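(* Assume all non-trivial zeros of $\zeta$ are simple, and fix $\beta,n\in\mathbb{N}$. The limit defining $\varpi^{(\beta)}_n(z)$ exists for $z\in\mathbb{H}$, the function $\varpi^{(\beta)}_n$ is holomorphic on $\mathbb{H}$, and for $z\in\mathbb{H}$ $$2\pi i\,\varpi^{(\beta)}_n(z)=\varpi^{(\beta)}_{1,n}(z)+\varpi^{(\beta)}_{2,n}(z)-e^{3z/2}\sum_{q=1}^\infty\frac{c_q^{(\beta)}(n)}{q^{3/2}(z-\log q)},$$ where $$\varpi^{(\beta)}_{1,n}(z)=\int_{-1/2+i\infty}^{-1/2}\frac{\sigma^{(\beta)}_{1-s/\beta}(n)}{\zeta(s)}e^{sz}\,ds$$ (integral along the vertical line $\operatorname{Re}s=-1/2$, downward) is analytic on $\mathbb{H}$, $$\varpi^{(\beta)}_{2,n}(z)=\int_{-1/2}^{3/2}\frac{\sigma^{(\beta)}_{1-s/\beta}(n)}{\zeta(s)}e^{sz}\,ds$$ (integral along the real segment) is entire, and the last term is a meromorphic function on all of $\mathbb{C}$ whose poles are at the points $z=\log q$ with $c_q^{(\beta)}(n)\neq0$.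
   Context: For $\beta,q,n\in\mathbb{N}$, $c_q^{(\beta)}(n)=\sum e^{2\pi i nh/q^\beta}$, the sum over integers $0\le h<q^\beta$ such that $h$ and $q^\beta$ have no common divisor of the form $d^\beta$ with $d>1$. For $z\in\mathbb{C}$, $\sigma_z^{(\beta)}(n)=\sum_{d\in\mathbb{N},\ d^\beta\mid n}d^{\beta z}$. $\mathbb{H}=\{z\in\mathbb{C}:\operatorname{Im}z>0\}$. Fix a sequence $(T_m)_{m\ge1}$ with $m\le T_m\le m+1$ and $|\zeta(\sigma\pm iT_m)|^{-1}<T_m^{c_1}$ for $-1\le\sigma\le2$, for an absolute constant $c_1$ (such a sequence exists). For $z\in\mathbb{H}$, $\varpi^{(\beta)}_n(z)=\lim_{m\to\infty}\sum_{\rho:\,0<\operatorname{Im}\rho<T_m}\frac{\sigma^{(\beta)}_{1-\rho/\beta}(n)}{\zeta'(\rho)}e^{\rho z}$, the sum over non-trivial zeros $\rho$ of $\zeta$. *)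

(* Defs.v *)
From Stdlib Require Import Reals List Arith Lra.
From Coquelicot Require Import Coquelicot.
Import ListNotations.
Open Scope R_scope.

Definition Cexp (z : C) : C :=
  (exp (fst z) * cos (snd z), exp (fst z) * sin (snd z)).

Definition cpow (d : nat) (w : C) : C := Cexp (Cmult w (RtoC (ln (INR d)))).

Definition csum (l : list C) : C := fold_right Cplus (RtoC 0) l.

Definition dvdb (a b : nat) : bool := Nat.eqb (b mod a) 0.

(* sigma^{(beta)}_z (n) = sum over d in N with d^beta | n of d^{beta z}.
   For n >= 1 and beta >= 1 every such d satisfies 1 <= d <= d^beta <= n. *)
Definition sigma_beta (beta : nat) (z : C) (n : nat) : C :=
  csum (map (fun d => cpow d (Cmult (RtoC (INR beta)) z))
            (filter (fun d => dvdb (d ^ beta) n) (seq 1 n))).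

(* h and q^beta have no common divisor of the form d^beta with d > 1.
   Any such d satisfies d <= d^beta <= q^beta (q >= 1, beta >= 1). *)
Definition beta_coprime (beta q h : nat) : bool :=
  forallb (fun d => negb (dvdb (d ^ beta) h && dvdb (d ^ beta) (q ^ beta)))
          (seq 2 (q ^ beta)).

Definition c_beta (beta q n : nat) : C :=
  csum (map (fun h => Cexp (Cmult Ci (RtoC (2 * PI * INR n * INR h / INR (q ^ beta)))))
            (filter (beta_coprime beta q) (seq 0 (q ^ beta)))).

(* non-trivial zero of zeta (the value at the pole s = 1 is excluded) *)
Definition nontrivial_zero (zeta : C -> C) (rho : C) : Prop :=
  rho <> RtoC 1 /\ zeta rho = RtoC 0 /\
  ~ (exists k : nat, (1 <= k)%nat /\ rho = RtoC (- 2 * INR k)).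

Definition is_finsum (P : C -> Prop) (f : C -> C) (S : C) : Prop :=
  exists l : list C, NoDup l /\ (forall x, In x l <-> P x) /\ S = csum (map f l).

Definition pole_term (beta n q : nat) (z : C) : C :=
  Cmult (c_beta beta q n)
        (Cinv (Cmult (RtoC (Rpower (INR q) (3/2)))
                     (Cminus z (RtoC (ln (INR q)))))).

(* Main.v *)
Require Import Defs.
From Stdlib Require Import Reals Lra Lia List Bool Arith Permutation Classical ClassicalEpsilon Factorial.
From Coquelicot Require Import Coquelicot.
Import ListNotations.
Open Scope R_scope.

(* Shift the line Re s = 3/2 to Re s = -1/2. Inside the rectangle of height T_m the integrand sigma/zeta * e^{sz}
   has simple poles at the zeros of zeta, so the residue theorem gives the partial sums of varpi; the top edge tends
   to 0 by the hypothesis on T_m and e^{-T_m Im z}, and on the right edge sigma/zeta = sum_q c_q(n) q^{-s} is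
   integrated term by term. The integrals over the two vertical half-lines are Laplace transforms at -iz, hence
   holomorphic, and varpi inherits holomorphy from the identity.

   Since zeta is only given as a continuation of its Dirichlet series, it is identified with the Euler-Maclaurin
   expression on Re s > -1. The Fourier series of {x}^2 - {x} turns this into zeta(s) = chi(s) zeta(1-s) for
   -1 < Re s < -1/2, where chi is the Mellin transform of cos y - 1 up to elementary factors. Its continuation to
   Re s > -1 has poles only at the odd positive integers, so the same identity read at Re s > 1 shows that
   zeta(1-s) does not vanish there and that 1/zeta(1-s) = chi(s)/zeta(s) grows polynomially on Re s = 3/2; no
   information on the Gamma function is needed. *)

(** * Complex derivatives *)


(** The edges of the rectangle shape the proof: zeta may vanish on none of them. On the left edge
    the functional equation ensures this off the real axis, but the bottom edge is the real segment
    itself, where an explicit bound on the Euler-Maclaurin integral excludes zeros. Since [zeta 1]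
    is an arbitrary value, the contour integrals are taken of [quot], which is built from [zetaW],
    that is (s-1) zeta(s). The quadratic {x}^2-{x} is preferred to {x} because it is continuous with
    an absolutely convergent Fourier series, so termwise integration rests on uniform bounds.
    Writing x = e^t turns Mellin into Laplace transforms: one operator [Lap], with one holomorphy
    lemma and one lemma on series, serves the continuation of zeta, the factor chi and the vertical
    half-lines. The identity theorem is applied along horizontal lines off the real axis, which
    avoids all real singularities at once; real points follow by continuity. Simplicity of the zeros
    gives the residues and also their isolation, hence finite sums up to T_m. *)

Lemma C_ext (a b : C) : fst a = fst b -> snd a = snd b -> a = b.
Proof. destruct a, b; simpl; intros; subst; auto. Qed.

Lemma Cmod_le_abs (z : C) : Cmod z <= Rabs (fst z) + Rabs (snd z).
Proof.
  assert (E : z = (RtoC (fst z) + Ci * RtoC (snd z))%C)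
    by (apply C_ext; simpl; ring).
  rewrite E at 1.
  eapply Rle_trans; [apply Cmod_triangle|].
  rewrite Cmod_mult, Cmod_Ci, !Cmod_R. lra.
Qed.

Lemma fst_le_Cmod (z : C) : Rabs (fst z) <= Cmod z.
Proof. eapply Rle_trans; [|apply Rmax_Cmod]. apply Rmax_l. Qed.

Lemma snd_le_Cmod (z : C) : Rabs (snd z) <= Cmod z.
Proof. eapply Rle_trans; [|apply Rmax_Cmod]. apply Rmax_r. Qed.

Lemma Cmod_sym (a b : C) : Cmod (a - b) = Cmod (b - a).
Proof. rewrite <- Cmod_opp. f_equal. ring. Qed.

Lemma Cmod_tri3 (a b c : C) : Cmod (a - c) <= Cmod (a - b) + Cmod (b - c).
Proof. replace (a - c)%C with ((a - b) + (b - c))%C by ring. apply Cmod_triangle. Qed.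

Lemma Cmod_rev (a b : C) : Cmod a - Cmod b <= Cmod (a - b).
Proof.
  assert (H := Cmod_triangle (a - b) b).
  replace (a - b + b)%C with a in H by ring. lra.
Qed.

Lemma Cmod_minus_0 (a b : C) : Cmod (a - b) = 0 -> a = b.
Proof.
  intros H. apply Cmod_eq_0 in H.
  replace a with ((a - b) + b)%C by ring. rewrite H. ring.
Qed.

Lemma Cminus_neq (a b : C) : a <> b -> (a - b)%C <> RtoC 0.
Proof. intros H E. apply H. apply Cmod_minus_0. rewrite E. apply Cmod_0. Qed.

Lemma RtoC_neq (a b : R) : a <> b -> RtoC a <> RtoC b.
Proof. intros H E. apply H. injection E; auto. Qed.

Lemma Cmod_pos (a : C) : a <> RtoC 0 -> 0 < Cmod a.
Proof. apply Cmod_gt_0. Qed.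

(** This default value lets [inv_zeta_W] and [Cinv_mult_total] hold also where a denominator
    vanishes. *)
Lemma Cinv_0 : Cinv (RtoC 0) = RtoC 0.
Proof.
  apply C_ext; simpl; unfold Rdiv; ring.
Qed.

Lemma Cmod_small_0 (a : C) : (forall eps, 0 < eps -> Cmod a <= eps) -> a = RtoC 0.
Proof.
  intros H. apply Cmod_eq_0. destruct (Rle_lt_or_eq_dec _ _ (Cmod_ge_0 a)); [|auto].
  specialize (H (Cmod a / 2)). lra.
Qed.

(* The uniform structure of [C] is that of the product (sup norm), not that of [Cmod]. *)
Lemma continuous_C_iff {T : UniformSpace} (f : T -> C) x :
  continuous (U := C_UniformSpace) f x <->
  (forall eps, 0 < eps -> locally x (fun y => Cmod (f y - f x) < eps)).
Proof.
  split.
  - intros H eps He.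
    assert (He2 : 0 < eps / 2) by lra.
    specialize (H (fun z => Cmod (z - f x) < eps)). apply H.
    exists (mkposreal _ He2). intros z [H1 H2].
    change (Rabs (fst z - fst (f x)) < eps / 2) in H1.
    change (Rabs (snd z - snd (f x)) < eps / 2) in H2.
    eapply Rle_lt_trans; [apply Cmod_le_abs|]. simpl.
    unfold Rminus in *. lra.
  - intros H P [e He].
    unfold filtermap. generalize (H e (cond_pos e)). apply filter_imp.
    intros y Hy. apply He. split.
    + change (Rabs (fst (f y) - fst (f x)) < e).
      eapply Rle_lt_trans; [|apply Hy]. apply (fst_le_Cmod (f y - f x)).
    + change (Rabs (snd (f y) - snd (f x)) < e).
      eapply Rle_lt_trans; [|apply Hy]. apply (snd_le_Cmod (f y - f x)).
Qed.

Lemma locally_C_iff (z : C) (P : C -> Prop) :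
  @locally C_UniformSpace z P <-> exists d, 0 < d /\ forall w, Cmod (w - z) < d -> P w.
Proof.
  split.
  - intros [e He]. exists e. split; [apply cond_pos|]. intros w Hw. apply He. split.
    + change (Rabs (fst w - fst z) < e).
      eapply Rle_lt_trans; [|apply Hw]. apply (fst_le_Cmod (w - z)).
    + change (Rabs (snd w - snd z) < e).
      eapply Rle_lt_trans; [|apply Hw]. apply (snd_le_Cmod (w - z)).
  - intros [d [Hd H]]. assert (Hd2 : 0 < d / 2) by lra.
    exists (mkposreal _ Hd2). intros w [H1 H2]. apply H.
    change (Rabs (fst w - fst z) < d / 2) in H1.
    change (Rabs (snd w - snd z) < d / 2) in H2.
    eapply Rle_lt_trans; [apply Cmod_le_abs|]. simpl. unfold Rminus in *. lra.
Qed.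

Notation Ccont := (continuous (T := C_UniformSpace) (U := C_UniformSpace)).
Notation curve_cont := (continuous (T := R_UniformSpace) (U := C_UniformSpace)).

Lemma Ccont_iff (f : C -> C) z :
  Ccont f z <-> (forall eps, 0 < eps -> exists d, 0 < d /\
     forall w, Cmod (w - z) < d -> Cmod (f w - f z) < eps).
Proof.
  rewrite continuous_C_iff. split; intros H eps He; apply locally_C_iff, H; auto.
Qed.

Lemma continuous_pair_iff {T : UniformSpace} (f : T -> C) x :
  continuous (U := C_UniformSpace) f x <->
  continuous (U := R_UniformSpace) (fun y => fst (f y)) x /\
  continuous (U := R_UniformSpace) (fun y => snd (f y)) x.
Proof.
  split.
  - intros H. split.
    + apply (continuous_comp (V := C_UniformSpace) f (fun z : C => fst z)); auto.
      apply (continuous_fst (U := R_UniformSpace) (V := R_UniformSpace)).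
    + apply (continuous_comp (V := C_UniformSpace) f (fun z : C => snd z)); auto.
      apply (continuous_snd (U := R_UniformSpace) (V := R_UniformSpace)).
  - intros [H1 H2]. apply continuous_C_iff. intros eps He.
    assert (He2 : 0 < eps / 2) by lra.
    assert (A : locally x (fun y => Rabs (fst (f y) - fst (f x)) < eps / 2)).
    { apply (H1 (fun v => Rabs (v - fst (f x)) < eps / 2)).
      exists (mkposreal _ He2). intros v Hv; exact Hv. }
    assert (B : locally x (fun y => Rabs (snd (f y) - snd (f x)) < eps / 2)).
    { apply (H2 (fun v => Rabs (v - snd (f x)) < eps / 2)).
      exists (mkposreal _ He2). intros v Hv; exact Hv. }
    generalize (filter_and _ _ A B). apply filter_imp. clear A B. intros y [A B].
    eapply Rle_lt_trans; [apply Cmod_le_abs|]. simpl. unfold Rminus in *. lra.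
Qed.

Lemma cont_ext {T : UniformSpace} (f g : T -> C) x : (forall t, f t = g t) ->
  continuous (U := C_UniformSpace) f x -> continuous (U := C_UniformSpace) g x.
Proof. intros E. apply continuous_ext. exact E. Qed.

Lemma cont_plus {T : UniformSpace} (f g : T -> C) x :
  continuous (U := C_UniformSpace) f x -> continuous (U := C_UniformSpace) g x ->
  continuous (U := C_UniformSpace) (fun t => Cplus (f t) (g t)) x.
Proof.
  rewrite !continuous_pair_iff. intros [A B] [C D]. split; simpl.
  - apply (continuous_plus (V := R_NormedModule)); auto.
  - apply (continuous_plus (V := R_NormedModule)); auto.
Qed.

Lemma cont_opp {T : UniformSpace} (f : T -> C) x :
  continuous (U := C_UniformSpace) f x ->
  continuous (U := C_UniformSpace) (fun t => Copp (f t)) x.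
Proof.
  rewrite !continuous_pair_iff. intros [A B]. split; simpl.
  - apply (continuous_opp (V := R_NormedModule)); auto.
  - apply (continuous_opp (V := R_NormedModule)); auto.
Qed.

Lemma cont_minus {T : UniformSpace} (f g : T -> C) x :
  continuous (U := C_UniformSpace) f x -> continuous (U := C_UniformSpace) g x ->
  continuous (U := C_UniformSpace) (fun t => Cminus (f t) (g t)) x.
Proof. intros. apply cont_plus; auto. apply cont_opp; auto. Qed.

Lemma cont_mult {T : UniformSpace} (f g : T -> C) x :
  continuous (U := C_UniformSpace) f x -> continuous (U := C_UniformSpace) g x ->
  continuous (U := C_UniformSpace) (fun t => Cmult (f t) (g t)) x.
Proof.
  rewrite !continuous_pair_iff. intros [A B] [C D]. split; simpl.
  - apply (continuous_minus (V := R_NormedModule));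
      apply (continuous_mult (K := R_AbsRing)); auto.
  - apply (continuous_plus (V := R_NormedModule));
      apply (continuous_mult (K := R_AbsRing)); auto.
Qed.

Lemma cont_const {T : UniformSpace} (c : C) (x : T) :
  continuous (U := C_UniformSpace) (fun _ => c) x.
Proof. apply continuous_const. Qed.

Lemma cont_inv {T : UniformSpace} (f : T -> C) x :
  f x <> RtoC 0 -> continuous (U := C_UniformSpace) f x ->
  continuous (U := C_UniformSpace) (fun t => Cinv (f t)) x.
Proof.
  intros H0 Hf.
  assert (Hm := Cmod_pos _ H0). rewrite continuous_C_iff in Hf.
  apply continuous_C_iff. intros eps He.
  assert (E1 : 0 < Cmod (f x) / 2) by lra.
  assert (E2 : 0 < eps * (Cmod (f x) * Cmod (f x) / 2)).
  { apply Rmult_lt_0_compat; auto. unfold Rdiv. repeat apply Rmult_lt_0_compat; lra. }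
  generalize (filter_and _ _ (Hf _ E1) (Hf _ E2)). apply filter_imp.
  intros y [A B].
  assert (C1 : Cmod (f x) / 2 < Cmod (f y)).
  { rewrite Cmod_sym in A. assert (Z := Cmod_rev (f x) (f y)). lra. }
  assert (Hy : f y <> RtoC 0) by (intros E; rewrite E, Cmod_0 in C1; lra).
  replace (/ f y - / f x)%C with (- (f y - f x) / (f y * f x))%C by (field; auto).
  rewrite Cmod_div by (apply Cmult_neq_0; auto).
  rewrite Cmod_opp, Cmod_mult.
  apply (Rmult_lt_reg_r (Cmod (f y) * Cmod (f x))).
  { apply Rmult_lt_0_compat; lra. }
  unfold Rdiv. rewrite Rmult_assoc, Rinv_l by (apply Rgt_not_eq, Rmult_lt_0_compat; lra).
  rewrite Rmult_1_r. eapply Rlt_trans; [apply B|].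
  apply Rmult_lt_compat_l; auto.
  replace (Cmod (f x) * Cmod (f x) / 2) with ((Cmod (f x) / 2) * Cmod (f x)) by field.
  apply Rmult_lt_compat_r; auto.
Qed.

(** * The complex exponential *)

Lemma Cexp_add (a b : C) : Cexp (a + b) = (Cexp a * Cexp b)%C.
Proof.
  unfold Cexp. apply C_ext; simpl; rewrite exp_plus, ?cos_plus, ?sin_plus; ring.
Qed.

Lemma Cexp_0 : Cexp (RtoC 0) = RtoC 1.
Proof. unfold Cexp. apply C_ext; simpl; rewrite exp_0, ?cos_0, ?sin_0; ring. Qed.

Lemma Cexp_R (x : R) : Cexp (RtoC x) = RtoC (exp x).
Proof. unfold Cexp. apply C_ext; simpl; rewrite ?cos_0, ?sin_0; ring. Qed.

Lemma Cmod_Cexp (z : C) : Cmod (Cexp z) = exp (fst z).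
Proof.
  unfold Cmod, Cexp; simpl.
  replace (_ + _) with (exp (fst z) * exp (fst z) * (Rsqr (sin (snd z)) + Rsqr (cos (snd z))))
    by (unfold Rsqr; ring).
  rewrite sin2_cos2, Rmult_1_r. apply sqrt_square. left; apply exp_pos.
Qed.

Lemma Cexp_neq0 (z : C) : Cexp z <> RtoC 0.
Proof.
  intros E. assert (H := Cmod_Cexp z). rewrite E, Cmod_0 in H.
  assert (Z := exp_pos (fst z)). lra.
Qed.

Lemma Cexp_opp (z : C) : Cexp (- z) = Cinv (Cexp z).
Proof.
  assert (H : (Cexp z * Cexp (- z))%C = RtoC 1).
  { rewrite <- Cexp_add. replace (z + - z)%C with (RtoC 0) by ring. apply Cexp_0. }
  assert (Z := Cexp_neq0 z).
  replace (Cexp (- z)) with (/ Cexp z * (Cexp z * Cexp (- z)))%C by (field; auto).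
  rewrite H. ring.
Qed.

(** An epsilon-delta form of [is_derive] over [C_AbsRing], in terms of [Cmod], in which the
    estimates below are made; [Cder_is_derive] leads back to the library notion. *)
Definition Cder (f : C -> C) (z l : C) : Prop :=
  forall eps, 0 < eps -> exists d, 0 < d /\
    forall w, Cmod (w - z) < d -> Cmod (f w - f z - l * (w - z)) <= eps * Cmod (w - z).

Lemma Cder_is_derive (f : C -> C) (z l : C) :
  Cder f z l <-> is_derive (K := C_AbsRing) f z l.
Proof.
  assert (E : forall w, scal (K := C_AbsRing) (V := C_NormedModule) (minus w z) l
              = Cmult l (w - z)).
  { intros w. change (Cmult (w - z) l = Cmult l (w - z)). ring. }
  split.
  - intros H. split; [apply is_linear_scal_l|].
    intros x Hx. apply (is_filter_lim_locally_unique (V := AbsRing_NormedModule C_AbsRing)) in Hx. subst x.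
    intros eps. destruct (H eps (cond_pos eps)) as [d [Hd Hw]].
    exists (mkposreal _ Hd). intros w Bw.
    rewrite E. exact (Hw w Bw).
  - intros [_ H] eps He.
    destruct (H z (fun P HP => HP) (mkposreal _ He)) as [d Hd].
    exists d. split; [apply cond_pos|]. intros w Hw.
    specialize (Hd w Hw). rewrite E in Hd. exact Hd.
Qed.

Definition Chol (f : C -> C) (z : C) : Prop := exists l, Cder f z l.

Lemma Chol_ex_derive (f : C -> C) z : Chol f z <-> ex_derive (K := C_AbsRing) f z.
Proof.
  split; intros [l H]; exists l; apply Cder_is_derive; auto.
Qed.

(** Caratheodory's form of differentiability: the difference quotient extends continuously. Product
    and chain rule then become algebraic identities between continuous factors, without division by
    [w - z]. *)
Lemma Cder_cara (f : C -> C) (z l : C) :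
  Cder f z l <-> exists phi : C -> C, phi z = l /\ Ccont phi z /\
    forall w, (f w - f z = phi w * (w - z))%C.
Proof.
  split.
  - intros H.
    exists (fun w => if excluded_middle_informative (w = z) then l else ((f w - f z) / (w - z))%C).
    split; [|split].
    + destruct excluded_middle_informative; tauto.
    + apply Ccont_iff. intros eps He.
      destruct (H (eps / 2) ltac:(lra)) as [d [Hd Hw]].
      exists d. split; auto. intros w Bw.
      destruct (excluded_middle_informative (z = z)) as [_|n]; [|tauto].
      destruct (excluded_middle_informative (w = z)) as [->|n].
      * replace (l - l)%C with (RtoC 0) by ring. rewrite Cmod_0. lra.
      * assert (N := Cminus_neq _ _ n). specialize (Hw w Bw).
        replace ((f w - f z) / (w - z) - l)%C with ((f w - f z - l * (w - z)) / (w - z))%C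
          by (field; auto).
        rewrite Cmod_div by auto. assert (P := Cmod_pos _ N).
        apply (Rmult_lt_reg_r (Cmod (w - z))); auto.
        unfold Rdiv. rewrite Rmult_assoc, Rinv_l by lra.
        rewrite Rmult_1_r. eapply Rle_lt_trans; [apply Hw|].
        apply Rmult_lt_compat_r; lra.
    + intros w. destruct excluded_middle_informative as [->|n].
      * ring.
      * assert (N := Cminus_neq _ _ n). field. auto.
  - intros [phi [E [Hc Hp]]] eps He. rewrite Ccont_iff in Hc.
    destruct (Hc eps He) as [d [Hd Hw]]. exists d. split; auto.
    intros w Bw. rewrite Hp, <- E.
    replace (phi w * (w - z) - phi z * (w - z))%C with ((phi w - phi z) * (w - z))%C by ring.
    rewrite Cmod_mult. apply Rmult_le_compat_r; [apply Cmod_ge_0|].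
    left. auto.
Qed.

Lemma Ccont_id z : Ccont (fun w => w) z.
Proof. apply continuous_id. Qed.

Lemma Cder_cont f z l : Cder f z l -> Ccont f z.
Proof.
  rewrite Cder_cara. intros [phi [E [Hc Hp]]].
  apply (cont_ext (T := C_UniformSpace) (fun w => Cplus (Cmult (phi w) (w - z)) (f z))).
  - intros w. rewrite <- Hp. ring.
  - apply cont_plus; [|apply cont_const]. apply cont_mult; auto.
    apply cont_minus; [apply Ccont_id|apply cont_const].
Qed.

Lemma Chol_cont f z : Chol f z -> Ccont f z.
Proof. intros [l H]. eapply Cder_cont; eauto. Qed.

Lemma Cder_const c z : Cder (fun _ => c) z 0.
Proof.
  intros eps He. exists 1. split; [lra|]. intros w _.
  replace (c - c - 0 * (w - z))%C with (RtoC 0) by ring. rewrite Cmod_0.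
  apply Rmult_le_pos; [lra|apply Cmod_ge_0].
Qed.

Lemma Cder_id z : Cder (fun w => w) z 1.
Proof.
  intros eps He. exists 1. split; [lra|]. intros w _.
  replace (w - z - 1 * (w - z))%C with (RtoC 0) by ring. rewrite Cmod_0.
  apply Rmult_le_pos; [lra|apply Cmod_ge_0].
Qed.

Lemma Cder_plus f g z a b : Cder f z a -> Cder g z b -> Cder (fun w => Cplus (f w) (g w)) z (a + b)%C.
Proof.
  rewrite !Cder_cara. intros [p [E [Hc Hp]]] [q [E' [Hc' Hp']]].
  exists (fun w => Cplus (p w) (q w)). split; [congruence|split].
  - apply cont_plus; auto.
  - intros w. transitivity ((f w - f z) + (g w - g z))%C; [ring|].
    rewrite Hp, Hp'. ring.
Qed.

Lemma Cder_mult f g z a b : Cder f z a -> Cder g z b ->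
  Cder (fun w => Cmult (f w) (g w)) z (a * g z + f z * b)%C.
Proof.
  intros Hf Hg. assert (Cg := Cder_cont _ _ _ Hg).
  revert Hf Hg.
  rewrite !Cder_cara. intros [p [E [Hc Hp]]] [q [E' [Hc' Hp']]].
  exists (fun w => Cplus (Cmult (p w) (g w)) (Cmult (f z) (q w))). split; [congruence|split].
  - apply cont_plus; apply cont_mult; auto. apply cont_const.
  - intros w. transitivity ((f w - f z) * g w + f z * (g w - g z))%C; [ring|].
    rewrite Hp, Hp'. ring.
Qed.

Lemma Cder_comp f g z a b : Cder f (g z) a -> Cder g z b ->
  Cder (fun w => f (g w)) z (a * b)%C.
Proof.
  intros Hf Hg. assert (Cg := Cder_cont _ _ _ Hg).
  revert Hf Hg.
  rewrite !Cder_cara. intros [p [E [Hc Hp]]] [q [E' [Hc' Hp']]].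
  exists (fun w => Cmult (p (g w)) (q w)). split; [congruence|split].
  - apply cont_mult; auto. apply (continuous_comp g p); auto.
  - intros w. rewrite Hp, Hp'. ring.
Qed.

Lemma Cder_ext_loc f g z l : (exists d, 0 < d /\ forall w, Cmod (w - z) < d -> f w = g w) ->
  Cder f z l -> Cder g z l.
Proof.
  intros [d [Hd E]] H eps He. destruct (H eps He) as [d' [Hd' Hw]].
  exists (Rmin d d'). split; [apply Rmin_pos; auto|].
  intros w Bw. rewrite <- !E; [apply Hw|..].
  - eapply Rlt_le_trans; [apply Bw|apply Rmin_r].
  - replace (z - z)%C with (RtoC 0) by ring. rewrite Cmod_0; auto.
  - eapply Rlt_le_trans; [apply Bw|apply Rmin_l].
Qed.

Lemma Cder_ext f g z l : (forall w, f w = g w) -> Cder f z l -> Cder g z l.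
Proof. intros E. apply Cder_ext_loc. exists 1. split; auto; lra. Qed.

Lemma Ccont_neq0 f z : Ccont f z -> f z <> RtoC 0 ->
  exists d, 0 < d /\ forall w, Cmod (w - z) < d -> f w <> RtoC 0.
Proof.
  rewrite Ccont_iff. intros H N. assert (P := Cmod_pos _ N).
  destruct (H _ P) as [d [Hd Hw]]. exists d. split; auto.
  intros w Bw E. specialize (Hw w Bw). rewrite E in Hw.
  replace (0 - f z)%C with (- f z)%C in Hw by ring. rewrite Cmod_opp in Hw. lra.
Qed.

Lemma Cder_inv_id z : z <> RtoC 0 -> Cder Cinv z (- / (z * z))%C.
Proof.
  intros N.
  destruct (Ccont_neq0 _ _ (Ccont_id z) N) as [d [Hd Hw]].
  (* The factorisation has to hold for every [w], also for 0, where [Cinv] has the default value 0.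
     There [g] takes instead the value 2/z that fits the chosen factor; near [z] nothing changes. *)
  set (g := fun w => if excluded_middle_informative (w = RtoC 0) then (/ z - w / (z * z) + / z)%C else Cinv w).
  apply (Cder_ext_loc g).
  { exists d. split; auto. intros w Bw. unfold g.
    destruct excluded_middle_informative; auto. exfalso; eapply Hw; eauto. }
  apply Cder_cara.
  exists (fun w => if excluded_middle_informative (w = RtoC 0) then (- / (z * z))%C else Copp (Cmult (/ w) (/ z))).
  split; [|split].
  - destruct excluded_middle_informative; [tauto|]. field; auto.
  - apply Ccont_iff. assert (HC : Ccont (fun w => Copp (Cmult (/ w) (/ z))) z).
    { apply cont_opp, cont_mult; [|apply cont_const]. apply cont_inv; [auto|apply Ccont_id]. }
    rewrite Ccont_iff in HC. intros eps He. destruct (HC eps He) as [d' [Hd' Hw']].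
    exists (Rmin d d'). split; [apply Rmin_pos; auto|].
    intros w Bw.
    destruct (excluded_middle_informative (z = RtoC 0)); [tauto|].
    destruct (excluded_middle_informative (w = RtoC 0)).
    + exfalso. apply (Hw w); auto. eapply Rlt_le_trans; [apply Bw|apply Rmin_l].
    + apply Hw'. eapply Rlt_le_trans; [apply Bw|apply Rmin_r].
  - intros w. unfold g.
    destruct (excluded_middle_informative (z = RtoC 0)); [tauto|].
    destruct (excluded_middle_informative (w = RtoC 0)); field; auto.
Qed.

Lemma Chol_const c z : Chol (fun _ => c) z. Proof. eexists; apply Cder_const. Qed.
Lemma Chol_id z : Chol (fun w => w) z. Proof. eexists; apply Cder_id. Qed.
Lemma Chol_plus f g z : Chol f z -> Chol g z -> Chol (fun w => Cplus (f w) (g w)) z.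
Proof. intros [a A] [b B]. eexists. apply Cder_plus; eauto. Qed.
Lemma Chol_mult f g z : Chol f z -> Chol g z -> Chol (fun w => Cmult (f w) (g w)) z.
Proof. intros [a A] [b B]. eexists. apply Cder_mult; eauto. Qed.
Lemma Chol_comp f g z : Chol f (g z) -> Chol g z -> Chol (fun w => f (g w)) z.
Proof. intros [a A] [b B]. eexists. apply Cder_comp; eauto. Qed.
Lemma Chol_ext f g z : (forall w, f w = g w) -> Chol f z -> Chol g z.
Proof. intros E [a A]. exists a. eapply Cder_ext; eauto. Qed.
Lemma Chol_ext_loc f g z : (exists d, 0 < d /\ forall w, Cmod (w - z) < d -> f w = g w) ->
  Chol f z -> Chol g z.
Proof. intros E [a A]. exists a. eapply Cder_ext_loc; eauto. Qed.
Lemma Chol_opp f z : Chol f z -> Chol (fun w => Copp (f w)) z.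
Proof.
  intros H. apply (Chol_ext (fun w => Cmult (-(1))%C (f w))); [intros; ring|].
  apply Chol_mult; auto. apply Chol_const.
Qed.
Lemma Chol_minus f g z : Chol f z -> Chol g z -> Chol (fun w => Cminus (f w) (g w)) z.
Proof. intros. apply Chol_plus; auto. apply Chol_opp; auto. Qed.
Lemma Chol_inv f z : f z <> RtoC 0 -> Chol f z -> Chol (fun w => Cinv (f w)) z.
Proof. intros N H. apply (Chol_comp Cinv f); auto. eexists; apply Cder_inv_id; auto. Qed.

(** Takes the place of differentiation under integrals and sums: for [Cexp], [Lap], [Polar] and
    integrals over a segment a candidate derivative is named and the second-order remainder
    bounded. *)
Lemma Cder_quadratic f z l M d : 0 < d ->
  (forall w, Cmod (w - z) < d -> Cmod (f w - f z - l * (w - z)) <= M * (Cmod (w - z) * Cmod (w - z))) ->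
  Cder f z l.
Proof.
  intros Hd H eps He.
  assert (HM : 0 < Rabs M + 1) by (assert (Z := Rabs_pos M); lra).
  exists (Rmin d (eps / (Rabs M + 1))). split.
  { apply Rmin_pos; auto. apply Rdiv_lt_0_compat; auto. }
  intros w Bw.
  assert (B1 := Rlt_le_trans _ _ _ Bw (Rmin_l _ _)).
  assert (B2 := Rlt_le_trans _ _ _ Bw (Rmin_r _ _)).
  eapply Rle_trans; [apply H; auto|].
  assert (P := Cmod_ge_0 (w - z)).
  rewrite <- Rmult_assoc. apply Rmult_le_compat_r; auto.
  apply Rle_trans with ((Rabs M + 1) * Cmod (w - z)).
  - apply Rmult_le_compat_r; auto. assert (Z := Rle_abs M). lra.
  - apply (Rmult_lt_compat_l (Rabs M + 1)) in B2; auto.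
    replace ((Rabs M + 1) * (eps / (Rabs M + 1))) with eps in B2 by (field; lra). lra.
Qed.

(** * Integrals along curves *)


Notation is_CI := (is_RInt (V := C_R_NormedModule)).
Notation ex_CI := (ex_RInt (V := C_R_NormedModule)).
Definition CI (f : R -> C) (a b : R) : C := RInt (V := C_R_CompleteNormedModule) f a b.

Lemma is_CI_pair f a b (l : C) : is_CI f a b l <->
  is_RInt (fun t => fst (f t)) a b (fst l) /\ is_RInt (fun t => snd (f t)) a b (snd l).
Proof.
  split.
  - intros H. split.
    + exact (is_RInt_fct_extend_fst (U := R_NormedModule) (V := R_NormedModule) f a b l H).
    + exact (is_RInt_fct_extend_snd (U := R_NormedModule) (V := R_NormedModule) f a b l H).
  - intros [H1 H2].
    rewrite (surjective_pairing l).
    exact (is_RInt_fct_extend_pair (U := R_NormedModule) (V := R_NormedModule) f a b (fst l) (snd l) H1 H2).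
Qed.

Lemma CI_correct f a b : ex_CI f a b -> is_CI f a b (CI f a b).
Proof. apply (RInt_correct (V := C_R_CompleteNormedModule)). Qed.

Lemma CI_unique f a b l : is_CI f a b l -> CI f a b = l.
Proof. apply (is_RInt_unique (V := C_R_CompleteNormedModule)). Qed.

Lemma ex_CI_cont f a b : (forall t, Rmin a b <= t <= Rmax a b -> curve_cont f t) -> ex_CI f a b.
Proof. apply (ex_RInt_continuous (V := C_R_CompleteNormedModule)). Qed.

Lemma ex_CI_all f a b : (forall t, curve_cont f t) -> ex_CI f a b.
Proof. intros H; apply ex_CI_cont; auto. Qed.

Lemma is_CI_plus f g a b l m : is_CI f a b l -> is_CI g a b m ->
  is_CI (fun t => Cplus (f t) (g t)) a b (l + m)%C.
Proof. apply (is_RInt_plus (V := C_R_NormedModule)). Qed.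

Lemma is_CI_scal c f a b l : is_CI f a b l -> is_CI (fun t => Cmult c (f t)) a b (c * l)%C.
Proof.
  rewrite !is_CI_pair. intros [H1 H2]. simpl. split.
  - apply (is_RInt_minus (V := R_NormedModule)); apply (is_RInt_scal (V := R_NormedModule)); auto.
  - apply (is_RInt_plus (V := R_NormedModule)); apply (is_RInt_scal (V := R_NormedModule)); auto.
Qed.

Lemma is_CI_const (c : C) a b : is_CI (fun _ => c) a b (RtoC (b - a) * c)%C.
Proof.
  apply is_CI_pair. simpl. split.
  - replace ((b - a) * fst c - 0 * snd c) with (scal (b - a) (fst c))
      by (unfold scal; simpl; unfold mult; simpl; ring).
    apply (is_RInt_const (V := R_NormedModule)).
  - replace ((b - a) * snd c + 0 * fst c) with (scal (b - a) (snd c))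
      by (unfold scal; simpl; unfold mult; simpl; ring).
    apply (is_RInt_const (V := R_NormedModule)).
Qed.

Lemma is_CI_ext f g a b l : (forall t, Rmin a b < t < Rmax a b -> f t = g t) ->
  is_CI f a b l -> is_CI g a b l.
Proof. apply (is_RInt_ext (V := C_R_NormedModule)). Qed.

Lemma is_CI_chasles f a b c l m : is_CI f a b l -> is_CI f b c m -> is_CI f a c (l + m)%C.
Proof. apply (is_RInt_Chasles (V := C_R_NormedModule)). Qed.

Lemma ex_CI_scal c f a b : ex_CI f a b -> ex_CI (fun t => Cmult c (f t)) a b.
Proof. intros [l H]. eexists. apply is_CI_scal; eauto. Qed.

Lemma CI_plus f g a b : ex_CI f a b -> ex_CI g a b ->
  CI (fun t => Cplus (f t) (g t)) a b = (CI f a b + CI g a b)%C.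
Proof. intros. apply CI_unique, is_CI_plus; apply CI_correct; auto. Qed.

Lemma CI_scal c f a b : ex_CI f a b -> CI (fun t => Cmult c (f t)) a b = (c * CI f a b)%C.
Proof. intros. apply CI_unique, is_CI_scal, CI_correct; auto. Qed.

Lemma CI_ext f g a b : (forall t, Rmin a b < t < Rmax a b -> f t = g t) -> CI f a b = CI g a b.
Proof. apply (RInt_ext (V := C_R_CompleteNormedModule)). Qed.

Lemma CI_ext_all f g a b : (forall t, f t = g t) -> CI f a b = CI g a b.
Proof. intros H; apply CI_ext; auto. Qed.

Lemma CI_minus f g a b : ex_CI f a b -> ex_CI g a b ->
  CI (fun t => Cminus (f t) (g t)) a b = (CI f a b - CI g a b)%C.
Proof.
  intros H K. transitivity (CI f a b + CI (fun t => Cmult (-(1)) (g t)) a b)%C.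
  - rewrite <- CI_plus; auto. 2: apply ex_CI_scal; auto.
    apply CI_ext_all; intros; ring.
  - rewrite CI_scal by auto. ring.
Qed.

Lemma CI_chasles f a b c : ex_CI f a b -> ex_CI f b c -> (CI f a b + CI f b c)%C = CI f a c.
Proof. apply (RInt_Chasles (V := C_R_CompleteNormedModule)). Qed.

Lemma CI_swap f a b : ex_CI f a b -> CI f b a = (- CI f a b)%C.
Proof.
  intros H. apply CI_unique. apply (is_RInt_swap (V := C_R_NormedModule)). apply CI_correct; auto.
Qed.

Lemma CI_point f a : CI f a a = RtoC 0.
Proof. apply (RInt_point (V := C_R_CompleteNormedModule)). Qed.

(** The topology of the product is that of the sup norm, but the norm of the product module is
    Euclidean. Library bounds for integrals therefore apply to [Cmod] without loss of a constant. *)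
Lemma norm_C_R (z : C) : norm (V := C_R_NormedModule) z = Cmod z.
Proof.
  unfold Cmod. change (sqrt (Rabs (fst z) ^ 2 + Rabs (snd z) ^ 2) = sqrt (fst z ^ 2 + snd z ^ 2)).
  rewrite !pow2_abs. reflexivity.
Qed.

Lemma CI_bound f a b M : a <= b -> ex_CI f a b ->
  (forall t, a <= t <= b -> Cmod (f t) <= M) -> Cmod (CI f a b) <= (b - a) * M.
Proof.
  intros Hab He Hb.
  assert (N := norm_C_R).
  rewrite <- N. apply (norm_RInt_le_const (V := C_R_NormedModule) f); auto.
  - intros t Ht. rewrite N; auto.
  - apply CI_correct; auto.
Qed.

Notation curve_der := (is_derive (K := R_AbsRing) (V := C_R_NormedModule)).

Lemma CI_FTC F f a b :
  (forall t, Rmin a b <= t <= Rmax a b -> curve_der F t (f t)) ->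
  (forall t, Rmin a b <= t <= Rmax a b -> curve_cont f t) ->
  is_CI f a b (F b - F a)%C.
Proof. intros H K. apply (is_RInt_derive (V := C_R_CompleteNormedModule)); auto. Qed.

Lemma curve_der_intro F t (l : C) :
  (forall eps, 0 < eps -> exists d, 0 < d /\ forall u, Rabs (u - t) < d ->
     Cmod (F u - F t - l * RtoC (u - t)) <= eps * Rabs (u - t)) -> curve_der F t l.
Proof.
  intros H. split; [apply is_linear_scal_l|].
  intros x Hx. apply (is_filter_lim_locally_unique (V := R_NormedModule)) in Hx. subst x.
  intros eps. destruct (H eps (cond_pos eps)) as [d [Hd Hw]].
  exists (mkposreal _ Hd). intros u Bu.
  assert (N := norm_C_R).
  rewrite N. specialize (Hw u Bu).
  match goal with |- Cmod ?X <= _ => replace X with (F u - F t - l * RtoC (u - t))%C end.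
  - exact Hw.
  - apply C_ext.
    + change (fst (F u - F t - l * RtoC (u - t))%C = fst (F u) - fst (F t) - (u - t) * fst l). simpl. ring.
    + change (snd (F u - F t - l * RtoC (u - t))%C = snd (F u) - snd (F t) - (u - t) * snd l). simpl. ring.
Qed.

Lemma Cder_line F (p v : C) t l : Cder F (p + RtoC t * v)%C l ->
  curve_der (fun u => F (p + RtoC u * v)%C) t (l * v)%C.
Proof.
  intros H. apply curve_der_intro. intros eps He.
  assert (Hv : 0 < Cmod v + 1) by (assert (Z := Cmod_ge_0 v); lra).
  destruct (H (eps / (Cmod v + 1))) as [d [Hd Hw]].
  { apply Rdiv_lt_0_compat; auto. }
  exists (d / (Cmod v + 1)). split; [apply Rdiv_lt_0_compat; auto|].
  intros u Bu.
  assert (E : ((p + RtoC u * v) - (p + RtoC t * v))%C = (RtoC (u - t) * v)%C).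
  { apply C_ext; simpl; ring. }
  specialize (Hw (p + RtoC u * v)%C). rewrite E, Cmod_mult, Cmod_R in Hw.
  replace (l * v * RtoC (u - t))%C with (l * (RtoC (u - t) * v))%C by ring.
  apply (Rmult_lt_compat_r (Cmod v + 1)) in Bu; auto.
  replace (d / (Cmod v + 1) * (Cmod v + 1)) with d in Bu by (field; lra).
  assert (Z := Rabs_pos (u - t)).
  eapply Rle_trans; [apply Hw|].
  - rewrite Rmult_plus_distr_l in Bu. lra.
  - replace (eps * Rabs (u - t)) with (eps / (Cmod v + 1) * (Rabs (u - t) * (Cmod v + 1))) by (field; lra).
    apply Rmult_le_compat_l; [left; apply Rdiv_lt_0_compat; auto|].
    apply Rmult_le_compat_l; lra.
Qed.

Lemma curve_hor_cont c t : curve_cont (fun u : R => (u, c)) t.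
Proof. apply continuous_pair_iff. split; simpl; [apply continuous_id|apply continuous_const]. Qed.

Lemma curve_ver_cont c t : curve_cont (fun u : R => (c, u)) t.
Proof. apply continuous_pair_iff. split; simpl; [apply continuous_const|apply continuous_id]. Qed.

Lemma curve_comp_cont f g t : curve_cont g t -> Ccont f (g t) -> curve_cont (fun u => f (g u)) t.
Proof. intros. apply (continuous_comp g f); auto. Qed.

(* Counterclockwise integral along the boundary of [a,b] x [c,d]. *)
Definition rint (f : C -> C) (a b c d : R) : C :=
  (CI (fun x => f (x, c)) a b + Ci * CI (fun y => f (b, y)) c d
   - CI (fun x => f (x, d)) a b - Ci * CI (fun y => f (a, y)) c d)%C.

Definition contR (f : C -> C) a b c d :=
  forall x y, a <= x <= b -> c <= y <= d -> Ccont f (x, y).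

Lemma hor_cont f (x y : R) : Ccont f (x, y) -> curve_cont (fun u => f (u, y)) x.
Proof. intros. apply (curve_comp_cont f (fun u : R => (u, y))); auto. apply curve_hor_cont. Qed.

Lemma ver_cont f (x y : R) : Ccont f (x, y) -> curve_cont (fun u => f (x, u)) y.
Proof. intros. apply (curve_comp_cont f (fun u : R => (x, u))); auto. apply curve_ver_cont. Qed.

Lemma hor_ex f a b y : a <= b -> (forall x, a <= x <= b -> Ccont f (x, y)) -> ex_CI (fun u => f (u, y)) a b.
Proof.
  intros Hab H. apply ex_CI_cont. rewrite Rmin_left, Rmax_right by auto.
  intros; apply hor_cont; auto.
Qed.

Lemma ver_ex f x c d : c <= d -> (forall y, c <= y <= d -> Ccont f (x, y)) -> ex_CI (fun u => f (x, u)) c d.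
Proof.
  intros Hab H. apply ex_CI_cont. rewrite Rmin_left, Rmax_right by auto.
  intros; apply ver_cont; auto.
Qed.

(** Only the four edges are concerned: the integrand may have singularities inside, and [rint] sees
    no more than the boundary. *)
Definition contB (f : C -> C) a b c d :=
  (forall x, a <= x <= b -> Ccont f (x, c) /\ Ccont f (x, d)) /\
  (forall y, c <= y <= d -> Ccont f (a, y) /\ Ccont f (b, y)).

Lemma contR_B f a b c d : a <= b -> c <= d -> contR f a b c d -> contB f a b c d.
Proof. intros Hab Hcd H. split; intros; split; apply H; lra. Qed.

Lemma contB_plus f g a b c d : contB f a b c d -> contB g a b c d ->
  contB (fun z => Cplus (f z) (g z)) a b c d.
Proof.
  intros [F1 F2] [G1 G2]. split.
  - intros x Hx. destruct (F1 x Hx), (G1 x Hx). split; apply (cont_plus (T := C_UniformSpace)); auto.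
  - intros y Hy. destruct (F2 y Hy), (G2 y Hy). split; apply (cont_plus (T := C_UniformSpace)); auto.
Qed.

Lemma contB_mult f g a b c d : contB f a b c d -> contB g a b c d ->
  contB (fun z => Cmult (f z) (g z)) a b c d.
Proof.
  intros [F1 F2] [G1 G2]. split.
  - intros x Hx. destruct (F1 x Hx), (G1 x Hx). split; apply (cont_mult (T := C_UniformSpace)); auto.
  - intros y Hy. destruct (F2 y Hy), (G2 y Hy). split; apply (cont_mult (T := C_UniformSpace)); auto.
Qed.

Lemma contB_ex f a b c d : a <= b -> c <= d -> contB f a b c d ->
  ex_CI (fun x => f (x, c)) a b /\ ex_CI (fun y => f (b, y)) c d /\
  ex_CI (fun x => f (x, d)) a b /\ ex_CI (fun y => f (a, y)) c d.
Proof.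
  intros Hab Hcd [H K]. refine (conj _ (conj _ (conj _ _))).
  - apply hor_ex; auto. intros; apply H; auto.
  - apply ver_ex; auto. intros; apply K; auto.
  - apply hor_ex; auto. intros; apply H; auto.
  - apply ver_ex; auto. intros; apply K; auto.
Qed.

Lemma rint_plus f g a b c d : a <= b -> c <= d -> contB f a b c d -> contB g a b c d ->
  rint (fun z => Cplus (f z) (g z)) a b c d = (rint f a b c d + rint g a b c d)%C.
Proof.
  intros Hab Hcd Hf Hg.
  apply contB_ex in Hf; auto. apply contB_ex in Hg; auto. unfold rint.
  rewrite !CI_plus by tauto. ring.
Qed.

Lemma rint_scal k f a b c d : a <= b -> c <= d -> contB f a b c d ->
  rint (fun z => Cmult k (f z)) a b c d = (k * rint f a b c d)%C.
Proof.
  intros Hab Hcd Hf.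
  apply contB_ex in Hf; auto. unfold rint. rewrite !CI_scal by tauto. ring.
Qed.

Lemma rint_bound f a b c d M : a <= b -> c <= d -> contB f a b c d ->
  (forall x, a <= x <= b -> Cmod (f (x, c)) <= M /\ Cmod (f (x, d)) <= M) ->
  (forall y, c <= y <= d -> Cmod (f (a, y)) <= M /\ Cmod (f (b, y)) <= M) ->
  Cmod (rint f a b c d) <= 2 * ((b - a) + (d - c)) * M.
Proof.
  intros Hab Hcd Hf H K. apply contB_ex in Hf; auto. destruct Hf as [E1 [E2 [E3 E4]]].
  assert (B1 := CI_bound _ _ _ M Hab E1 ltac:(apply H)).
  assert (B2 := CI_bound _ _ _ M Hcd E2 ltac:(apply K)).
  assert (B3 := CI_bound _ _ _ M Hab E3 ltac:(apply H)).
  assert (B4 := CI_bound _ _ _ M Hcd E4 ltac:(apply K)).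
  unfold rint.
  eapply Rle_trans; [apply Cmod_triangle|]. rewrite Cmod_opp, Cmod_mult, Cmod_Ci.
  assert (X := Cmod_triangle (CI (fun x => f (x, c)) a b + Ci * CI (fun y => f (b, y)) c d) (- CI (fun x => f (x, d)) a b)).
  rewrite Cmod_opp in X.
  assert (Y := Cmod_triangle (CI (fun x => f (x, c)) a b) (Ci * CI (fun y => f (b, y)) c d)).
  rewrite Cmod_mult, Cmod_Ci in Y. unfold Cminus in *. lra.
Qed.

(** Each edge contributes the difference of [F] at its end points, and the differences cancel around
    the boundary. *)
Lemma rint_primitive F f a b c d : a <= b -> c <= d -> contR f a b c d ->
  (forall x y, a <= x <= b -> c <= y <= d -> Cder F (x, y) (f (x, y))) ->
  rint f a b c d = RtoC 0.
Proof.
  intros Hab Hcd Hc HF.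
  assert (Hh : forall y, c <= y <= d -> CI (fun x => f (x, y)) a b = (F (b, y) - F (a, y))%C).
  { intros y Hy. apply CI_unique. apply (CI_FTC (fun x => F (x, y))); rewrite Rmin_left, Rmax_right by auto.
    - intros t Ht.
      assert (Z := Cder_line F (0, y) (RtoC 1) t (f (t, y))).
      replace ((0, y) + RtoC t * RtoC 1)%C with ((t, y) : C) in Z by (apply C_ext; simpl; ring).
      specialize (Z (HF t y Ht Hy)).
      replace (f (t, y) * RtoC 1)%C with (f (t, y)) in Z by ring.
      eapply is_derive_ext; [|apply Z]. intros u. simpl. f_equal.
      apply C_ext; simpl; ring.
    - intros t Ht. apply hor_cont; auto. }
  assert (Hv : forall x, a <= x <= b -> (Ci * CI (fun y => f (x, y)) c d)%C = (F (x, d) - F (x, c))%C).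
  { intros x Hx.
    assert (Ex : ex_CI (fun u => f (x, u)) c d) by (apply ver_ex; auto).
    rewrite <- CI_scal by auto.
    apply CI_unique. apply (CI_FTC (fun y => F (x, y))); rewrite Rmin_left, Rmax_right by auto.
    - intros t Ht.
      assert (Z := Cder_line F (x, 0) Ci t (f (x, t))).
      replace ((x, 0) + RtoC t * Ci)%C with ((x, t) : C) in Z by (apply C_ext; simpl; ring).
      specialize (Z (HF x t Hx Ht)).
      replace (f (x, t) * Ci)%C with (Ci * f (x, t))%C in Z by ring.
      eapply is_derive_ext; [|apply Z]. intros u. simpl. f_equal.
      apply C_ext; simpl; ring.
    - intros t Ht. apply cont_mult; [apply cont_const|]. apply ver_cont; auto. }
  unfold rint. rewrite !Hh, !Hv by lra. ring.
Qed.

Lemma rint_split_h f a m b c d : a <= m <= b -> c <= d ->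
  contB f a m c d -> contB f m b c d ->
  rint f a b c d = (rint f a m c d + rint f m b c d)%C.
Proof.
  intros Hm Hcd H K. apply contB_ex in H; try lra. apply contB_ex in K; try lra.
  unfold rint. rewrite <- (CI_chasles (fun x => f (x, c)) a m b) by tauto.
  rewrite <- (CI_chasles (fun x => f (x, d)) a m b) by tauto. ring.
Qed.

Lemma rint_split_v f a b c m d : a <= b -> c <= m <= d ->
  contB f a b c m -> contB f a b m d ->
  rint f a b c d = (rint f a b c m + rint f a b m d)%C.
Proof.
  intros Hab Hm H K. apply contB_ex in H; try lra. apply contB_ex in K; try lra.
  unfold rint. rewrite <- (CI_chasles (fun y => f (b, y)) c m d) by tauto.
  rewrite <- (CI_chasles (fun y => f (a, y)) c m d) by tauto. ring.
Qed.

(** * Goursat's theorem *)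


Record box := Box { bx0 : R; bx1 : R; by0 : R; by1 : R }.

(** Nested rectangles stand in for compactness. [Q] is abstract because two different properties are
    pursued: a boundary integral that is too large in [Goursat], and a set of zeros that no finite
    list covers in [zeros_finite]. *)
Lemma bisection (Q : R -> R -> R -> R -> Prop) a b c d : a <= b -> c <= d -> Q a b c d ->
  (forall a b c d, a <= b -> c <= d -> Q a b c d ->
     let m := (a + b) / 2 in let n := (c + d) / 2 in
     Q a m c n \/ Q m b c n \/ Q a m n d \/ Q m b n d) ->
  exists x y, a <= x <= b /\ c <= y <= d /\
    forall delta, 0 < delta -> exists a' b' c' d', Q a' b' c' d' /\
      a <= a' <= x /\ x <= b' <= b /\ c <= c' <= y /\ y <= d' <= d /\
      b' - a' < delta /\ d' - c' < delta.
Proof.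
  intros Hab Hcd HQ Hstep.
  set (ok := fun B => bx0 B <= bx1 B /\ by0 B <= by1 B /\ Q (bx0 B) (bx1 B) (by0 B) (by1 B)).
  set (rel := fun B B' => bx0 B <= bx0 B' /\ bx1 B' <= bx1 B /\ by0 B <= by0 B' /\ by1 B' <= by1 B /\
     bx1 B' - bx0 B' = (bx1 B - bx0 B) / 2 /\ by1 B' - by0 B' = (by1 B - by0 B) / 2).
  (* The implication sits under the existential so that a total step function on boxes can be
     chosen. *)
  assert (S : forall B, exists B', ok B -> ok B' /\ rel B B').
  { intros [p q r s]. destruct (classic (ok (Box p q r s))) as [H|H].
    2: exists (Box p q r s); tauto.
    destruct H as [H1 [H2 H3]]; simpl in *.
    destruct (Hstep p q r s H1 H2 H3) as [K|[K|[K|K]]].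
    - exists (Box p ((p + q) / 2) r ((r + s) / 2)). intros _. unfold ok, rel; simpl. repeat split; auto; lra.
    - exists (Box ((p + q) / 2) q r ((r + s) / 2)). intros _. unfold ok, rel; simpl. repeat split; auto; lra.
    - exists (Box p ((p + q) / 2) ((r + s) / 2) s). intros _. unfold ok, rel; simpl. repeat split; auto; lra.
    - exists (Box ((p + q) / 2) q ((r + s) / 2) s). intros _. unfold ok, rel; simpl. repeat split; auto; lra. }
  set (step := fun B => proj1_sig (constructive_indefinite_description _ (S B))).
  assert (Hs : forall B, ok B -> ok (step B) /\ rel B (step B)).
  { intros B. unfold step. destruct constructive_indefinite_description as [B' H]; auto. }
  set (u := fun n => Nat.iter n step (Box a b c d)).
  assert (Hok : forall n, ok (u n)).
  { induction n.
    - unfold u, ok; simpl; auto.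
    - apply (Hs (u n)); auto. }
  assert (Hrel : forall n, rel (u n) (u (Datatypes.S n))) by (intros n; apply (Hs (u n)); auto).
  assert (Mono : forall n k, bx0 (u n) <= bx0 (u (k + n)%nat) /\ bx1 (u (k + n)%nat) <= bx1 (u n) /\
     by0 (u n) <= by0 (u (k + n)%nat) /\ by1 (u (k + n)%nat) <= by1 (u n)).
  { intros n k. induction k.
    - simpl; lra.
    - destruct (Hrel (k + n)%nat) as [A [B [C [D _]]]]. change (Datatypes.S k + n)%nat with (Datatypes.S (k + n)). destruct IHk as [? [? [? ?]]]. repeat split; lra. }
  assert (Cross : forall n m, bx0 (u n) <= bx1 (u m) /\ by0 (u n) <= by1 (u m)).
  { intros n m. destruct (Mono n m) as [A1 [A2 [A3 A4]]]. destruct (Mono m n) as [B1 [B2 [B3 B4]]].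
    rewrite (Nat.add_comm n m) in *. destruct (Hok (m + n)%nat) as [C1 [C2 _]]. lra. }
  assert (Size : forall n, bx1 (u n) - bx0 (u n) = (b - a) * (1/2) ^ n /\ by1 (u n) - by0 (u n) = (d - c) * (1/2) ^ n).
  { induction n.
    - simpl; lra.
    - destruct (Hrel n) as [_ [_ [_ [_ [E1 E2]]]]]. rewrite E1, E2. simpl. destruct IHn. split; lra. }
  destruct (completeness (fun r => exists n, r = bx0 (u n))) as [x [Hx1 Hx2]].
  { exists (bx1 (u 0%nat)). intros r [n ->]. apply Cross. }
  { exists (bx0 (u 0%nat)), 0%nat; auto. }
  destruct (completeness (fun r => exists n, r = by0 (u n))) as [y [Hy1 Hy2]].
  { exists (by1 (u 0%nat)). intros r [n ->]. apply Cross. }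
  { exists (by0 (u 0%nat)), 0%nat; auto. }
  assert (Px : forall n, bx0 (u n) <= x <= bx1 (u n)).
  { intros n; split; [apply Hx1; eauto|]. apply Hx2. intros r [m ->]. apply Cross. }
  assert (Py : forall n, by0 (u n) <= y <= by1 (u n)).
  { intros n; split; [apply Hy1; eauto|]. apply Hy2. intros r [m ->]. apply Cross. }
  exists x, y. split; [apply (Px 0%nat)|]. split; [apply (Py 0%nat)|].
  intros delta Hd.
  destruct (pow_lt_1_zero (1/2) ltac:(rewrite Rabs_pos_eq; lra) (delta / ((b - a) + (d - c) + 1))) as [N HN].
  { apply Rdiv_lt_0_compat; lra. }
  specialize (HN N (Nat.le_refl N)).
  rewrite Rabs_pos_eq in HN by (apply pow_le; lra).
  assert (Z : 0 < (1/2) ^ N) by (apply pow_lt; lra).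
  apply (Rmult_lt_compat_r ((b - a) + (d - c) + 1)) in HN; [|lra].
  unfold Rdiv in HN at 2. rewrite Rmult_assoc, Rinv_l, Rmult_1_r in HN by lra.
  exists (bx0 (u N)), (bx1 (u N)), (by0 (u N)), (by1 (u N)).
  destruct (Mono 0%nat N) as [A1 [A2 [A3 A4]]]. rewrite Nat.add_0_r in *. simpl in A1, A2, A3, A4.
  destruct (Size N) as [S1 S2].
  assert (0 <= (b - a) * (1/2)^N) by (apply Rmult_le_pos; lra).
  assert (0 <= (d - c) * (1/2)^N) by (apply Rmult_le_pos; lra).
  specialize (Px N). specialize (Py N).
  split; [apply Hok|]. repeat split; lra.
Qed.

Definition holR (f : C -> C) a b c d := forall x y, a <= x <= b -> c <= y <= d -> Chol f (x, y).

Lemma holR_contR f a b c d : holR f a b c d -> contR f a b c d.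
Proof. intros H x y Hx Hy. apply Chol_cont, H; auto. Qed.

Lemma rint_affine (p q r : C) a b c d : a <= b -> c <= d ->
  rint (fun w => (p + q * (w - r))%C) a b c d = RtoC 0.
Proof.
  intros Hab Hcd.
  apply (rint_primitive (fun w => (p * w + q / 2 * ((w - r) * (w - r)))%C)); auto.
  - intros x y _ _. apply cont_plus; [apply cont_const|]. apply cont_mult; [apply cont_const|].
    apply cont_minus; [apply Ccont_id|apply cont_const].
  - intros x y _ _. set (z := (x, y) : C).
    assert (H1 : Cder (fun w => Cmult p w) z (0 * z + p * 1)%C)
      by (apply (Cder_mult (fun _ => p) (fun w => w)); [apply Cder_const|apply Cder_id]).
    assert (H2 : Cder (fun w => Cplus w (- r)) z (1 + 0)%C)
      by (apply Cder_plus; [apply Cder_id|apply Cder_const]).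
    assert (H3 := Cder_mult _ _ _ _ _ (Cder_const (q / 2)%C z) (Cder_mult _ _ _ _ _ H2 H2)).
    assert (H4 := Cder_plus _ _ _ _ _ H1 H3). cbv beta in H4.
    match type of H4 with Cder ?F z ?l => replace (p + q * (z - r))%C with l; [exact H4|] end.
    field.
Qed.

(** An integral exceeding [eps] times the square of the half-perimeter would, by bisection, stay too
    large in boxes shrinking to a point. There [f] is affine up to o(|w - z|), and affine functions
    integrate to 0. *)
Theorem Goursat f a b c d : a <= b -> c <= d -> holR f a b c d -> rint f a b c d = RtoC 0.
Proof.
  intros Hab Hcd Hf. apply Cmod_small_0. intros e0 He0.
  set (eps := e0 / ((((b - a) + (d - c)) * ((b - a) + (d - c))) + 1)).
  assert (Hsq : 0 <= ((b - a) + (d - c)) * ((b - a) + (d - c))) by (apply Rle_0_sqr).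
  assert (Heps : 0 < eps) by (apply Rdiv_lt_0_compat; lra).
  destruct (Rle_lt_dec (Cmod (rint f a b c d)) (eps * (((b - a) + (d - c)) * ((b - a) + (d - c))))) as [H|Hbad].
  { eapply Rle_trans; [apply H|]. unfold eps.
    apply Rle_trans with (e0 / ((((b - a) + (d - c)) * ((b - a) + (d - c))) + 1) * ((((b - a) + (d - c)) * ((b - a) + (d - c))) + 1)).
    - apply Rmult_le_compat_l; [left; auto|lra].
    - apply Req_le. field. lra. }
  exfalso.
  (* Halving both sides divides the threshold by four; if all four quarters were within it, the
     whole box would be. *)
  set (Q := fun p q r s => a <= p /\ q <= b /\ c <= r /\ s <= d /\
     eps * (((q - p) + (s - r)) * ((q - p) + (s - r))) < Cmod (rint f p q r s)).
  destruct (bisection Q a b c d Hab Hcd) as [x [y [Hx [Hy Hsm]]]].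
  - unfold Q. repeat split; auto; lra.
  - clear - Hf Heps. intros p q r s Hpq Hrs [H1 [H2 [H3 [H4 H5]]]] m n.
    assert (Hm : p <= m <= q) by (unfold m; lra). assert (Hn : r <= n <= s) by (unfold n; lra).
    assert (Hc := holR_contR _ _ _ _ _ Hf).
    assert (Hc' : forall p' q' r' s', p <= p' -> p' <= q' -> q' <= q -> r <= r' -> r' <= s' -> s' <= s ->
               contB f p' q' r' s').
    { intros. apply contR_B; try lra. intros x y Hx Hy. apply Hc; lra. }
    assert (E : rint f p q r s = (rint f p m r n + rint f m q r n + (rint f p m n s + rint f m q n s))%C).
    { rewrite (rint_split_v f p q r n s); try (apply Hc'); try lra.
      rewrite (rint_split_h f p m q r n); try (apply Hc'); try lra.
      rewrite (rint_split_h f p m q n s); try (apply Hc'); try lra. auto. }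
    apply NNPP. intros N. unfold Q in N.
    set (sz := (q - p) + (s - r)) in *.
    assert (W : forall p' q' r' s', a <= p' -> q' <= b -> c <= r' -> s' <= d -> (q' - p') + (s' - r') = sz / 2 ->
      ~ (a <= p' /\ q' <= b /\ c <= r' /\ s' <= d /\ eps * (((q' - p') + (s' - r')) * ((q' - p') + (s' - r'))) < Cmod (rint f p' q' r' s')) ->
      Cmod (rint f p' q' r' s') <= eps * (sz * sz) / 4).
    { intros p' q' r' s' A1 A2 A3 A4 A5 A6. apply Rnot_lt_le. intros L. apply A6.
      repeat split; auto. rewrite A5. lra. }
    assert (B1 := W p m r n ltac:(lra) ltac:(lra) ltac:(lra) ltac:(lra) ltac:(unfold m, n, sz; lra) ltac:(tauto)).
    assert (B2 := W m q r n ltac:(lra) ltac:(lra) ltac:(lra) ltac:(lra) ltac:(unfold m, n, sz; lra) ltac:(tauto)).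
    assert (B3 := W p m n s ltac:(lra) ltac:(lra) ltac:(lra) ltac:(lra) ltac:(unfold m, n, sz; lra) ltac:(tauto)).
    assert (B4 := W m q n s ltac:(lra) ltac:(lra) ltac:(lra) ltac:(lra) ltac:(unfold m, n, sz; lra) ltac:(tauto)).
    rewrite E in H5.
    assert (T1 := Cmod_triangle (rint f p m r n + rint f m q r n) (rint f p m n s + rint f m q n s)).
    assert (T2 := Cmod_triangle (rint f p m r n) (rint f m q r n)).
    assert (T3 := Cmod_triangle (rint f p m n s) (rint f m q n s)). lra.
  - destruct (Hf x y Hx Hy) as [l Hl].
    (* The half compensates the factor 2 in [rint_bound]: the perimeter is twice the half-perimeter,
       which also bounds |w - z|. *)
    destruct (Hl (eps / 2) ltac:(lra)) as [dd [Hdd Hw]].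
    destruct (Hsm (dd / 2) ltac:(lra)) as [p [q [r [s [[_ [_ [_ [_ HQ]]]] [H1 [H2 [H3 [H4 [H5 H6]]]]]]]]]].
    set (z := (x, y) : C) in *.
    set (g := fun w => (f w - (f z + l * (w - z)))%C).
    assert (HB : contB f p q r s).
    { apply contR_B; try lra. intros u v Hu Hv. apply Chol_cont, Hf; lra. }
    assert (HA : contB (fun w => (- (1) * (f z + l * (w - z)))%C) p q r s).
    { apply contR_B; try lra. intros u v Hu Hv. apply cont_mult; [apply cont_const|].
      apply cont_plus; [apply cont_const|]. apply cont_mult; [apply cont_const|].
      apply cont_minus; [apply Ccont_id|apply cont_const]. }
    assert (HA' : contB (fun w => (f z + l * (w - z))%C) p q r s).
    { apply contR_B; try lra. intros u v Hu Hv.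
      apply cont_plus; [apply cont_const|]. apply cont_mult; [apply cont_const|].
      apply cont_minus; [apply Ccont_id|apply cont_const]. }
    assert (E : rint f p q r s = rint (fun w => (f w + (- (1) * (f z + l * (w - z))))%C) p q r s).
    { rewrite rint_plus; auto; try lra. rewrite rint_scal; auto; try lra.
      rewrite rint_affine by lra. ring. }
    assert (K : forall u v, p <= u <= q -> r <= v <= s ->
       Cmod (f (u, v) + - (1) * (f z + l * ((u, v) - z))) <= eps / 2 * (q - p + (s - r))).
    { intros u v Hu Hv.
      assert (D : Cmod ((u, v) - z) <= (q - p) + (s - r)).
      { eapply Rle_trans; [apply Cmod_le_abs|]. simpl. apply Rplus_le_compat; apply Rabs_le; lra. }
      replace (f (u, v) + - (1) * (f z + l * ((u, v) - z)))%C with (f (u, v) - f z - l * ((u, v) - z))%C by ring.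
      eapply Rle_trans; [apply Hw|].
      - lra.
      - apply Rmult_le_compat_l; lra. }
    rewrite E in HQ. apply (Rlt_not_le _ _ HQ).
    eapply Rle_trans; [apply (rint_bound _ _ _ _ _ (eps / 2 * ((q - p) + (s - r)))); try lra|].
    + apply contB_plus; auto.
    + intros u Hu. split; apply K; lra.
    + intros v Hv. split; apply K; lra.
    + apply Req_le. field.
Qed.

(** * Residues *)


(** At most a simple pole is described. The point [p] is left out of the limit, so the value of [f]
    there is irrelevant, and residue 0 marks a singularity too weak to contribute to an integral. *)
Definition resid (f : C -> C) (p r : C) : Prop :=
  forall eps, 0 < eps -> exists d, 0 < d /\
    forall s, 0 < Cmod (s - p) < d -> Cmod ((s - p) * f s - r) <= eps.

Lemma resid_plus f g p r q : resid f p r -> resid g p q -> resid (fun s => Cplus (f s) (g s)) p (r + q).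
Proof.
  intros H K eps He. destruct (H (eps / 2) ltac:(lra)) as [d [Hd H']].
  destruct (K (eps / 2) ltac:(lra)) as [d' [Hd' K']].
  exists (Rmin d d'). split; [apply Rmin_pos; auto|]. intros s [S1 S2].
  assert (A := H' s (conj S1 (Rlt_le_trans _ _ _ S2 (Rmin_l _ _)))).
  assert (B := K' s (conj S1 (Rlt_le_trans _ _ _ S2 (Rmin_r _ _)))).
  replace ((s - p) * (f s + g s) - (r + q))%C with (((s - p) * f s - r) + ((s - p) * g s - q))%C by ring.
  eapply Rle_trans; [apply Cmod_triangle|]. lra.
Qed.

Lemma resid_cont f p : Ccont f p -> resid f p 0.
Proof.
  intros H eps He. rewrite Ccont_iff in H. destruct (H 1 ltac:(lra)) as [d [Hd Hw]].
  assert (P : 0 < Cmod (f p) + 1) by (assert (Z := Cmod_ge_0 (f p)); lra).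
  exists (Rmin d (eps / (Cmod (f p) + 1))). split.
  { apply Rmin_pos; auto. apply Rdiv_lt_0_compat; auto. }
  intros s [S1 S2].
  assert (A := Hw s (Rlt_le_trans _ _ _ S2 (Rmin_l _ _))).
  assert (B := Rlt_le_trans _ _ _ S2 (Rmin_r _ _)).
  replace ((s - p) * f s - 0)%C with ((s - p) * f s)%C by ring. rewrite Cmod_mult.
  assert (Z := Cmod_rev (f s) (f p)).
  apply Rle_trans with (eps / (Cmod (f p) + 1) * (Cmod (f p) + 1)).
  - apply Rmult_le_compat; try apply Cmod_ge_0; lra.
  - apply Req_le; field; lra.
Qed.

Lemma resid_pole f p : Ccont f p -> resid (fun s => f s * / (s - p))%C p (f p).
Proof.
  intros H eps He. rewrite Ccont_iff in H. destruct (H eps He) as [d [Hd Hw]].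
  exists d. split; auto. intros s [S1 S2].
  assert (N : (s - p)%C <> RtoC 0) by (intros E; rewrite E, Cmod_0 in S1; lra).
  replace ((s - p) * (f s * / (s - p)) - f p)%C with (f s - f p)%C by (field; auto).
  left; auto.
Qed.

Lemma cont_inv_minus p q : q <> p -> Ccont (fun s => / (s - p))%C q.
Proof.
  intros N. apply (cont_inv (T := C_UniformSpace)).
  - apply Cminus_neq; auto.
  - apply cont_minus; [apply Ccont_id|apply cont_const].
Qed.

Lemma hol_inv_minus p q : q <> p -> Chol (fun s => / (s - p))%C q.
Proof.
  intros N. apply Chol_inv; [apply Cminus_neq; auto|].
  apply Chol_minus; [apply Chol_id|apply Chol_const].
Qed.

(** The pieces are two strips of full height to the left and right of the square, the parts below
    and above it, and the square. Continuity is asked on their edges only, since further poles may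
    lie inside the pieces. *)
Lemma rint_cut f a b c d x y e : 0 < e -> a <= x - e -> x + e <= b -> c <= y - e -> y + e <= d ->
  contB f a (x - e) c d -> contB f (x + e) b c d ->
  contB f (x - e) (x + e) c (y - e) -> contB f (x - e) (x + e) (y + e) d ->
  contB f (x - e) (x + e) (y - e) (y + e) ->
  rint f a b c d = (rint f a (x - e) c d + rint f (x + e) b c d + rint f (x - e) (x + e) c (y - e)
    + rint f (x - e) (x + e) (y + e) d + rint f (x - e) (x + e) (y - e) (y + e))%C.
Proof.
  intros He H1 H2 H3 H4 C1 C2 C3 C4 C5.
  assert (D1 : contB f (x - e) (x + e) c (y + e)).
  { destruct C3 as [A1 A2], C5 as [B1 B2]. split.
    - intros u Hu. destruct (A1 u Hu), (B1 u Hu). auto.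
    - intros v Hv. destruct (Rle_dec v (y - e)); [apply A2|apply B2]; lra. }
  assert (D2 : contB f (x - e) (x + e) c d).
  { destruct D1 as [A1 A2], C4 as [B1 B2]. split.
    - intros u Hu. destruct (A1 u Hu), (B1 u Hu). auto.
    - intros v Hv. destruct (Rle_dec v (y + e)); [apply A2|apply B2]; lra. }
  assert (D3 : contB f a (x + e) c d).
  { destruct C1 as [A1 A2], D2 as [B1 B2]. split.
    - intros u Hu. destruct (Rle_dec u (x - e)); [apply A1|apply B1]; lra.
    - intros v Hv. destruct (A2 v Hv), (B2 v Hv). auto. }
  rewrite (rint_split_h f a (x + e) b c d); try lra; auto.
  rewrite (rint_split_h f a (x - e) (x + e) c d); try lra; auto.
  rewrite (rint_split_v f (x - e) (x + e) c (y + e) d); try lra; auto.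
  rewrite (rint_split_v f (x - e) (x + e) c (y - e) (y + e)); try lra; auto.
  ring.
Qed.

Definition inside a b c d (p : C) := a < fst p < b /\ c < snd p < d.
Definition onrect a b c d (p : C) := a <= fst p <= b /\ c <= snd p <= d.

(** The cuts around [p] must miss the other exceptional points. Any radius below all nonzero
    coordinate differences achieves this; a vanishing difference is harmless because [e] is
    positive. *)
Lemma small_generic (l : list C) (p : C) (d0 : R) : 0 < d0 -> exists e0, 0 < e0 <= d0 /\
  forall e q, 0 < e < e0 -> In q l ->
    fst q <> fst p - e /\ fst q <> fst p + e /\ snd q <> snd p - e /\ snd q <> snd p + e.
Proof.
  intros Hd. induction l as [|q l IH].
  - exists d0. split; [lra|]. intros e q _ [].
  - destruct IH as [e0 [He H]].
    assert (V : forall v : R, exists m, 0 < m /\ forall e, 0 < e < m -> v <> - e /\ v <> e).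
    { intros v. destruct (Req_dec v 0) as [->|N].
      - exists 1. split; [lra|]. intros; lra.
      - exists (Rabs v). split; [apply Rabs_pos_lt; auto|].
        intros e Hm. unfold Rabs in Hm. destruct (Rcase_abs v); lra. }
    destruct (V (fst q - fst p)) as [m [Hm Vm]]. destruct (V (snd q - snd p)) as [m' [Hm' Vm']].
    exists (Rmin e0 (Rmin m m')).
    assert (L1 := Rmin_l e0 (Rmin m m')). assert (L2 := Rmin_r e0 (Rmin m m')).
    assert (L3 := Rmin_l m m'). assert (L4 := Rmin_r m m').
    split.
    + split; [repeat apply Rmin_pos; lra|lra].
    + intros e r He' [<-|Hr].
      * destruct (Vm e); [lra|]. destruct (Vm' e); [lra|]. lra.
      * apply H; auto. lra.
Qed.

(** A small square is cut out around [p], and the four pieces around it fall under the induction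
    hypothesis, which is why [g] and the rectangle are quantified after the list. On the square of
    half-side e the integrand is at most (eps/8)/e and the perimeter is 8e, so the integral is at
    most eps. *)
Lemma rint_negligible (l : list C) : forall g a b c d, a <= b -> c <= d ->
  (forall z, onrect a b c d z -> ~ In z l -> Chol g z) ->
  (forall p, In p l -> onrect a b c d p -> inside a b c d p /\ resid g p 0) ->
  rint g a b c d = RtoC 0.
Proof.
  induction l as [|p l IH]; intros g a b c d Hab Hcd Hh Hn.
  { apply Goursat; auto. intros x y Hx Hy. apply Hh; [split; simpl; auto|]. intros []. }
  destruct (classic (onrect a b c d p)) as [Hp|Hp].
  2: { apply IH; auto.
       - intros z Hz Nz. apply Hh; auto. intros [E|E]; [subst; tauto|tauto].
       - intros q Hq; apply Hn; right; auto. }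
  destruct (classic (In p l)) as [Hpl|Hpl].
  { apply IH; auto.
    - intros z Hz Nz. apply Hh; auto. intros [E|E]; [subst; tauto|tauto].
    - intros q Hq; apply Hn; right; auto. }
  destruct (Hn p (or_introl eq_refl) Hp) as [[I1 I2] Np].
  apply Cmod_small_0. intros eps He.
  destruct (Np (eps / 8) ltac:(lra)) as [d0 [Hd0 Hneg]].
  set (x := fst p) in *. set (y := snd p) in *.
  set (m := Rmin (d0 / 2) (Rmin (Rmin (x - a) (b - x)) (Rmin (y - c) (d - y)))).
  assert (L1 : m <= d0 / 2) by apply Rmin_l.
  assert (L2 : m <= Rmin (Rmin (x - a) (b - x)) (Rmin (y - c) (d - y))) by apply Rmin_r.
  assert (L3 := Rmin_l (Rmin (x - a) (b - x)) (Rmin (y - c) (d - y))).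
  assert (L4 := Rmin_r (Rmin (x - a) (b - x)) (Rmin (y - c) (d - y))).
  assert (L5 := Rmin_l (x - a) (b - x)). assert (L6 := Rmin_r (x - a) (b - x)).
  assert (L7 := Rmin_l (y - c) (d - y)). assert (L8 := Rmin_r (y - c) (d - y)).
  assert (Hm : 0 < m) by (unfold m; repeat apply Rmin_pos; lra).
  destruct (small_generic l p m Hm) as [e0 [He0 Hgen]].
  set (e := e0 / 2). assert (Hee : 0 < e < e0) by (unfold e; lra).
  assert (Hcont : forall z, onrect a b c d z -> fst z = x - e \/ fst z = x + e \/ snd z = y - e \/ snd z = y + e \/
     fst z = a \/ fst z = b \/ snd z = c \/ snd z = d -> Ccont g z).
  { intros z Hz Hb. apply Chol_cont, Hh; auto. intros [E|E].
    - subst z. fold x y in Hb. lra.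
    - destruct (Hgen e z Hee E) as [G1 [G2 [G3 G4]]].
      destruct (Hn z (or_intror E) Hz) as [[J1 J2] _]. fold x y in G1, G2, G3, G4.
      destruct Hb as [Hb|[Hb|[Hb|[Hb|[Hb|[Hb|[Hb|Hb]]]]]]]; lra. }
  assert (HB : forall a' b' c' d', a <= a' -> a' <= b' -> b' <= b -> c <= c' -> c' <= d' -> d' <= d ->
     (a' = a \/ a' = x - e \/ a' = x + e) -> (b' = b \/ b' = x - e \/ b' = x + e) ->
     (c' = c \/ c' = y - e \/ c' = y + e) -> (d' = d \/ d' = y - e \/ d' = y + e) ->
     contB g a' b' c' d').
  { intros. split; intros t Ht; split; apply Hcont; unfold onrect; simpl; try lra; tauto. }
  assert (HI : forall a' b' c' d', a <= a' -> a' <= b' -> b' <= b -> c <= c' -> c' <= d' -> d' <= d ->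
     (a' = a \/ a' = x - e \/ a' = x + e) -> (b' = b \/ b' = x - e \/ b' = x + e) ->
     (c' = c \/ c' = y - e \/ c' = y + e) -> (d' = d \/ d' = y - e \/ d' = y + e) ->
     ~ onrect a' b' c' d' p -> rint g a' b' c' d' = RtoC 0).
  { intros a' b' c' d' H1 H2 H3 H4 H5 H6 Ea Eb Ec Ed Hout. apply IH; auto.
    - intros z [Hz1 Hz2] Nz. apply Hh. { split; lra. } intros [E|E]; [subst; apply Hout; split; auto|tauto].
    - intros q Hq [Q1 Q2].
      assert (Hr : onrect a b c d q) by (split; lra).
      destruct (Hn q (or_intror Hq) Hr) as [[J1 J2] J3].
      destruct (Hgen e q Hee Hq) as [G1 [G2 [G3 G4]]]. fold x y in G1, G2, G3, G4.
      split; auto. split; lra. }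
  rewrite (rint_cut g a b c d x y e); try lra; try (apply HB; try lra; tauto).
  rewrite (HI a (x - e) c d), (HI (x + e) b c d), (HI (x - e) (x + e) c (y - e)), (HI (x - e) (x + e) (y + e) d);
    try lra; try tauto; try (intros [Q1 Q2]; fold x y in Q1, Q2; lra).
  replace (0 + 0 + 0 + 0 + rint g (x - e) (x + e) (y - e) (y + e))%C with (rint g (x - e) (x + e) (y - e) (y + e)) by ring.
  assert (BD : forall z : C, Rabs (fst z - x) <= e -> Rabs (snd z - y) <= e ->
     Rabs (fst z - x) = e \/ Rabs (snd z - y) = e -> Cmod (g z) <= eps / (8 * e)).
  { intros z Hz1 Hz2 Hz3.
    assert (D1 : e <= Cmod (z - p)).
    { destruct Hz3 as [<-|<-]; [apply (fst_le_Cmod (z - p))|apply (snd_le_Cmod (z - p))]. }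
    assert (D2 : Cmod (z - p) <= 2 * e).
    { eapply Rle_trans; [apply Cmod_le_abs|]. simpl. fold x y. unfold Rminus in *. lra. }
    assert (K := Hneg z ltac:(lra)).
    replace ((z - p) * g z - 0)%C with ((z - p) * g z)%C in K by ring. rewrite Cmod_mult in K.
    apply (Rmult_le_reg_l e); [lra|].
    apply Rle_trans with (eps / 8); [|apply Req_le; field; lra].
    eapply Rle_trans; [|apply K]. apply Rmult_le_compat_r; auto. apply Cmod_ge_0. }
  assert (R1 : forall t, - e <= t <= e -> Rabs t <= e) by (intros; apply Rabs_le; auto).
  assert (R2 : Rabs e = e) by (apply Rabs_pos_eq; lra).
  assert (R3 : Rabs (- e) = e) by (rewrite Rabs_Ropp; auto).
  eapply Rle_trans; [apply (rint_bound _ _ _ _ _ (eps / (8 * e)))|]; try lra.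
  - apply HB; try lra; tauto.
  - intros u Hu. split; apply BD; simpl; try (apply R1; lra).
    + right. replace (y - e - y) with (- e) by ring. auto.
    + right. replace (y + e - y) with e by ring. auto.
  - intros u Hu. split; apply BD; simpl; try (apply R1; lra).
    + left. replace (x - e - x) with (- e) by ring. auto.
    + left. replace (x + e - x) with e by ring. auto.
  - apply Req_le. field. lra.
Qed.

(** The integrand is the sum of the four edge integrands of 1/(s - p) on a square centred at [p],
    with a common parameter [t]. The arctangent provides the value 2 pi i without a branch of the
    logarithm. *)
Lemma atan_integral e : 0 < e -> is_CI (fun t => Ci * RtoC (4 * e / (t * t + e * e)))%C (- e) e (RtoC (2 * PI) * Ci)%C.
Proof.
  intros He. replace (RtoC (2 * PI) * Ci)%C with (Ci * RtoC (2 * PI))%C by ring.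
  apply is_CI_scal. apply is_CI_pair. simpl. split.
  2: { replace 0 with (scal (e - - e) 0) at 1 by (unfold scal; simpl; unfold mult; simpl; ring).
       apply (is_RInt_const (V := R_NormedModule)). }
  replace (2 * PI) with (minus (4 * atan (e / e)) (4 * atan (- e / e))).
  2: { replace (- e / e) with (- (1)) by (field; lra). replace (e / e) with 1 by (field; lra).
       rewrite atan_opp, atan_1. unfold minus, plus, opp; simpl. field. }
  assert (Hp : forall t, 0 < t * t + e * e).
  { intros t. assert (0 <= t * t) by apply Rle_0_sqr. assert (0 < e * e) by (apply Rmult_lt_0_compat; auto). lra. }
  apply (is_RInt_derive (V := R_CompleteNormedModule) (fun t => 4 * atan (t / e))).
  - intros t _. specialize (Hp t).
    assert (Q : t / e * (t / e) + 1 = (t * t + e * e) / (e * e)) by (field; lra).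
    auto_derive; auto. field. repeat split; try lra; nra.
  - intros t _. apply (ex_derive_continuous (V := R_NormedModule)).
    auto_derive. specialize (Hp t). lra.
Qed.

Lemma rint_pole_square (p : C) e : 0 < e ->
  rint (fun s => / (s - p))%C (fst p - e) (fst p + e) (snd p - e) (snd p + e) = (RtoC (2 * PI) * Ci)%C.
Proof.
  intros He. destruct p as [x y]; simpl.
  set (p := (x, y) : C).
  assert (SH : forall f z, ex_CI f (z - e) (z + e) -> is_CI (fun t => f (t + z)) (- e) e (CI f (z - e) (z + e))).
  { intros f z Hf. apply CI_correct in Hf.
    assert (Z := is_RInt_comp_lin (V := C_R_NormedModule) f 1 z (- e) e (CI f (z - e) (z + e))).
    replace (1 * - e + z) with (z - e) in Z by ring. replace (1 * e + z) with (z + e) in Z by ring.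
    specialize (Z Hf). eapply is_CI_ext; [|apply Z]. intros t _. simpl.
    rewrite Rmult_1_l. apply C_ext; simpl; unfold scal; simpl; unfold mult; simpl; ring. }
  assert (HB : contB (fun s => / (s - p))%C (x - e) (x + e) (y - e) (y + e)).
  { split; intros t Ht; split; apply cont_inv_minus; intros E; injection E; intros; lra. }
  apply contB_ex in HB; try lra. destruct HB as [E1 [E2 [E3 E4]]].
  unfold rint.
  assert (I1 := SH _ _ E1). assert (I2 := is_CI_scal Ci _ _ _ _ (SH _ _ E2)).
  assert (I3 := is_CI_scal (- (1))%C _ _ _ _ (SH _ _ E3)).
  assert (I4 := is_CI_scal (- Ci)%C _ _ _ _ (SH _ _ E4)).
  assert (I := is_CI_plus _ _ _ _ _ _ (is_CI_plus _ _ _ _ _ _ I1 I2) (is_CI_plus _ _ _ _ _ _ I3 I4)).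
  rewrite <- (CI_unique _ _ _ _ (atan_integral e He)).
  apply CI_unique in I.
  match type of I with CI ?f _ _ = ?r => transitivity r; [ring|]; rewrite <- I end.
  apply CI_ext. intros t _. unfold p.
  assert (Hp : 0 < t * t + e * e).
  { assert (0 <= t * t) by apply Rle_0_sqr. assert (0 < e * e) by (apply Rmult_lt_0_compat; auto). lra. }
  apply C_ext; simpl; field; nra.
Qed.

Lemma rint_pole (p : C) a b c d : inside a b c d p ->
  rint (fun s => / (s - p))%C a b c d = (RtoC (2 * PI) * Ci)%C.
Proof.
  intros [H1 H2].
  set (x := fst p) in *. set (y := snd p) in *.
  set (e := Rmin (Rmin (x - a) (b - x)) (Rmin (y - c) (d - y))).
  assert (L3 : e <= _) by apply (Rmin_l (Rmin (x - a) (b - x)) (Rmin (y - c) (d - y))).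
  assert (L4 : e <= _) by apply (Rmin_r (Rmin (x - a) (b - x)) (Rmin (y - c) (d - y))).
  assert (L5 := Rmin_l (x - a) (b - x)). assert (L6 := Rmin_r (x - a) (b - x)).
  assert (L7 := Rmin_l (y - c) (d - y)). assert (L8 := Rmin_r (y - c) (d - y)).
  assert (Hm : 0 < e) by (unfold e; repeat apply Rmin_pos; lra).
  assert (HH : forall a' b' c' d', ~ onrect a' b' c' d' p -> holR (fun s => / (s - p))%C a' b' c' d').
  { intros a' b' c' d' Hout u v Hu Hv. apply hol_inv_minus. intros E. apply Hout. rewrite <- E. split; auto. }
  assert (O1 : ~ onrect a (x - e) c d p) by (intros [Q1 Q2]; fold x y in Q1, Q2; lra).
  assert (O2 : ~ onrect (x + e) b c d p) by (intros [Q1 Q2]; fold x y in Q1, Q2; lra).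
  assert (O3 : ~ onrect (x - e) (x + e) c (y - e) p) by (intros [Q1 Q2]; fold x y in Q1, Q2; lra).
  assert (O4 : ~ onrect (x - e) (x + e) (y + e) d p) by (intros [Q1 Q2]; fold x y in Q1, Q2; lra).
  rewrite (rint_cut _ a b c d x y e); try lra; try (apply contR_B; [lra|lra|]; apply holR_contR, HH; assumption).
  - rewrite !Goursat by (try lra; apply HH; auto). unfold x, y. rewrite rint_pole_square by auto. ring.
  - split; intros t Ht; split; apply cont_inv_minus; intros E;
      apply (f_equal (fun z : C => (fst z, snd z))) in E; injection E; fold x y; intros; lra.
Qed.

(** Subtracting res/(s - p) leaves residue 0 at [p], though not holomorphy, so the point is moved
    from the poles [l2] to the negligible points [l1]. When [l2] is exhausted, [rint_negligible]
    applies. *)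
Lemma residue_theorem_gen (l2 : list C) : forall l1 (res : C -> C) F a b c d, a <= b -> c <= d ->
  NoDup (l1 ++ l2) ->
  (forall p, In p (l1 ++ l2) -> inside a b c d p) ->
  (forall z, onrect a b c d z -> ~ In z (l1 ++ l2) -> Chol F z) ->
  (forall p, In p l1 -> resid F p 0) -> (forall p, In p l2 -> resid F p (res p)) ->
  rint F a b c d = (RtoC (2 * PI) * Ci * csum (map res l2))%C.
Proof.
  induction l2 as [|p l2 IH]; intros l1 res F a b c d Hab Hcd HN HI Hh H1 H2.
  - simpl. rewrite app_nil_r in *.
    transitivity (RtoC 0); [|change (csum []) with (RtoC 0); ring].
    apply (rint_negligible l1); auto.
  - set (F' := fun s => (F s + (- res p) * / (s - p))%C).
    assert (Hp : In p (l1 ++ p :: l2)) by (apply in_or_app; right; left; auto).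
    assert (Hin : forall q, In q ((p :: l1) ++ l2) <-> In q (l1 ++ p :: l2)).
    { intros q. simpl. rewrite !in_app_iff. simpl. tauto. }
    assert (Hnp : ~ In p (l1 ++ l2)) by (apply NoDup_remove_2; auto).
    assert (Hother : forall q r, q <> p -> resid F q r -> resid F' q r).
    { intros q r Nq Hr. replace r with (r + 0)%C by ring. apply resid_plus; auto.
      apply resid_cont. apply (cont_mult (T := C_UniformSpace)); [apply cont_const|apply cont_inv_minus; auto]. }
    assert (HF' : rint F' a b c d = (RtoC (2 * PI) * Ci * csum (map res l2))%C).
    { apply (IH (p :: l1)); auto.
      - simpl. constructor; auto. apply (NoDup_remove_1 l1 l2 p); auto.
      - intros q Hq. apply HI, Hin; auto.
      - intros z Hz Nz. apply Chol_plus; [apply Hh; auto; rewrite <- Hin; auto|].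
        apply Chol_mult; [apply Chol_const|apply hol_inv_minus]. intros ->. apply Nz; left; auto.
      - intros q [<-|Hq].
        + replace (RtoC 0) with (res p + - res p)%C by ring. apply resid_plus.
          * apply H2; left; auto.
          * apply (resid_pole (fun _ => (- res p)%C)). apply cont_const.
        + apply Hother; auto. intros ->. apply Hnp, in_or_app; auto.
      - intros q Hq. apply Hother; auto.
        + intros ->. apply Hnp, in_or_app; auto.
        + apply H2; right; auto. }
    assert (Hb : forall z, onrect a b c d z -> ~ inside a b c d z -> ~ In z (l1 ++ p :: l2)).
    { intros z _ Hz Hq. apply Hz, HI; auto. }
    assert (CF : forall g, (forall z, onrect a b c d z -> ~ In z (l1 ++ p :: l2) -> Chol g z) -> contB g a b c d).
    { intros g Hg. split; intros t Ht; split; apply Chol_cont, Hg; try (split; simpl; lra);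
        apply Hb; try (split; simpl; lra); intros [Q1 Q2]; simpl in Q1, Q2; lra. }
    assert (C1 : contB F a b c d) by (apply CF; auto).
    assert (C2 : contB (fun s => / (s - p))%C a b c d).
    { apply CF. intros z Hz Nz. apply hol_inv_minus. intros ->; auto. }
    unfold F' in HF'. rewrite rint_plus in HF'; auto.
    2: { apply contB_mult; auto. split; intros; split; apply cont_const. }
    rewrite rint_scal, rint_pole in HF'; auto. simpl.
    replace (rint F a b c d) with (rint F a b c d + - res p * (RtoC (2 * PI) * Ci) + res p * (RtoC (2 * PI) * Ci))%C by ring.
    rewrite HF'. ring.
Qed.

Theorem residue_theorem (l : list C) (res : C -> C) F a b c d : a <= b -> c <= d ->
  NoDup l -> (forall p, In p l -> inside a b c d p) ->
  (forall z, onrect a b c d z -> ~ In z l -> Chol F z) ->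
  (forall p, In p l -> resid F p (res p)) ->
  rint F a b c d = (RtoC (2 * PI) * Ci * csum (map res l))%C.
Proof.
  intros. apply (residue_theorem_gen l []); auto. intros p [].
Qed.

Lemma Cauchy_formula f w a b c d : inside a b c d w -> holR f a b c d ->
  rint (fun s => f s * / (s - w))%C a b c d = (RtoC (2 * PI) * Ci * f w)%C.
Proof.
  intros [I1 I2] Hf.
  rewrite (residue_theorem [w] f); try lra.
  - simpl. ring.
  - repeat constructor. intros [].
  - intros p [<-|[]]. split; auto.
  - intros z [Z1 Z2] Nz. apply Chol_mult.
    + rewrite (surjective_pairing z). apply Hf; auto.
    + apply hol_inv_minus. intros ->. apply Nz; left; auto.
  - intros p [<-|[]]. apply resid_pole. apply Chol_cont. rewrite (surjective_pairing w). apply Hf; lra.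
Qed.

(** * The identity theorem *)


Lemma edge_bounded (f : R -> C) a b : (forall t, a <= t <= b -> curve_cont f t) ->
  exists M, forall t, a <= t <= b -> Cmod (f t) <= M.
Proof.
  intros H. destruct (bounded_continuity (K := R_AbsRing) (V := C_R_NormedModule) f a b H) as [M HM].
  exists M. intros t Ht. specialize (HM t Ht). rewrite norm_C_R in HM. lra.
Qed.

Lemma contB_bounded f a b c d : contB f a b c d -> exists M, 0 <= M /\
  (forall x, a <= x <= b -> Cmod (f (x, c)) <= M /\ Cmod (f (x, d)) <= M) /\
  (forall y, c <= y <= d -> Cmod (f (a, y)) <= M /\ Cmod (f (b, y)) <= M).
Proof.
  intros [H K].
  destruct (edge_bounded (fun x => f (x, c)) a b) as [M1 H1]; [intros; apply hor_cont, H; auto|].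
  destruct (edge_bounded (fun x => f (x, d)) a b) as [M2 H2]; [intros; apply hor_cont, H; auto|].
  destruct (edge_bounded (fun x => f (a, x)) c d) as [M3 H3]; [intros; apply ver_cont, K; auto|].
  destruct (edge_bounded (fun x => f (b, x)) c d) as [M4 H4]; [intros; apply ver_cont, K; auto|].
  exists (Rmax 0 (Rmax (Rmax M1 M2) (Rmax M3 M4))).
  assert (L0 := Rmax_l 0 (Rmax (Rmax M1 M2) (Rmax M3 M4))).
  assert (L1 := Rmax_r 0 (Rmax (Rmax M1 M2) (Rmax M3 M4))).
  assert (L2 := Rmax_l (Rmax M1 M2) (Rmax M3 M4)). assert (L3 := Rmax_r (Rmax M1 M2) (Rmax M3 M4)).
  assert (L4 := Rmax_l M1 M2). assert (L5 := Rmax_r M1 M2).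
  assert (L6 := Rmax_l M3 M4). assert (L7 := Rmax_r M3 M4).
  split; auto. split; intros t Ht.
  - specialize (H1 t Ht). specialize (H2 t Ht). lra.
  - specialize (H3 t Ht). specialize (H4 t Ht). lra.
Qed.

Lemma Chol_pow f z n : Chol f z -> Chol (fun w => Cpow (f w) n) z.
Proof.
  intros H. induction n; simpl.
  - apply Chol_const.
  - apply Chol_mult; auto.
Qed.

Definition zero_near (f : C -> C) (c : C) := exists d, 0 < d /\ forall w, Cmod (w - c) < d -> f w = RtoC 0.

Lemma geometric_small K q : 0 <= q < 1 -> forall eps, 0 < eps -> exists N, K * q ^ N <= eps.
Proof.
  intros Hq eps He.
  assert (HK : 0 < Rabs K + 1) by (assert (Z := Rabs_pos K); lra).
  destruct (pow_lt_1_zero q ltac:(rewrite Rabs_pos_eq; lra) (eps / (Rabs K + 1))) as [N HN].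
  { apply Rdiv_lt_0_compat; auto. }
  exists N. specialize (HN N (Nat.le_refl N)). assert (P : 0 <= q ^ N) by (apply pow_le; lra).
  rewrite Rabs_pos_eq in HN by auto.
  apply Rle_trans with ((Rabs K + 1) * q ^ N).
  - apply Rmult_le_compat_r; auto. assert (Z := Rle_abs K); lra.
  - apply (Rmult_lt_compat_l (Rabs K + 1)) in HN; auto.
    replace ((Rabs K + 1) * (eps / (Rabs K + 1))) with eps in HN by (field; lra). lra.
Qed.

(* Cauchy's formula for [f / (s - c)^N], which is holomorphic at [c] because [f] vanishes there. *)
Lemma zero_disc f (c : C) R : 0 < R ->
  holR f (fst c - R) (fst c + R) (snd c - R) (snd c + R) -> zero_near f c ->
  forall w, Cmod (w - c) < R -> f w = RtoC 0.
Proof.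
  intros HR Hf [d [Hd Hz]] w Hw.
  destruct (classic (w = c)) as [->|Nw].
  { apply Hz. replace (c - c)%C with (RtoC 0) by ring. rewrite Cmod_0; auto. }
  assert (Pw := Cmod_pos _ (Cminus_neq _ _ Nw)).
  assert (Fw : Rabs (fst w - fst c) < R) by (eapply Rle_lt_trans; [apply (fst_le_Cmod (w - c))|auto]).
  assert (Sw : Rabs (snd w - snd c) < R) by (eapply Rle_lt_trans; [apply (snd_le_Cmod (w - c))|auto]).
  apply Rabs_def2 in Fw. apply Rabs_def2 in Sw.
  assert (Iw : inside (fst c - R) (fst c + R) (snd c - R) (snd c + R) w) by (split; lra).
  assert (HB : contB (fun s => f s * / (s - w))%C (fst c - R) (fst c + R) (snd c - R) (snd c + R)).
  { split; intros t Ht; split; apply (cont_mult (T := C_UniformSpace));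
      try (apply Chol_cont, Hf; lra); apply cont_inv_minus; intros E;
      apply (f_equal (fun z : C => (fst z, snd z))) in E; injection E; intros; lra. }
  destruct (contB_bounded _ _ _ _ _ HB) as [M [HM [M1 M2]]].
  set (g := fun N s => (f s * Cpow (/ (s - c)) N)%C).
  assert (Hg : forall N, holR (g N) (fst c - R) (fst c + R) (snd c - R) (snd c + R)).
  { intros N x y Hx Hy. destruct (classic (((x, y) : C) = c)) as [E|E].
    - rewrite E. apply (Chol_ext_loc (fun _ => RtoC 0)); [|apply Chol_const].
      exists d. split; auto. intros v Hv. unfold g. rewrite Hz by auto. ring.
    - apply Chol_mult; [apply Hf; auto|]. apply Chol_pow, hol_inv_minus; auto. }
  assert (Hout : forall s : C, R <= Cmod (s - c) -> s <> c /\ / Cmod (s - c) <= / R).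
  { intros s Hs. split.
    - intros ->. replace (c - c)%C with (RtoC 0) in Hs by ring. rewrite Cmod_0 in Hs. lra.
    - apply Rinv_le_contravar; auto. }
  (* Every boundary point has distance at least [R] from [c], so the factor (s - c)^(-N) costs at
     most R^(-N) there, while at [w] it gains |w - c|^(-N). The perimeter is 8R. *)
  assert (Key : forall N, 2 * PI * Cmod (f w) <= 8 * R * M * (Cmod (w - c) / R) ^ N).
  { intros N. assert (CF := Cauchy_formula (g N) w _ _ _ _ Iw (Hg N)).
    assert (BE : forall s : C, R <= Cmod (s - c) -> Cmod (f s * / (s - w)) <= M -> Cmod (g N s * / (s - w)) <= M * (/ R) ^ N).
    { intros s Hs Hb. destruct (Hout s Hs) as [Ns Is]. unfold g.
      replace (f s * Cpow (/ (s - c)) N * / (s - w))%C with (f s * / (s - w) * Cpow (/ (s - c)) N)%C by ring.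
      rewrite Cmod_mult, Cmod_pow, Cmod_inv by (apply Cminus_neq; auto).
      apply Rmult_le_compat; auto; try apply Cmod_ge_0.
      - apply pow_le. left. apply Rinv_0_lt_compat. lra.
      - apply pow_incr. split; auto. left. apply Rinv_0_lt_compat. lra. }
    assert (DF : forall s : C, Rabs (fst s - fst c) = R -> R <= Cmod (s - c)) by (intros s <-; apply (fst_le_Cmod (s - c))).
    assert (DS : forall s : C, Rabs (snd s - snd c) = R -> R <= Cmod (s - c)) by (intros s <-; apply (snd_le_Cmod (s - c))).
    assert (AR : Rabs R = R) by (apply Rabs_pos_eq; lra).
    assert (B := rint_bound (fun s => g N s * / (s - w))%C (fst c - R) (fst c + R) (snd c - R) (snd c + R) (M * (/ R) ^ N)).
    rewrite CF in B. rewrite !Cmod_mult, Cmod_R, Cmod_Ci, (Rabs_pos_eq (2 * PI)) in B by (assert (Z := PI_RGT_0); lra).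
    unfold g in B. rewrite Cmod_mult, Cmod_pow, Cmod_inv in B by (apply Cminus_neq; auto).
    assert (B' : 2 * PI * 1 * (Cmod (f w) * (/ Cmod (w - c)) ^ N) <= 2 * (fst c + R - (fst c - R) + (snd c + R - (snd c - R))) * (M * (/ R) ^ N)).
    { apply B; try lra.
      - split; intros t Ht; split; apply (cont_mult (T := C_UniformSpace));
          try (apply Chol_cont, (Hg N); lra); apply cont_inv_minus; intros E;
          apply (f_equal (fun z : C => (fst z, snd z))) in E; injection E; intros; lra.
      - intros x Hx. split; apply BE; try apply M1; auto; apply DS; simpl.
        + replace (snd c - R - snd c) with (- R) by ring. rewrite Rabs_Ropp; auto.
        + replace (snd c + R - snd c) with R by ring. auto.
      - intros x Hx. split; apply BE; try apply M2; auto; apply DF; simpl.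
        + replace (fst c - R - fst c) with (- R) by ring. rewrite Rabs_Ropp; auto.
        + replace (fst c + R - fst c) with R by ring. auto. }
    assert (PN : 0 < Cmod (w - c) ^ N) by (apply pow_lt; auto).
    apply (Rmult_le_compat_r (Cmod (w - c) ^ N)) in B'; [|lra].
    unfold Rdiv. rewrite Rpow_mult_distr.
    replace (2 * PI * Cmod (f w)) with (2 * PI * 1 * (Cmod (f w) * (/ Cmod (w - c)) ^ N) * Cmod (w - c) ^ N).
    2: { rewrite pow_inv. field. lra. }
    lra. }
  apply Cmod_small_0. intros eps He.
  destruct (geometric_small (8 * R * M) (Cmod (w - c) / R)) with (eps := eps) as [N HN]; auto.
  { split; [apply Rle_div_r; lra|]. apply Rlt_div_l; lra. }
  specialize (Key N). assert (Z := Cmod_ge_0 (f w)). assert (Z2 := PI2_3_2). assert (2 * PI >= 1) by lra.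
  assert (1 * Cmod (f w) <= 2 * PI * Cmod (f w)) by (apply Rmult_le_compat_r; lra). lra.
Qed.

(** Vanishing spreads along the line of height [b] through overlapping discs. Their radius is at
    most half the distance to the real axis and to Re s = A, so real singularities of [f] are never
    met, however many there are. *)
Lemma identity_horizontal f A b : b <> 0 ->
  (forall s : C, A < fst s -> snd s <> 0 -> Chol f s) ->
  forall x0, A < x0 -> zero_near f (x0, b) -> forall x, A < x -> f (x, b) = RtoC 0.
Proof.
  intros Hb Hf x0 Hx0 H0 x Hx.
  set (m := Rmin x0 x - A). assert (Hm : 0 < m) by (unfold m; assert (Z := Rmin_glb_lt _ _ _ Hx0 Hx); lra).
  assert (Pb := Rabs_pos_lt _ Hb).
  set (r := Rmin (Rabs b) m / 2).
  assert (Z1 := Rmin_l (Rabs b) m). assert (Z2 := Rmin_r (Rabs b) m).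
  assert (Hr : 0 < r) by (assert (Z := Rmin_pos _ _ Pb Hm); unfold r; lra).
  assert (Q1 : r <= Rabs b / 2) by (unfold r; lra).
  assert (Q2 : r <= (Rmin x0 x - A) / 2) by (unfold r; fold m; lra).
  assert (Q3 : A < Rmin x0 x) by (apply Rmin_glb_lt; auto).
  destruct (nfloor_ex (Rabs (x - x0) / r)) as [N [_ HN]].
  { apply Rle_div_r; auto. rewrite Rmult_0_l. apply Rabs_pos. }
  assert (HS : 0 < INR N + 1) by (assert (Z := pos_INR N); lra).
  set (e := (x - x0) / (INR N + 1)).
  assert (He : Rabs e < r).
  { unfold e. unfold Rdiv. rewrite Rabs_mult, (Rabs_pos_eq (/ _)) by (left; apply Rinv_0_lt_compat; auto).
    apply Rlt_div_l; auto. apply Rlt_div_l in HN; auto. lra. }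
  assert (Step : forall k : nat, INR k <= INR N + 1 -> zero_near f (x0 + INR k * e, b)).
  { induction k; intros Hk.
    - simpl. rewrite Rmult_0_l, Rplus_0_r. auto.
    - rewrite S_INR in *.
      assert (Hk' : INR k <= INR N + 1) by lra. specialize (IHk Hk').
      assert (Bx : Rmin x0 x <= x0 + INR k * e).
      { assert (K0 := pos_INR k). set (th := INR k / (INR N + 1)).
        assert (T : 0 <= th <= 1).
        { unfold th. split; [apply Rle_div_r; lra|apply Rle_div_l; lra]. }
        replace (x0 + INR k * e) with ((1 - th) * x0 + th * x) by (unfold th, e; field; lra).
        assert (Y1 := Rmin_l x0 x). assert (Y2 := Rmin_r x0 x).
        apply Rle_trans with ((1 - th) * Rmin x0 x + th * Rmin x0 x); [lra|].
        apply Rplus_le_compat; apply Rmult_le_compat_l; lra. }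
      (* A disc of this radius about the next centre lies in the disc of radius [r] about the
         current one, to which [zero_disc] applies. *)
      exists (r - Rabs e). split; [lra|]. intros w Hw.
      apply (zero_disc f (x0 + INR k * e, b) r); auto.
      + simpl. intros u v Hu Hv. apply Hf; simpl.
        * clearbody r m e. simpl in *. lra.
        * intros ->. clearbody r m e. simpl in *. unfold Rabs in *. destruct (Rcase_abs b); lra.
      + eapply Rle_lt_trans; [apply (Cmod_tri3 w ((x0 + (INR k + 1) * e)%R, b))|].
        replace (((x0 + (INR k + 1) * e)%R, b) - ((x0 + INR k * e)%R, b))%C with (RtoC e) by (apply C_ext; simpl; ring).
        rewrite Cmod_R. lra. }
  destruct (Step (S N)) as [d [Hd Hz]]; [rewrite S_INR; lra|].
  rewrite S_INR in Hz. replace (x0 + (INR N + 1) * e) with x in Hz by (unfold e; field; lra).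
  apply Hz. replace ((x, b) - (x, b))%C with (RtoC 0) by ring. rewrite Cmod_0; auto.
Qed.

(** * Complex series and the exponential *)


(** There are [N] terms, against [N + 1] in [sum_n]; with the empty sum included, tail bounds at
    [N = 0] give bounds for the whole series. *)
Fixpoint Csum (f : nat -> C) (N : nat) : C :=
  match N with O => RtoC 0 | S k => (Csum f k + f k)%C end.
Fixpoint Rsum (f : nat -> R) (N : nat) : R :=
  match N with O => 0 | S k => Rsum f k + f k end.

Definition Cser (f : nat -> C) (l : C) :=
  forall eps, 0 < eps -> exists N0, forall N, (N0 <= N)%nat -> Cmod (Csum f N - l) <= eps.

Lemma Csum_sum_n f N : Csum f (S N) = sum_n (G := C_AbelianMonoid) f N.
Proof.
  induction N.
  - rewrite sum_O. simpl. ring.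
  - rewrite sum_Sn, <- IHN. reflexivity.
Qed.

Lemma Rsum_sum_n f N : Rsum f (S N) = sum_n f N.
Proof.
  induction N.
  - rewrite sum_O. simpl. ring.
  - rewrite sum_Sn, <- IHN. reflexivity.
Qed.

Lemma Cser_is_series f l : Cser f l <-> is_series (K := C_AbsRing) (V := C_NormedModule) f l.
Proof.
  split.
  - intros H P HP.
    apply (locally_C_iff l P) in HP. destruct HP as [d [Hd HP]].
    destruct (H (d / 2) ltac:(lra)) as [N0 HN]. exists N0. intros n Hn. apply HP.
    assert (K := HN (S n) ltac:(lia)). rewrite Csum_sum_n in K.
    eapply Rle_lt_trans; [exact K|]. lra.
  - intros H eps He.
    destruct (H (fun w => Cmod (w - l) <= eps)) as [N0 HN].
    { apply (locally_C_iff l). exists eps. split; auto. intros; lra. }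
    exists (S N0). intros [|n] Hn; [lia|]. rewrite Csum_sum_n. apply HN. lia.
Qed.

Lemma Cser_unique f l l' : Cser f l -> Cser f l' -> l = l'.
Proof.
  intros H K. apply Cmod_minus_0.
  replace (l - l')%C with (- (l' - l))%C by ring. rewrite Cmod_opp.
  assert (E : (l' - l)%C = RtoC 0).
  { apply Cmod_small_0. intros eps He.
    destruct (H (eps / 2) ltac:(lra)) as [N1 H1]. destruct (K (eps / 2) ltac:(lra)) as [N2 H2].
    eapply Rle_trans; [apply (Cmod_tri3 _ (Csum f (N1 + N2)))|].
    rewrite (Cmod_sym l'). specialize (H1 (N1 + N2)%nat ltac:(lia)). specialize (H2 (N1 + N2)%nat ltac:(lia)). lra. }
  rewrite E. apply Cmod_0.
Qed.

Lemma Csum_ext f g N : (forall n, (n < N)%nat -> f n = g n) -> Csum f N = Csum g N.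
Proof. induction N; simpl; intros H; auto. rewrite IHN, H; auto. Qed.

Lemma Rsum_ext f g N : (forall n, (n < N)%nat -> f n = g n) -> Rsum f N = Rsum g N.
Proof. induction N; simpl; intros H; auto. rewrite IHN, H; auto. Qed.

Lemma Cser_ext f g l : (forall n, f n = g n) -> Cser f l -> Cser g l.
Proof.
  intros E H eps He. destruct (H eps He) as [N0 HN]. exists N0. intros N HN'.
  rewrite <- (Csum_ext f g); auto.
Qed.

Lemma Csum_plus f g N : Csum (fun n => (f n + g n)%C) N = (Csum f N + Csum g N)%C.
Proof. induction N; simpl; [ring|]. rewrite IHN. ring. Qed.

Lemma Csum_scal c f N : Csum (fun n => (c * f n)%C) N = (c * Csum f N)%C.
Proof. induction N; simpl; [ring|]. rewrite IHN. ring. Qed.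

Lemma Csum_Cmod f N : Cmod (Csum f N) <= Rsum (fun n => Cmod (f n)) N.
Proof.
  induction N; simpl; [rewrite Cmod_0; lra|].
  eapply Rle_trans; [apply Cmod_triangle|]. lra.
Qed.

Lemma Rsum_le f g N : (forall n, (n < N)%nat -> f n <= g n) -> Rsum f N <= Rsum g N.
Proof.
  induction N; simpl; intros H; [lra|].
  apply Rplus_le_compat; auto.
Qed.

Lemma Rsum_scal c f N : Rsum (fun n => c * f n) N = c * Rsum f N.
Proof. induction N; simpl; [ring|]. rewrite IHN. ring. Qed.

Lemma Cser_plus f g l m : Cser f l -> Cser g m -> Cser (fun n => (f n + g n)%C) (l + m)%C.
Proof.
  intros H K eps He. destruct (H (eps / 2) ltac:(lra)) as [N1 H1]. destruct (K (eps / 2) ltac:(lra)) as [N2 H2].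
  exists (N1 + N2)%nat. intros N HN. rewrite Csum_plus.
  replace (Csum f N + Csum g N - (l + m))%C with ((Csum f N - l) + (Csum g N - m))%C by ring.
  eapply Rle_trans; [apply Cmod_triangle|].
  specialize (H1 N ltac:(lia)). specialize (H2 N ltac:(lia)). lra.
Qed.

Lemma Cser_scal c f l : Cser f l -> Cser (fun n => (c * f n)%C) (c * l)%C.
Proof.
  intros H eps He.
  assert (P : 0 < Cmod c + 1) by (assert (Z := Cmod_ge_0 c); lra).
  destruct (H (eps / (Cmod c + 1))) as [N0 HN]; [apply Rdiv_lt_0_compat; auto|].
  exists N0. intros N HN'. rewrite Csum_scal.
  replace (c * Csum f N - c * l)%C with (c * (Csum f N - l))%C by ring. rewrite Cmod_mult.
  apply Rle_trans with ((Cmod c + 1) * (eps / (Cmod c + 1))); [|apply Req_le; field; lra].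
  apply Rmult_le_compat; auto; try apply Cmod_ge_0. lra.
Qed.

Lemma Series_nonneg m : ex_series m -> (forall n, 0 <= m n) -> 0 <= Series m.
Proof.
  intros Hm Hp. apply (Rle_trans _ (Series (fun n => 0 * m n))).
  - rewrite Series_scal_l. lra.
  - apply Series_le; auto. intros n. rewrite Rmult_0_l. split; [lra|auto].
Qed.

Definition series_tail (m : nat -> R) (N : nat) : R := Series (fun k => m (N + k)%nat).

Lemma series_tail_small m : ex_series m -> (forall n, 0 <= m n) -> forall eps, 0 < eps -> exists N0, forall N, (N0 <= N)%nat -> series_tail m N <= eps.
Proof.
  intros Hm Hp eps He.
  assert (L := Series_correct m Hm).
  destruct (L (fun y => Rabs (y - Series m) < eps)) as [N0 HN].
  { exists (mkposreal _ He). intros y Hy; exact Hy. }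
  exists (S N0). intros [|N] HN'; [lia|]. specialize (HN N ltac:(lia)).
  unfold series_tail. assert (E := Series_incr_n m (S N) ltac:(lia) Hm).
  simpl pred in E. rewrite <- sum_n_Reals in E.
  change (Rabs (sum_n (G := R_AbelianMonoid) m N - Series m) < eps) in HN. rewrite E in HN.
  apply Rabs_def2 in HN. lra.
Qed.

Lemma series_tail_0 m : series_tail m 0 = Series m.
Proof. unfold series_tail. apply Series_ext. auto. Qed.

Lemma series_tail_nonneg m N : ex_series m -> (forall n, 0 <= m n) -> 0 <= series_tail m N.
Proof.
  intros Hm Hp. apply Series_nonneg; auto. apply ex_series_incr_n; auto.
Qed.

Lemma Rsum_le_tail m N k : ex_series m -> (forall n, 0 <= m n) -> Rsum (fun j => m (N + j)%nat) k <= series_tail m N.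
Proof.
  intros Hm Hp.
  assert (He : ex_series (fun j => m (N + j)%nat)) by (apply ex_series_incr_n; auto).
  destruct k; simpl.
  - apply series_tail_nonneg; auto.
  - change (Rsum (fun j => m (N + j)%nat) (S k) <= series_tail m N). rewrite Rsum_sum_n.
    unfold series_tail. rewrite (Series_incr_n (fun j => m (N + j)%nat) (S k)) by (auto; lia).
    simpl pred. rewrite <- sum_n_Reals.
    assert (0 <= Series (fun j => m (N + (S k + j))%nat)).
    { apply Series_nonneg; auto. apply (ex_series_incr_n (fun j => m (N + j)%nat) (S k)); auto. }
    lra.
Qed.

Lemma Csum_split f N k : Csum f (N + k) = (Csum f N + Csum (fun j => f (N + j)%nat) k)%C.
Proof.
  induction k; simpl.
  - rewrite Nat.add_0_r. ring.
  - rewrite Nat.add_succ_r. simpl. rewrite IHk. ring.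
Qed.

Lemma Csum_diff_tail f m N k : ex_series m -> (forall n, Cmod (f n) <= m n) ->
  Cmod (Csum f (N + k) - Csum f N) <= series_tail m N.
Proof.
  intros Hm Hf. rewrite Csum_split.
  replace (_ - _)%C with (Csum (fun j => f (N + j)%nat) k) by ring.
  eapply Rle_trans; [apply Csum_Cmod|].
  eapply Rle_trans; [|apply Rsum_le_tail; auto].
  - apply Rsum_le; auto.
  - intros n. eapply Rle_trans; [apply Cmod_ge_0|apply Hf].
Qed.

(** Completeness with a rate: the bound [e] on the increments survives in the limit. This turns
    tails of majorants into error bounds for sums and truncated integrals. *)
Lemma C_complete (u : nat -> C) (e : nat -> R) :
  (forall eps, 0 < eps -> exists N0, forall N, (N0 <= N)%nat -> e N <= eps) ->
  (forall N k, Cmod (u (N + k)%nat - u N) <= e N) ->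
  exists l, forall N, Cmod (u N - l) <= e N.
Proof.
  intros He Hu.
  assert (Cau : forall (p : C -> R), (forall a b, Rabs (p a - p b) <= Cmod (a - b)) -> exists l, Un_cv (fun n => p (u n)) l).
  { intros p Hp. cut (Cauchy_crit (fun n => p (u n))).
    { intros Hc. destruct (Rcomplete.R_complete _ Hc) as [l Hl]. eauto. }
    intros eps Heps. destruct (He (eps / 3) ltac:(lra)) as [N0 HN]. exists N0.
    intros n m Hn Hm. unfold Rdist.
    apply Rle_lt_trans with (Cmod (u n - u m)); auto.
    eapply Rle_lt_trans; [apply (Cmod_tri3 _ (u N0))|].
    replace n with (N0 + (n - N0))%nat by lia. replace m with (N0 + (m - N0))%nat by lia.
    rewrite (Cmod_sym (u N0)).
    assert (A := Hu N0 (n - N0)%nat). assert (B := Hu N0 (m - N0)%nat). specialize (HN N0 ltac:(lia)). lra. }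
  destruct (Cau fst) as [x Hx]. { intros a b. apply (fst_le_Cmod (a - b)). }
  destruct (Cau snd) as [y Hy]. { intros a b. apply (snd_le_Cmod (a - b)). }
  exists (x, y). intros N. apply le_epsilon. intros eps Heps.
  destruct (Hx (eps / 2) ltac:(lra)) as [N1 H1]. destruct (Hy (eps / 2) ltac:(lra)) as [N2 H2].
  set (n := (N + (N1 + N2))%nat).
  eapply Rle_trans; [apply (Cmod_tri3 _ (u n))|].
  rewrite Cmod_sym. apply Rplus_le_compat; [apply Hu|].
  eapply Rle_trans; [apply Cmod_le_abs|]. simpl.
  specialize (H1 n ltac:(lia)). specialize (H2 n ltac:(lia)). unfold Rdist in *. unfold Rminus in *. lra.
Qed.

Lemma Cser_dominated f m : ex_series m -> (forall n, Cmod (f n) <= m n) ->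
  exists l, Cser f l /\ forall N, Cmod (Csum f N - l) <= series_tail m N.
Proof.
  intros Hm Hf.
  assert (Hp : forall n, 0 <= m n) by (intros n; eapply Rle_trans; [apply Cmod_ge_0|apply Hf]).
  destruct (C_complete (Csum f) (series_tail m)) as [l Hl].
  - apply series_tail_small; auto.
  - intros. apply Csum_diff_tail; auto.
  - exists l. split; auto. intros eps He. destruct (series_tail_small m Hm Hp eps He) as [N0 HN].
    exists N0. intros N HN'. eapply Rle_trans; [apply Hl|]; auto.
Qed.

Lemma Cser_tail_bound f l m : ex_series m -> (forall n, Cmod (f n) <= m n) -> Cser f l ->
  forall N, Cmod (Csum f N - l) <= series_tail m N.
Proof.
  intros Hm Hf H. destruct (Cser_dominated f m Hm Hf) as [l' [H' Hl]].
  rewrite (Cser_unique _ _ _ H H'). auto.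
Qed.

Lemma Cser_bound f l m : ex_series m -> (forall n, Cmod (f n) <= m n) -> Cser f l -> Cmod l <= Series m.
Proof.
  intros Hm Hf H. assert (K := Cser_tail_bound f l m Hm Hf H 0%nat). simpl in K.
  rewrite series_tail_0 in K. rewrite Cmod_sym in K. replace (l - 0)%C with l in K by ring. auto.
Qed.

Lemma exp_mono x y : x <= y -> exp x <= exp y.
Proof. intros [H| ->]; [left; apply exp_increasing; auto|lra]. Qed.

(** Source of the Taylor bounds: estimating this integrand gives the first-order remainder, and
    inserting that estimate gives the second-order one. *)
Lemma Cexp_line_integral (u : C) : is_CI (fun t => u * Cexp (RtoC t * u))%C 0 1 (Cexp u - 1)%C.
Proof.
  destruct u as [p q]. apply is_CI_pair. simpl. split.
  - replace (exp p * cos q + - (1)) with (minus (exp (1 * p) * cos (1 * q)) (exp (0 * p) * cos (0 * q))).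
    2: { rewrite !Rmult_1_l, !Rmult_0_l, exp_0, cos_0. unfold minus, plus, opp; simpl. ring. }
    apply (is_RInt_derive (V := R_CompleteNormedModule) (fun t => exp (t * p) * cos (t * q))).
    + intros t _. auto_derive; auto.
      replace (t * p - 0 * q) with (t * p) by ring. replace (t * q + 0 * p) with (t * q) by ring. ring.
    + intros t _. apply (ex_derive_continuous (V := R_NormedModule)). auto_derive; auto.
  - replace (exp p * sin q + - 0) with (minus (exp (1 * p) * sin (1 * q)) (exp (0 * p) * sin (0 * q))).
    2: { rewrite !Rmult_1_l, !Rmult_0_l, exp_0, sin_0. unfold minus, plus, opp; simpl. ring. }
    apply (is_RInt_derive (V := R_CompleteNormedModule) (fun t => exp (t * p) * sin (t * q))).
    + intros t _. auto_derive; auto.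
      replace (t * p - 0 * q) with (t * p) by ring. replace (t * q + 0 * p) with (t * q) by ring. ring.
    + intros t _. apply (ex_derive_continuous (V := R_NormedModule)). auto_derive; auto.
Qed.

Lemma Cexp_minus1 (u : C) : Cmod (Cexp u - 1) <= Cmod u * exp (Cmod u).
Proof.
  assert (H := Cexp_line_integral u).
  rewrite <- (CI_unique _ _ _ _ H).
  replace (Cmod u * exp (Cmod u)) with ((1 - 0) * (Cmod u * exp (Cmod u))) by ring.
  apply CI_bound; [lra|eexists; eauto|].
  intros t Ht. rewrite Cmod_mult, Cmod_Cexp. apply Rmult_le_compat_l; [apply Cmod_ge_0|].
  apply exp_mono. simpl.
  assert (A := fst_le_Cmod u). assert (B := Rle_abs (fst u)). assert (D := Rabs_pos (fst u)).
  replace (t * fst u - 0 * snd u) with (t * fst u) by ring.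
  apply Rle_trans with (t * Rabs (fst u)); [apply Rmult_le_compat_l; lra|].
  apply Rle_trans with (1 * Rabs (fst u)); [apply Rmult_le_compat_r; lra|lra].
Qed.

Lemma Cexp_quadratic (u : C) : Cmod (Cexp u - 1 - u) <= Cmod u * Cmod u * exp (Cmod u).
Proof.
  assert (H := Cexp_line_integral u).
  assert (K : is_CI (fun _ => u) 0 1 u).
  { assert (Z := is_CI_const u 0 1). replace (RtoC (1 - 0) * u)%C with u in Z; [exact Z|].
    apply C_ext; simpl; ring. }
  assert (L := is_CI_plus _ _ _ _ _ _ H (is_CI_scal (- (1))%C _ _ _ _ K)).
  replace (Cexp u - 1 - u)%C with (Cexp u - 1 + - (1) * u)%C by ring.
  rewrite <- (CI_unique _ _ _ _ L).
  replace (Cmod u * Cmod u * exp (Cmod u)) with ((1 - 0) * (Cmod u * (Cmod u * exp (Cmod u)))) by ring.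
  apply CI_bound; [lra|eexists; eauto|].
  intros t Ht. replace (u * Cexp (RtoC t * u) + - (1) * u)%C with (u * (Cexp (RtoC t * u) - 1))%C by ring.
  rewrite Cmod_mult. apply Rmult_le_compat_l; [apply Cmod_ge_0|].
  eapply Rle_trans; [apply Cexp_minus1|].
  assert (E : Cmod (RtoC t * u) <= Cmod u).
  { rewrite Cmod_mult, Cmod_R, Rabs_pos_eq by lra.
    apply Rle_trans with (1 * Cmod u); [apply Rmult_le_compat_r; [apply Cmod_ge_0|lra]|lra]. }
  apply Rmult_le_compat; auto; try apply Cmod_ge_0.
  - left; apply exp_pos.
  - apply exp_mono; auto.
Qed.

Lemma Cder_Cexp z : Cder Cexp z (Cexp z).
Proof.
  apply (Cder_quadratic _ _ _ (Cmod (Cexp z) * exp 1) 1); [lra|].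
  intros w Hw.
  replace (Cexp w) with (Cexp z * Cexp (w - z))%C by (rewrite <- Cexp_add; f_equal; ring).
  replace (Cexp z * Cexp (w - z) - Cexp z - Cexp z * (w - z))%C with (Cexp z * (Cexp (w - z) - 1 - (w - z)))%C by ring.
  rewrite Cmod_mult, Rmult_assoc. apply Rmult_le_compat_l; [apply Cmod_ge_0|].
  eapply Rle_trans; [apply Cexp_quadratic|].
  rewrite Rmult_comm. apply Rmult_le_compat_r; [|apply exp_mono; lra].
  apply Rmult_le_pos; apply Cmod_ge_0.
Qed.

Lemma Chol_Cexp f z : Chol f z -> Chol (fun w => Cexp (f w)) z.
Proof. apply Chol_comp. eexists; apply Cder_Cexp. Qed.

Lemma cont_Cexp {T : UniformSpace} (f : T -> C) x :
  continuous (U := C_UniformSpace) f x -> continuous (U := C_UniformSpace) (fun t => Cexp (f t)) x.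
Proof.
  intros H. apply (continuous_comp f (fun z : C => Cexp z : C)); auto.
  eapply (Cder_cont Cexp). apply Cder_Cexp.
Qed.

(** * Laplace transforms *)


Definition lapf (a : R -> C) (w : C) (t : R) : C := (a t * Cexp (- (w * RtoC t)))%C.

Definition is_lap (a : R -> C) (w l : C) : Prop :=
  forall eps, 0 < eps -> exists X0, forall X, X0 <= X -> 0 <= X -> Cmod (CI (lapf a w) 0 X - l) <= eps.

(** Continuity is asked for every real [t] and not only for t >= 0, so that integrability is
    immediate on any interval and [a] may be shifted and reflected. *)
Definition ebound (a : R -> C) (M c : R) : Prop :=
  (forall t, curve_cont a t) /\ (forall t, 0 <= t -> Cmod (a t) <= M * exp (c * t)).

Lemma RtoC_cont t : curve_cont RtoC t.
Proof. apply continuous_pair_iff. split; simpl; [apply continuous_id|apply continuous_const]. Qed.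

Lemma lapf_cont a w t : curve_cont a t -> curve_cont (lapf a w) t.
Proof.
  intros H. apply cont_mult; auto. apply cont_Cexp, cont_opp, cont_mult; [apply cont_const|apply RtoC_cont].
Qed.

Lemma lapf_mod a w t : Cmod (lapf a w t) = Cmod (a t) * exp (- (fst w * t)).
Proof.
  unfold lapf. rewrite Cmod_mult, Cmod_Cexp. do 2 f_equal. simpl. ring.
Qed.

Lemma ebound_M a M c : ebound a M c -> 0 <= M.
Proof.
  intros [_ H]. specialize (H 0 ltac:(lra)). rewrite Rmult_0_r, exp_0 in H.
  assert (Z := Cmod_ge_0 (a 0)). lra.
Qed.

Lemma CI_bound_exp f M k X Y : (forall t, curve_cont f t) -> 0 < k -> X <= Y -> 0 <= M ->
  (forall t, X <= t <= Y -> Cmod (f t) <= M * exp (- (k * t))) ->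
  Cmod (CI f X Y) <= M / k * exp (- (k * X)).
Proof.
  intros Hc Hk HXY HM Hb.
  assert (HI : is_RInt (fun t => M * exp (- (k * t))) X Y (minus (- M / k * exp (- (k * Y))) (- M / k * exp (- (k * X))))).
  { apply (is_RInt_derive (V := R_CompleteNormedModule) (fun t => - M / k * exp (- (k * t)))).
    - intros t _. auto_derive; auto. field. lra.
    - intros t _. apply (ex_derive_continuous (V := R_NormedModule)). auto_derive; auto. }
  assert (K := norm_RInt_le (V := C_R_NormedModule) f _ X Y (CI f X Y) _ HXY
    (fun t Ht => Rle_trans _ _ _ (Req_le _ _ (norm_C_R (f t))) (Hb t Ht))
    (CI_correct f X Y (ex_CI_all f X Y Hc)) HI).
  rewrite norm_C_R in K. eapply Rle_trans; [apply K|]. unfold minus, plus, opp; simpl.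
  assert (0 <= M / k * exp (- (k * Y))).
  { apply Rmult_le_pos; [apply Rle_div_r; lra|left; apply exp_pos]. }
  unfold Rdiv in *. lra.
Qed.

Lemma lap_increment a M c w X Y : ebound a M c -> c < fst w -> 0 <= X <= Y ->
  Cmod (CI (lapf a w) 0 Y - CI (lapf a w) 0 X) <= M / (fst w - c) * exp (- ((fst w - c) * X)).
Proof.
  intros Ha Hw HX.
  assert (Hc : forall t, curve_cont (lapf a w) t) by (intros; apply lapf_cont, Ha).
  rewrite <- (CI_chasles (lapf a w) 0 X Y) by (apply ex_CI_all; auto).
  replace (CI (lapf a w) 0 X + CI (lapf a w) X Y - CI (lapf a w) 0 X)%C with (CI (lapf a w) X Y) by ring.
  apply CI_bound_exp; auto; try lra.
  - eapply ebound_M; eauto.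
  - intros t Ht. rewrite lapf_mod.
    replace (- ((fst w - c) * t)) with (c * t + - (fst w * t)) by ring.
    rewrite exp_plus, <- Rmult_assoc. apply Rmult_le_compat_r; [left; apply exp_pos|].
    apply Ha. lra.
Qed.

Lemma exp_decay K k : 0 < k -> forall eps, 0 < eps -> exists X0, 0 <= X0 /\ forall X, X0 <= X -> K * exp (- (k * X)) <= eps.
Proof.
  intros Hk eps He.
  assert (HK : 0 < Rabs K + 1) by (assert (Z := Rabs_pos K); lra).
  exists (Rabs K / (k * eps)).
  assert (0 < k * eps) by (apply Rmult_lt_0_compat; auto).
  split; [apply Rle_div_r; auto; rewrite Rmult_0_l; apply Rabs_pos|].
  intros X HX. apply Rle_div_l in HX; auto.
  assert (HX0 : 0 <= X).
  { destruct (Rle_lt_dec 0 X); auto. exfalso.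
    assert (X * (k * eps) < 0) by nra. assert (Z := Rabs_pos K). lra. }
  assert (E := exp_ineq1_le (k * X)).
  assert (P : 0 < exp (k * X)) by apply exp_pos.
  rewrite exp_Ropp.
  apply (Rmult_le_reg_r (exp (k * X))); auto.
  rewrite Rmult_assoc, Rinv_l, Rmult_1_r by lra.
  apply Rle_trans with (Rabs K); [apply Rle_abs|].
  eapply Rle_trans; [apply HX|]. apply Rle_trans with (eps * (k * X)); [lra|].
  apply Rmult_le_compat_l; lra.
Qed.

Lemma lap_exists a M c w : ebound a M c -> c < fst w ->
  exists l, is_lap a w l /\ Cmod l <= M / (fst w - c).
Proof.
  intros Ha Hw.
  set (k := fst w - c). assert (Hk : 0 < k) by (unfold k; lra).
  (* Integer upper limits come first, as completeness is stated for sequences; the bound on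
     increments then extends the rate to all real [X]. *)
  destruct (C_complete (fun n => CI (lapf a w) 0 (INR n)) (fun n => M / k * exp (- (k * INR n)))) as [l Hl].
  - intros eps He. destruct (exp_decay (M / k) k Hk eps He) as [X0 [P HX]].
    destruct (nfloor_ex X0 P) as [N [_ HN]]. exists (S N). intros n Hn. apply HX.
    apply le_INR in Hn. rewrite S_INR in Hn. lra.
  - intros N j. apply lap_increment; auto. split; [apply pos_INR|apply le_INR; lia].
  - assert (HX : forall X, 0 <= X -> Cmod (CI (lapf a w) 0 X - l) <= M / k * exp (- (k * X))).
    { intros X HX. apply le_epsilon. intros eps He.
      destruct (exp_decay (M / k) k Hk eps He) as [X0 [P HX0]].
      destruct (nfloor_ex (X + X0) ltac:(lra)) as [N [_ HN]].
      assert (E := S_INR N).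
      eapply Rle_trans; [apply (Cmod_tri3 _ (CI (lapf a w) 0 (INR (S N))))|].
      rewrite Cmod_sym. apply Rplus_le_compat.
      - apply lap_increment; auto. lra.
      - eapply Rle_trans; [apply Hl|]. apply HX0. lra. }
    exists l. split.
    + intros eps He. destruct (exp_decay (M / k) k Hk eps He) as [X0 [P HX0]].
      exists X0. intros X H1 H2. eapply Rle_trans; [apply HX; auto|]. apply HX0; auto.
    + specialize (HX 0 ltac:(lra)). rewrite CI_point, Rmult_0_r, Ropp_0, exp_0, Rmult_1_r in HX.
      rewrite Cmod_sym in HX. replace (l - 0)%C with l in HX by ring. auto.
Qed.

Lemma is_lap_unique a w l l' : is_lap a w l -> is_lap a w l' -> l = l'.
Proof.
  intros H K.
  assert (E : (l' - l)%C = RtoC 0).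
  { apply Cmod_small_0. intros eps He.
    destruct (H (eps / 2) ltac:(lra)) as [N1 H1]. destruct (K (eps / 2) ltac:(lra)) as [N2 H2].
    set (X := Rmax 0 (Rmax N1 N2)).
    assert (L0 := Rmax_l 0 (Rmax N1 N2)). assert (L1 := Rmax_r 0 (Rmax N1 N2)).
    assert (L2 := Rmax_l N1 N2). assert (L3 := Rmax_r N1 N2). fold X in L0, L1.
    eapply Rle_trans; [apply (Cmod_tri3 _ (CI (lapf a w) 0 X))|].
    rewrite (Cmod_sym l'). specialize (H1 X ltac:(lra) L0). specialize (H2 X ltac:(lra) L0). lra. }
  replace l' with ((l' - l) + l)%C by ring. rewrite E. ring.
Qed.

Lemma is_lap_ext a b w l : (forall t, 0 <= t -> a t = b t) -> is_lap a w l -> is_lap b w l.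
Proof.
  intros E H eps He. destruct (H eps He) as [X0 HX]. exists X0. intros X H1 H2.
  rewrite (CI_ext (lapf b w) (lapf a w)); auto.
  rewrite Rmin_left by auto. intros t Ht. unfold lapf. rewrite E; auto. lra.
Qed.

Lemma is_lap_plus a b w l m : (forall t, curve_cont a t) -> (forall t, curve_cont b t) ->
  is_lap a w l -> is_lap b w m -> is_lap (fun t => a t + b t)%C w (l + m)%C.
Proof.
  intros Ca Cb H K eps He. destruct (H (eps / 2) ltac:(lra)) as [X1 H1]. destruct (K (eps / 2) ltac:(lra)) as [X2 H2].
  exists (Rmax X1 X2). intros X HX P. assert (L1 := Rmax_l X1 X2). assert (L2 := Rmax_r X1 X2).
  rewrite (CI_ext_all _ (fun t => lapf a w t + lapf b w t)%C) by (intros; unfold lapf; ring).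
  rewrite CI_plus by (apply ex_CI_all; intros; apply lapf_cont; auto).
  replace (_ - _)%C with ((CI (lapf a w) 0 X - l) + (CI (lapf b w) 0 X - m))%C by ring.
  eapply Rle_trans; [apply Cmod_triangle|]. specialize (H1 X ltac:(lra) P). specialize (H2 X ltac:(lra) P). lra.
Qed.

Lemma is_lap_scal k a w l : (forall t, curve_cont a t) -> is_lap a w l -> is_lap (fun t => k * a t)%C w (k * l)%C.
Proof.
  intros Ca H eps He.
  assert (P : 0 < Cmod k + 1) by (assert (Z := Cmod_ge_0 k); lra).
  destruct (H (eps / (Cmod k + 1))) as [X0 HX]; [apply Rdiv_lt_0_compat; auto|].
  exists X0. intros X H1 H2.
  rewrite (CI_ext_all _ (fun t => k * lapf a w t)%C) by (intros; unfold lapf; ring).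
  rewrite CI_scal by (apply ex_CI_all; intros; apply lapf_cont; auto).
  replace (k * CI (lapf a w) 0 X - k * l)%C with (k * (CI (lapf a w) 0 X - l))%C by ring.
  rewrite Cmod_mult.
  apply Rle_trans with ((Cmod k + 1) * (eps / (Cmod k + 1))); [|apply Req_le; field; lra].
  apply Rmult_le_compat; auto; try apply Cmod_ge_0. lra.
Qed.

(** A total function, with an arbitrary value where the integral diverges. It is accessible only
    through [Lap_spec] and [Lap_unique]. *)
Definition Lap (a : R -> C) (w : C) : C := epsilon (inhabits (RtoC 0)) (is_lap a w).

Lemma Lap_spec a M c w : ebound a M c -> c < fst w -> is_lap a w (Lap a w).
Proof.
  intros Ha Hw. unfold Lap. apply epsilon_spec.
  destruct (lap_exists a M c w Ha Hw) as [l [H _]]. eauto.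
Qed.

Lemma Lap_unique a w l : is_lap a w l -> Lap a w = l.
Proof.
  intros H. apply (is_lap_unique a w); auto. unfold Lap. apply epsilon_spec. eauto.
Qed.

Lemma Lap_bound a M c w : ebound a M c -> c < fst w -> Cmod (Lap a w) <= M / (fst w - c).
Proof.
  intros Ha Hw. destruct (lap_exists a M c w Ha Hw) as [l [H B]]. rewrite (Lap_unique _ _ _ H). auto.
Qed.

Lemma exp_C_cont (s : C) t : curve_cont (fun t => Cexp (s * RtoC t)) t.
Proof. apply cont_Cexp, cont_mult; [apply cont_const|apply RtoC_cont]. Qed.

Lemma ebound_exp (s : C) : ebound (fun t => Cexp (s * RtoC t)) 1 (fst s).
Proof.
  split; [apply exp_C_cont|]. intros t _. rewrite Cmod_Cexp. simpl.
  apply Req_le. rewrite Rmult_1_l. f_equal. ring.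
Qed.

Lemma is_CI_Cexp (s : C) a b : s <> RtoC 0 ->
  is_CI (fun t => Cexp (s * RtoC t)) a b ((Cexp (s * RtoC b) - Cexp (s * RtoC a)) / s)%C.
Proof.
  intros Hs.
  replace ((Cexp (s * RtoC b) - Cexp (s * RtoC a)) / s)%C with (/ s * Cexp (s * RtoC b) - / s * Cexp (s * RtoC a))%C by (field; auto).
  apply (CI_FTC (fun t => / s * Cexp (s * RtoC t))%C).
  - intros t _.
    assert (D : Cder (fun w => / s * Cexp w)%C (0 + RtoC t * s)%C (/ s * Cexp (0 + RtoC t * s))%C).
    { replace (/ s * Cexp (0 + RtoC t * s))%C with (0 * Cexp (0 + RtoC t * s) + / s * Cexp (0 + RtoC t * s))%C by ring.
      apply (Cder_mult (fun _ => (/ s)%C)); [apply Cder_const|apply Cder_Cexp]. }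
    apply Cder_line in D.
    replace (/ s * Cexp (0 + RtoC t * s) * s)%C with (Cexp (s * RtoC t)) in D.
    + eapply is_derive_ext; [|apply D]. intros u. simpl. f_equal. f_equal. ring.
    + replace (0 + RtoC t * s)%C with (s * RtoC t)%C by ring. field; auto.
  - intros t _. apply exp_C_cont.
Qed.

Lemma is_lap_exp (s w : C) : fst s < fst w -> is_lap (fun t => Cexp (s * RtoC t)) w (/ (w - s))%C.
Proof.
  intros H.
  assert (N : (s - w)%C <> RtoC 0).
  { intros E. apply (f_equal fst) in E. simpl in E. lra. }
  assert (N' : (w - s)%C <> RtoC 0).
  { intros E. apply (f_equal fst) in E. simpl in E. lra. }
  intros eps He.
  destruct (exp_decay (/ Cmod (w - s)) (fst w - fst s) ltac:(lra) eps He) as [X0 [P HX]].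
  exists X0. intros X H1 H2.
  rewrite (CI_ext_all _ (fun t => Cexp ((s - w) * RtoC t))).
  2: { intros t. unfold lapf. rewrite <- Cexp_add. f_equal. ring. }
  rewrite (CI_unique _ _ _ _ (is_CI_Cexp (s - w)%C 0 X N)).
  replace ((s - w) * RtoC 0)%C with (RtoC 0) by ring. rewrite Cexp_0.
  replace ((Cexp ((s - w) * RtoC X) - 1) / (s - w) - / (w - s))%C with (- (/ (w - s) * Cexp ((s - w) * RtoC X)))%C.
  2: { field. auto. }
  rewrite Cmod_opp, Cmod_mult, Cmod_Cexp, Cmod_inv by auto.
  eapply Rle_trans; [|apply (HX X H1)]. apply Req_le. do 2 f_equal. simpl. ring.
Qed.

Lemma ebound_weaken a M c M' c' : ebound a M c -> M <= M' -> c <= c' -> ebound a M' c'.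
Proof.
  intros Ha HM Hc. assert (P := ebound_M _ _ _ Ha). destruct Ha as [H1 H2]. split; auto.
  intros t Ht. eapply Rle_trans; [apply H2; auto|].
  apply Rmult_le_compat; auto; [left; apply exp_pos|].
  apply exp_mono, Rmult_le_compat_r; auto.
Qed.

Lemma ebound_scal k a M c : ebound a M c -> ebound (fun t => k * a t)%C (Cmod k * M) c.
Proof.
  intros [A1 A2]. split.
  - intros; apply cont_mult; auto. apply cont_const.
  - intros t Ht. rewrite Cmod_mult, Rmult_assoc. apply Rmult_le_compat_l; auto. apply Cmod_ge_0.
Qed.

(** This is exp x >= x^2/2 at x = e t. It absorbs quadratic growth at the price of an arbitrarily
    small exponent. *)
Lemma sq_le_exp e t : 0 < e -> 0 <= t -> t * t <= 2 / (e * e) * exp (e * t).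
Proof.
  intros He Ht.
  assert (E : 1 + e * t / 2 <= exp (e * t / 2)) by apply exp_ineq1_le.
  assert (P : 0 <= e * t) by (apply Rmult_le_pos; lra).
  assert (F : exp (e * t) = exp (e * t / 2) * exp (e * t / 2)) by (rewrite <- exp_plus; f_equal; field).
  assert (G : (1 + e * t / 2) * (1 + e * t / 2) <= exp (e * t)).
  { rewrite F. apply Rmult_le_compat; lra. }
  assert (A : (e * t) * (e * t) <= 2 * (2 * exp (e * t))) by nra.
  assert (ee : 0 < e * e) by (apply Rmult_lt_0_compat; auto).
  apply (Rmult_le_reg_l (e * e)); auto.
  replace (e * e * (2 / (e * e) * exp (e * t))) with (2 * exp (e * t)) by (field; lra).
  clear A.
  assert (T := exp_pos (e * t)).
  assert (B : exp (e * t) >= 1 + e * t + (e * t) * (e * t) / 2).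
  { clear - P. set (x := e * t) in *.
    destruct (Req_dec x 0) as [->|Nx]; [rewrite exp_0; lra|].
    assert (Hx : 0 < x) by lra.
    destruct (MVT_gen (fun u => exp u - 1 - u - u * u / 2) 0 x (fun u => exp u - 1 - u)) as [c [Hc Ec]].
    - intros u _. auto_derive; auto. field.
    - intros u _. reg.
    - rewrite Rmin_left, Rmax_right in Hc by lra. rewrite exp_0 in Ec.
      assert (Z := exp_ineq1_le c). assert (0 <= (exp c - 1 - c) * (x - 0)) by (apply Rmult_le_pos; lra). lra. }
  lra.
Qed.

(** The candidate derivative is the transform of -t a(t), and the remainder is itself the transform
    of [r], so [Lap_bound] controls it. Of the gap [k] between Re z and [c], one quarter pays for
    exp(|h| t), which needs |h| < k/4, and one quarter for t^2. *)
Lemma lap_holomorphic a M c z : ebound a M c -> c < fst z -> Chol (Lap a) z.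
Proof.
  intros Ha Hz. assert (HM := ebound_M _ _ _ Ha). destruct Ha as [Ca Ba].
  set (k := fst z - c). assert (Hk : 0 < k) by (unfold k; lra).
  set (b := fun t => (- RtoC t * a t)%C).
  assert (Hb : ebound b (M * (2 / k)) (c + k / 2)).
  { split.
    - intros t. apply cont_mult; auto. apply cont_opp, RtoC_cont.
    - intros t Ht. unfold b. rewrite Cmod_mult, Cmod_opp, Cmod_R, Rabs_pos_eq by auto.
      assert (E := exp_ineq1_le (k / 2 * t)).
      assert (F : t <= 2 / k * exp (k / 2 * t)).
      { apply Rle_trans with (2 / k * (k / 2 * t)); [apply Req_le; field; lra|].
        apply Rmult_le_compat_l; [apply Rle_div_r; lra|lra]. }
      replace ((c + k / 2) * t) with (k / 2 * t + c * t) by ring. rewrite exp_plus.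
      replace (M * (2 / k) * (exp (k / 2 * t) * exp (c * t))) with ((2 / k * exp (k / 2 * t)) * (M * exp (c * t))) by ring.
      apply Rmult_le_compat; auto. apply Cmod_ge_0. }
  exists (Lap b z).
  set (K := M * (2 / (k / 4 * (k / 4)))).
  apply (Cder_quadratic _ _ _ (K / (k / 2)) (k / 4)); [lra|].
  intros w Hw. set (h := (w - z)%C) in *.
  assert (Hfw : c < fst w).
  { assert (Z := fst_le_Cmod h). unfold h in Z at 1. simpl in Z.
    assert (Z2 := Rle_abs (- (fst w + - fst z))). rewrite Rabs_Ropp in Z2. unfold k in *. lra. }
  set (r := fun t => (a t * (Cexp (- (h * RtoC t)) - 1 - - (h * RtoC t)))%C).
  assert (Hr : ebound r (K * (Cmod h * Cmod h)) (c + k / 2)).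
  { split.
    - intros t. apply cont_mult; auto. apply cont_minus; [apply cont_minus|].
      + apply cont_Cexp, cont_opp, cont_mult; [apply cont_const|apply RtoC_cont].
      + apply cont_const.
      + apply cont_opp, cont_mult; [apply cont_const|apply RtoC_cont].
    - intros t Ht. unfold r. rewrite Cmod_mult.
      assert (E := Cexp_quadratic (- (h * RtoC t))).
      rewrite Cmod_opp, Cmod_mult, Cmod_R, (Rabs_pos_eq t) in E by auto.
      replace ((c + k / 2) * t) with (c * t + (k / 4 * t + k / 4 * t)) by field. rewrite !exp_plus.
      replace (K * (Cmod h * Cmod h) * (exp (c * t) * (exp (k / 4 * t) * exp (k / 4 * t))))
        with ((M * exp (c * t)) * (Cmod h * Cmod h * (2 / (k / 4 * (k / 4)) * exp (k / 4 * t)) * exp (k / 4 * t))) by (unfold K; ring).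
      apply Rmult_le_compat; auto; try apply Cmod_ge_0.
      eapply Rle_trans; [apply E|].
      replace (Cmod h * t * (Cmod h * t)) with (Cmod h * Cmod h * (t * t)) by ring.
      apply Rmult_le_compat; try (left; apply exp_pos).
      + apply Rmult_le_pos; [apply Rmult_le_pos; apply Cmod_ge_0|apply Rle_0_sqr].
      + apply Rmult_le_compat_l; [apply Rmult_le_pos; apply Cmod_ge_0|]. apply sq_le_exp; lra.
      + apply exp_mono. apply Rmult_le_compat_r; lra. }
  assert (L0 := Lap_spec a M c z (conj Ca Ba) Hz).
  assert (L1 := Lap_spec a M c w (conj Ca Ba) Hfw).
  assert (L2 := Lap_spec b _ _ z Hb ltac:(unfold k in *; lra)).
  assert (L3 : is_lap r z (Lap a w - Lap a z - Lap b z * h)%C).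
  { intros eps He.
    assert (P : 0 < Cmod h + 1) by (assert (Z := Cmod_ge_0 h); lra).
    destruct (L0 (eps / 3) ltac:(lra)) as [X0 H0]. destruct (L1 (eps / 3) ltac:(lra)) as [X1 H1].
    destruct (L2 (eps / 3 / (Cmod h + 1))) as [X2 H2]; [apply Rdiv_lt_0_compat; lra|].
    exists (Rmax X0 (Rmax X1 X2)). intros X HX PX.
    assert (M0 := Rmax_l X0 (Rmax X1 X2)). assert (M1 := Rmax_r X0 (Rmax X1 X2)).
    assert (M2 := Rmax_l X1 X2). assert (M3 := Rmax_r X1 X2).
    specialize (H0 X ltac:(lra) PX). specialize (H1 X ltac:(lra) PX). specialize (H2 X ltac:(lra) PX).
    rewrite (CI_ext_all (lapf r z) (fun t => (lapf a w t - lapf a z t) - h * lapf b z t)%C).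
    2: { intros t. unfold lapf, r, b.
         replace (Cexp (- (w * RtoC t))) with (Cexp (- (h * RtoC t)) * Cexp (- (z * RtoC t)))%C; [ring|].
         rewrite <- Cexp_add. f_equal. unfold h. ring. }
    assert (Xa : forall v, ex_CI (lapf a v) 0 X) by (intros; apply ex_CI_all; intros; apply lapf_cont; auto).
    assert (Xb : ex_CI (lapf b z) 0 X) by (apply ex_CI_all; intros; apply lapf_cont, Hb).
    rewrite CI_minus; [|apply ex_CI_all; intros; apply cont_minus; apply lapf_cont; auto|apply ex_CI_scal; auto].
    rewrite CI_minus, CI_scal by auto.
    replace (_ - _)%C with ((CI (lapf a w) 0 X - Lap a w) + (- (CI (lapf a z) 0 X - Lap a z)) + (- (h * (CI (lapf b z) 0 X - Lap b z))))%C by ring.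
    eapply Rle_trans; [apply Cmod_triangle|].
    eapply Rle_trans; [apply Rplus_le_compat_r; apply Cmod_triangle|].
    rewrite !Cmod_opp, Cmod_mult.
    assert (Cmod h * Cmod (CI (lapf b z) 0 X - Lap b z) <= (Cmod h + 1) * (eps / 3 / (Cmod h + 1))).
    { apply Rmult_le_compat; auto; try apply Cmod_ge_0. lra. }
    replace ((Cmod h + 1) * (eps / 3 / (Cmod h + 1))) with (eps / 3) in H by (field; lra). lra. }
  rewrite <- (Lap_unique _ _ _ L3).
  eapply Rle_trans; [apply (Lap_bound r _ _ z Hr); unfold k in *; lra|].
  apply Req_le. replace (fst z - (c + k / 2)) with (k / 2) by (unfold k; field). field. lra.
Qed.

Lemma is_lap_Csum (f : nat -> R -> C) w (l : nat -> C) N :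
  (forall n t, curve_cont (f n) t) -> (forall n, is_lap (f n) w (l n)) ->
  (forall t, curve_cont (fun t => Csum (fun n => f n t) N) t) /\
  is_lap (fun t => Csum (fun n => f n t) N) w (Csum l N).
Proof.
  intros Hc Hl. induction N; simpl.
  - split; [intros; apply cont_const|].
    intros eps He. exists 0. intros X _ _.
    rewrite (CI_ext_all _ (fun _ => RtoC 0)) by (intros; unfold lapf; ring).
    rewrite (CI_unique _ _ _ _ (is_CI_const (RtoC 0) 0 X)).
    replace (RtoC (X - 0) * 0 - 0)%C with (RtoC 0) by ring. rewrite Cmod_0. lra.
  - destruct IHN as [H1 H2]. split.
    + intros t. apply cont_plus; auto.
    + apply is_lap_plus; auto.
Qed.

Lemma lap_series (f : nat -> R -> C) a M c e w :
  ebound a M c -> c < fst w ->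
  (forall n, exists Mn, ebound (f n) Mn c) ->
  (forall eps, 0 < eps -> exists N0, forall N, (N0 <= N)%nat -> e N <= eps) ->
  (forall N t, 0 <= t -> Cmod (a t - Csum (fun n => f n t) N) <= e N * exp (c * t)) ->
  Cser (fun n => Lap (f n) w) (Lap a w).
Proof.
  intros Ha Hw Hf He Hr eps Heps.
  assert (Hk : 0 < fst w - c) by lra.
  destruct (He (eps * (fst w - c)) ltac:(apply Rmult_lt_0_compat; auto)) as [N0 HN].
  exists N0. intros N HN'. specialize (HN N HN').
  assert (Hl : forall n, is_lap (f n) w (Lap (f n) w)).
  { intros n. destruct (Hf n) as [Mn Hn]. eapply Lap_spec; eauto. }
  assert (Hc : forall n t, curve_cont (f n) t).
  { intros n. destruct (Hf n) as [Mn Hn]. apply Hn. }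
  destruct (is_lap_Csum f w _ N Hc Hl) as [C1 L1].
  assert (L2 := Lap_spec a M c w Ha Hw).
  assert (L3 := is_lap_plus _ _ _ _ _ (proj1 Ha) (fun t => cont_mult (fun _ => (-(1))%C) _ t (cont_const _ _) (C1 t)) L2 (is_lap_scal (- (1))%C _ _ _ C1 L1)).
  set (r := fun t => (a t + - (1) * Csum (fun n => f n t) N)%C) in *.
  assert (Hrb : ebound r (e N) c).
  { split.
    - intros t. apply cont_plus; [apply Ha|]. apply cont_mult; [apply cont_const|apply C1].
    - intros t Ht. unfold r. replace (a t + - (1) * Csum (fun n => f n t) N)%C with (a t - Csum (fun n => f n t) N)%C by ring. auto. }
  assert (B := Lap_bound r _ _ w Hrb Hw). rewrite (Lap_unique _ _ _ L3) in B.
  rewrite Cmod_sym. replace (Lap a w - Csum (fun n => Lap (f n) w) N)%C with (Lap a w + - (1) * Csum (fun n => Lap (f n) w) N)%C by ring.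
  eapply Rle_trans; [apply B|]. apply Rle_div_l; auto.
Qed.

(** * The Fourier series of the sawtooth *)


Lemma mvt_bound (f df : R -> R) a b D : (forall t, Rmin a b <= t <= Rmax a b -> is_derive f t (df t) /\ Rabs (df t) <= D) ->
  Rabs (f b - f a) <= D * Rabs (b - a).
Proof.
  intros H. destruct (MVT_gen f a b df) as [c [Hc E]].
  - intros x Hx. apply H; lra.
  - intros x Hx. apply derivable_continuous_pt. exists (df x). apply is_derive_Reals. apply H; auto.
  - rewrite E, Rabs_mult. apply Rmult_le_compat_r; [apply Rabs_pos|]. apply H; auto.
Qed.

Lemma ex_series_bounded (m : nat -> R) B : (forall n, 0 <= m n) -> (forall N, Rsum m N <= B) -> ex_series m.
Proof.
  intros Hp Hb.
  destruct (ex_finite_lim_seq_incr (fun n => sum_n m n) B) as [l Hl].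
  - intros n. rewrite sum_Sn. unfold plus; simpl. specialize (Hp (S n)). lra.
  - intros n. assert (Z := Hb (S n)). rewrite Rsum_sum_n in Z. exact Z.
  - exists l. exact Hl.
Qed.

Lemma ex_series_dominated (f m : nat -> R) : (forall n, 0 <= f n <= m n) -> ex_series m -> ex_series f.
Proof.
  intros H Hm. apply (ex_series_le (K := R_AbsRing) (V := R_CompleteNormedModule) _ m); auto.
  intros n. unfold norm; simpl. unfold abs; simpl. rewrite Rabs_pos_eq; apply H.
Qed.

(** Comparison with a telescoping series: by the mean value theorem for t^(1-s) on [n, n+1], the
    term (n+1)^(-s) is at most the increment divided by s - 1. *)
Lemma ex_series_power s : 1 < s -> ex_series (fun n => Rpower (INR (S n)) (- s)).
Proof.
  intros Hs.
  apply (ex_series_bounded _ (1 + / (s - 1))).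
  { intros n. left. apply exp_pos. }
  assert (Pos : forall n, 0 < INR (S n)) by (intros; apply lt_0_INR; lia).
  assert (St : forall n, Rpower (INR (S (S n))) (- s) <= / (s - 1) * (Rpower (INR (S n)) (1 - s) - Rpower (INR (S (S n))) (1 - s))).
  { intros n. assert (P := Pos n). assert (P' := Pos (S n)). rewrite (S_INR (S n)) in *. set (x := INR (S n)) in *.
    destruct (MVT_gen (fun t => Rpower t (1 - s)) x (x + 1) (fun t => (1 - s) * Rpower t (1 - s - 1))) as [c [Hc E]].
    - intros t Ht. rewrite Rmin_left in Ht by lra. apply is_derive_Reals, derivable_pt_lim_power. lra.
    - intros t Ht. rewrite Rmin_left in Ht by lra. apply derivable_continuous_pt.
      eexists. apply derivable_pt_lim_power. lra.
    - rewrite Rmin_left, Rmax_right in Hc by lra.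
      replace (Rpower x (1 - s) - Rpower (x + 1) (1 - s)) with ((s - 1) * Rpower c (- s)).
      2: { replace (- s) with (1 - s - 1) by ring. lra. }
      rewrite <- Rmult_assoc, Rinv_l, Rmult_1_l by lra.
      unfold Rpower. apply exp_mono.
      assert (L : ln c <= ln (x + 1)) by (apply ln_le; lra). nra. }
  assert (T : forall N, Rsum (fun n => Rpower (INR (S n)) (- s)) (S N) <= 1 + / (s - 1) * (1 - Rpower (INR (S N)) (1 - s))).
  { induction N.
    - simpl. unfold Rpower. rewrite ln_1, !Rmult_0_r, exp_0. lra.
    - change (Rsum (fun n => Rpower (INR (S n)) (- s)) (S N) + Rpower (INR (S (S N))) (- s) <= 1 + / (s - 1) * (1 - Rpower (INR (S (S N))) (1 - s))).
      specialize (St N). lra. }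
  intros [|N].
  - simpl. assert (0 < / (s - 1)) by (apply Rinv_0_lt_compat; lra). lra.
  - eapply Rle_trans; [apply T|]. assert (0 < / (s - 1)) by (apply Rinv_0_lt_compat; lra).
    assert (Z := exp_pos ((1 - s) * ln (INR (S N)))). unfold Rpower.
    assert (0 < / (s - 1) * exp ((1 - s) * ln (INR (S N)))) by (apply Rmult_lt_0_compat; auto). lra.
Qed.

Lemma ex_series_inv_sq : ex_series (fun n => / (INR (S n) * INR (S n))).
Proof.
  apply (ex_series_ext (fun n => Rpower (INR (S n)) (- (2)))).
  - intros n. assert (P : 0 < INR (S n)) by (apply lt_0_INR; lia).
    rewrite Rpower_Ropp. f_equal. replace 2 with (INR 2) by (simpl; ring). rewrite Rpower_pow by auto.
    simpl. ring.
  - apply ex_series_power. lra.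
Qed.

(** Subtracting 1 from each cosine makes every term vanish at 0. The constant 1/6 of the usual
    expansion, equivalent to the value of the sum of 1/n^2, thus never has to be computed. *)
Definition saw_term (n : nat) (x : R) : R :=
  (cos (2 * PI * INR (S n) * x) - 1) / (PI * PI * (INR (S n) * INR (S n))).

(* [saw x] is [{x}^2 - {x}], given by its Fourier series. *)
Definition saw (x : R) : R := Series (fun n => saw_term n x).

Definition saw_maj (n : nat) : R := 2 / (PI * PI) * / (INR (S n) * INR (S n)).

Lemma PI_sq_pos : 0 < PI * PI.
Proof. apply Rmult_lt_0_compat; apply PI_RGT_0. Qed.

Lemma INR_sq_pos n : 0 < INR (S n) * INR (S n).
Proof. assert (P : 0 < INR (S n)) by (apply lt_0_INR; lia). apply Rmult_lt_0_compat; auto. Qed.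

Lemma saw_maj_nonneg n : 0 <= saw_maj n.
Proof.
  unfold saw_maj. assert (A := PI_sq_pos). assert (B := INR_sq_pos n).
  apply Rmult_le_pos; [apply Rle_div_r; lra|left; apply Rinv_0_lt_compat; auto].
Qed.

Lemma saw_term_bound n x : Rabs (saw_term n x) <= saw_maj n.
Proof.
  unfold saw_term, saw_maj. assert (A := PI_sq_pos). assert (B := INR_sq_pos n).
  assert (AB : 0 < PI * PI * (INR (S n) * INR (S n))) by (apply Rmult_lt_0_compat; auto).
  replace (2 / (PI * PI) * / (INR (S n) * INR (S n))) with (2 * / (PI * PI * (INR (S n) * INR (S n))))
    by (rewrite (Rinv_mult (PI * PI)); unfold Rdiv; ring).
  unfold Rdiv. rewrite Rabs_mult, (Rabs_pos_eq (/ _)) by (left; apply Rinv_0_lt_compat; auto).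
  apply Rmult_le_compat_r; [left; apply Rinv_0_lt_compat; auto|].
  assert (Z := COS_bound (2 * PI * INR (S n) * x)). apply Rabs_le. lra.
Qed.

Lemma ex_saw_maj : ex_series saw_maj.
Proof. apply (ex_series_scal (V := R_NormedModule)). apply ex_series_inv_sq. Qed.

Lemma Rsum_tail_bound (f m : nat -> R) N : ex_series m -> (forall n, Rabs (f n) <= m n) ->
  Rabs (Series f - Rsum f N) <= series_tail m N.
Proof.
  intros Hm Hf.
  assert (Ef : ex_series f).
  { apply (ex_series_le (K := R_AbsRing) (V := R_CompleteNormedModule) _ m); auto. }
  assert (E : Series f - Rsum f N = Series (fun k => f (N + k)%nat)).
  { destruct N; simpl.
    - rewrite Rminus_0_r. reflexivity.
    - change (Series f - Rsum f (S N) = Series (fun k => f (S N + k)%nat)).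
      rewrite (Series_incr_n f (S N)) by (auto; lia). rewrite Rsum_sum_n, sum_n_Reals. simpl pred. ring. }
  rewrite E. unfold series_tail.
  assert (Em : ex_series (fun k => m (N + k)%nat)) by (apply ex_series_incr_n; auto).
  eapply Rle_trans; [apply Series_Rabs|].
  - apply (ex_series_le (K := R_AbsRing) (V := R_CompleteNormedModule) _ (fun k => m (N + k)%nat)); auto.
    intros n. unfold norm; simpl. unfold abs; simpl. rewrite Rabs_Rabsolu. auto.
  - apply Series_le; auto. intros n. split; [apply Rabs_pos|auto].
Qed.

Lemma saw_tail x N : Rabs (saw x - Rsum (fun n => saw_term n x) N) <= series_tail saw_maj N.
Proof. apply Rsum_tail_bound; [apply ex_saw_maj|]. intros; apply saw_term_bound. Qed.

Lemma continuous_R_iff (f : R -> R) x : continuous f x <->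
  forall eps, 0 < eps -> exists d, 0 < d /\ forall y, Rabs (y - x) < d -> Rabs (f y - f x) < eps.
Proof.
  split.
  - intros H eps He. destruct (H (fun v => Rabs (v - f x) < eps)) as [d Hd].
    { exists (mkposreal _ He). intros v Hv; exact Hv. }
    exists d. split; [apply cond_pos|]. intros y Hy. apply Hd. exact Hy.
  - intros H P [e He]. destruct (H e (cond_pos e)) as [d [Hd Hy]].
    exists (mkposreal _ Hd). intros y By. apply He. apply Hy. exact By.
Qed.

Lemma Rsum_continuous (f : nat -> R -> R) x N : (forall n, continuous (f n) x) ->
  continuous (fun y => Rsum (fun n => f n y) N) x.
Proof.
  intros H. induction N; simpl.
  - apply continuous_const.
  - apply (continuous_plus (V := R_NormedModule)); auto.
Qed.

Lemma uniform_limit_continuous (f : nat -> R -> R) (g : R -> R) (e : nat -> R) x :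
  (forall n, continuous (f n) x) -> (forall N y, Rabs (g y - Rsum (fun n => f n y) N) <= e N) ->
  (forall eps, 0 < eps -> exists N, e N <= eps) -> continuous g x.
Proof.
  intros Hf Hg He. apply continuous_R_iff. intros eps Heps.
  destruct (He (eps / 4) ltac:(lra)) as [N HN].
  assert (Hc := Rsum_continuous f x N Hf). rewrite continuous_R_iff in Hc.
  destruct (Hc (eps / 4) ltac:(lra)) as [d [Hd Hy]]. exists d. split; auto.
  intros y By. specialize (Hy y By). assert (A := Hg N y). assert (B := Hg N x).
  apply Rabs_def2 in Hy. apply Rabs_le_between in A. apply Rabs_le_between in B.
  apply Rabs_def1; lra.
Qed.

Lemma saw_term_continuous n x : continuous (saw_term n) x.
Proof.
  apply (ex_derive_continuous (V := R_NormedModule)). unfold saw_term. auto_derive. auto.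
Qed.

Lemma saw_continuous x : continuous saw x.
Proof.
  apply (uniform_limit_continuous saw_term saw (series_tail saw_maj)).
  - intros; apply saw_term_continuous.
  - intros; apply saw_tail.
  - intros eps He. destruct (series_tail_small saw_maj ex_saw_maj saw_maj_nonneg eps He) as [N HN]. exists N. auto.
Qed.

Lemma saw_0 : saw 0 = 0.
Proof.
  unfold saw. rewrite (Series_ext _ (fun n => 0 * 0)).
  - rewrite Series_scal_l. ring.
  - intros n. unfold saw_term. rewrite Rmult_0_r, cos_0. unfold Rdiv. ring.
Qed.

Lemma dirichlet_kernel N x :
  sin (PI * x) * (1 + 2 * Rsum (fun n => cos (2 * PI * INR (S n) * x)) N) = sin ((2 * INR N + 1) * (PI * x)).
Proof.
  induction N.
  - simpl. rewrite !Rmult_0_r, Rplus_0_l, Rmult_1_l, Rplus_0_r. ring.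
  - change (Rsum (fun n => cos (2 * PI * INR (S n) * x)) (S N)) with
      (Rsum (fun n => cos (2 * PI * INR (S n) * x)) N + cos (2 * PI * INR (S N) * x)).
    replace (sin (PI * x) * (1 + 2 * (Rsum (fun n => cos (2 * PI * INR (S n) * x)) N + cos (2 * PI * INR (S N) * x))))
      with (sin (PI * x) * (1 + 2 * Rsum (fun n => cos (2 * PI * INR (S n) * x)) N) + 2 * sin (PI * x) * cos (2 * PI * INR (S N) * x)) by ring.
    rewrite IHN. rewrite S_INR.
    set (u := 2 * PI * (INR N + 1) * x). set (v := PI * x).
    replace ((2 * INR N + 1) * v) with (u - v) by (unfold u, v; ring).
    replace ((2 * (INR N + 1) + 1) * v) with (u + v) by (unfold u, v; ring).
    rewrite sin_plus, sin_minus. ring.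
Qed.

Lemma Rsum_S f N : Rsum f (S N) = Rsum f N + f N.
Proof. reflexivity. Qed.

Lemma Rsum_derive (f f' : nat -> R -> R) N t : (forall n, is_derive (f n) t (f' n t)) ->
  is_derive (fun x => Rsum (fun n => f n x) N) t (Rsum (fun n => f' n t) N).
Proof.
  intros H. induction N.
  - exact (is_derive_const (V := R_NormedModule) 0 t).
  - exact (is_derive_plus (V := R_NormedModule) _ _ _ _ _ IHN (H N)).
Qed.

(** The second derivative of x^2 - x minus a partial sum is twice the Dirichlet kernel. Away from
    the integers one integration by parts gains a factor 1/N, so the first derivative [g1 N] tends
    to 0 uniformly and the limit function is constant. *)
Lemma saw_quadratic_interior x y : 0 < x < 1 -> 0 < y < 1 -> x * x - x - saw x = y * y - y - saw y.
Proof.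
  intros Hx Hy.
  assert (Ppi := PI_RGT_0).
  (* Both points and the centre 1/2 lie in [d, 1 - d], where sin(pi t) is at least sin(pi d). *)
  set (d := Rmin (Rmin x (1 - x)) (Rmin (Rmin y (1 - y)) (1 / 2))).
  assert (D1 := Rmin_l (Rmin x (1 - x)) (Rmin (Rmin y (1 - y)) (1 / 2))).
  assert (D2 := Rmin_r (Rmin x (1 - x)) (Rmin (Rmin y (1 - y)) (1 / 2))).
  assert (D3 := Rmin_l x (1 - x)). assert (D4 := Rmin_r x (1 - x)).
  assert (D5 := Rmin_l (Rmin y (1 - y)) (1 / 2)). assert (D6 := Rmin_r (Rmin y (1 - y)) (1 / 2)).
  assert (D7 := Rmin_l y (1 - y)). assert (D8 := Rmin_r y (1 - y)).
  assert (Hd : 0 < d) by (unfold d; repeat apply Rmin_pos; lra).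
  fold d in D1, D2.
  assert (Hs : 0 < sin (PI * d)) by (apply sin_gt_0; nra).
  assert (Hsin : forall t, d <= t <= 1 - d -> sin (PI * d) <= sin (PI * t)).
  { intros t Ht. destruct (Rle_lt_dec t (1 / 2)).
    - apply sin_incr_1; nra.
    - rewrite <- (sin_PI_x (PI * t)). apply sin_incr_1; nra. }
  set (q := sin (PI * d)) in *.
  set (g1 := fun N t => 2 * t - 1 + Rsum (fun n => 2 * sin (2 * PI * INR (S n) * t) / (PI * INR (S n))) N).
  assert (Hg : forall N t, is_derive (fun t => t * t - t - Rsum (fun n => saw_term n t) N) t (g1 N t)).
  { intros N t. unfold g1.
    replace (2 * t - 1 + Rsum (fun n => 2 * sin (2 * PI * INR (S n) * t) / (PI * INR (S n))) N)
      with (minus (2 * t - 1) (Rsum (fun n => - (2 * sin (2 * PI * INR (S n) * t) / (PI * INR (S n)))) N)).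
    2: { rewrite (Rsum_ext _ (fun n => -1 * (2 * sin (2 * PI * INR (S n) * t) / (PI * INR (S n))))) by (intros; ring).
         rewrite Rsum_scal. unfold minus, plus, opp; simpl. ring. }
    apply (is_derive_minus (V := R_NormedModule)); [auto_derive; auto; ring|].
    apply (Rsum_derive saw_term (fun n t => - (2 * sin (2 * PI * INR (S n) * t) / (PI * INR (S n))))).
    intros n. unfold saw_term. assert (P : 0 < INR (S n)) by (apply lt_0_INR; lia).
    set (r := INR (S n)) in *. auto_derive; auto. field. split; lra. }
  assert (Hg1 : forall N t, is_derive (g1 N) t (2 + 4 * Rsum (fun n => cos (2 * PI * INR (S n) * t)) N)).
  { intros N t. unfold g1. rewrite <- Rsum_scal.
    apply (is_derive_plus (V := R_NormedModule)); [auto_derive; auto; ring|].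
    apply (Rsum_derive (fun n t => 2 * sin (2 * PI * INR (S n) * t) / (PI * INR (S n))) (fun n t => 4 * cos (2 * PI * INR (S n) * t))).
    intros n. assert (P : 0 < INR (S n)) by (apply lt_0_INR; lia).
    set (r := INR (S n)) in *. auto_derive; auto. field. split; lra. }
  (* The boundary term of the integration by parts: [F N] has the Dirichlet kernel as derivative up
     to a term of order 1/N. *)
  set (F := fun N t => - cos ((2 * INR N + 1) * (PI * t)) / ((2 * INR N + 1) * PI * sin (PI * t))).
  assert (PN : forall N, 0 < 2 * INR N + 1) by (intros N; assert (Z := pos_INR N); lra).
  assert (HF : forall N t, d <= t <= 1 - d -> is_derive (fun t => g1 N t - 2 * F N t) t
     (- (2 * cos ((2 * INR N + 1) * (PI * t)) * cos (PI * t) / ((2 * INR N + 1) * (sin (PI * t) * sin (PI * t)))))).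
  { intros N t Ht. specialize (Hsin t Ht). specialize (PN N).
    match goal with |- is_derive _ _ ?l => replace l with (minus (2 + 4 * Rsum (fun n => cos (2 * PI * INR (S n) * t)) N)
       (2 * (1 + 2 * Rsum (fun n => cos (2 * PI * INR (S n) * t)) N) + 2 * cos ((2 * INR N + 1) * (PI * t)) * cos (PI * t) / ((2 * INR N + 1) * (sin (PI * t) * sin (PI * t)))))
       by (unfold minus, plus, opp; simpl; ring) end.
    apply (is_derive_minus (V := R_NormedModule)); [apply Hg1|].
    assert (E := dirichlet_kernel N t).
    replace (1 + 2 * Rsum (fun n => cos (2 * PI * INR (S n) * t)) N) with (sin ((2 * INR N + 1) * (PI * t)) / sin (PI * t)).
    2: { rewrite <- E. field. lra. }
    unfold F. auto_derive.
    - apply Rmult_integral_contrapositive_currified; [apply Rmult_integral_contrapositive_currified|]; apply Rgt_not_eq; [lra|lra|]. unfold Rgt. eapply Rlt_le_trans; [exact Hs|exact Hsin].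
    - field. lra. }
  assert (Hb : forall N t, d <= t <= 1 - d -> Rabs (g1 N t) <= (2 / (q * q) + 2 / q) / (2 * INR N + 1)).
  { intros N t Ht. assert (P := PN N).
    assert (Hq2 : 0 < q * q) by (apply Rmult_lt_0_compat; auto).
    assert (A : Rabs ((g1 N t - 2 * F N t) - (g1 N (1/2) - 2 * F N (1/2))) <= 2 / (q * q) / (2 * INR N + 1) * Rabs (t - 1/2)).
    { apply (mvt_bound (fun t => g1 N t - 2 * F N t) (fun t => - (2 * cos ((2 * INR N + 1) * (PI * t)) * cos (PI * t) / ((2 * INR N + 1) * (sin (PI * t) * sin (PI * t)))))).
      intros s Hs'.
      assert (Hs2 : d <= s <= 1 - d).
      { destruct Hs' as [A B]. split.
        - eapply Rle_trans; [|apply A]. apply Rmin_glb; lra.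
        - eapply Rle_trans; [apply B|]. apply Rmax_lub; lra. }
      split; [apply HF; auto|]. assert (S1 := Hsin s Hs2).
      rewrite Rabs_Ropp.
      assert (Den : 0 < (2 * INR N + 1) * (sin (PI * s) * sin (PI * s))) by (repeat apply Rmult_lt_0_compat; lra).
      unfold Rdiv at 1. rewrite Rabs_mult, (Rabs_pos_eq (/ _)) by (left; apply Rinv_0_lt_compat; auto).
      replace (2 / (q * q) / (2 * INR N + 1)) with (2 * / ((2 * INR N + 1) * (q * q))) by (field; lra).
      apply Rmult_le_compat.
      - apply Rabs_pos.
      - left; apply Rinv_0_lt_compat; auto.
      - assert (C1 := COS_bound ((2 * INR N + 1) * (PI * s))). assert (C2 := COS_bound (PI * s)).
        apply Rabs_le. nra.
      - apply Rinv_le_contravar; [apply Rmult_lt_0_compat; lra|].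
        apply Rmult_le_compat_l; [lra|]. apply Rmult_le_compat; lra. }
    (* At the centre of symmetry both [g1 N] and [F N] vanish, which fixes the constant of
       integration. *)
    assert (Z1 : g1 N (1 / 2) = 0).
    { unfold g1. replace (2 * (1 / 2) - 1) with 0 by field. rewrite Rplus_0_l.
      clear. induction N; [reflexivity|]. rewrite Rsum_S, IHN.
      replace (2 * PI * INR (S N) * (1 / 2)) with (IZR (Z.of_nat (S N)) * PI)
        by (rewrite <- INR_IZR_INZ; field).
      rewrite (sin_eq_0_1 (IZR (Z.of_nat (S N)) * PI)) by (exists (Z.of_nat (S N)); auto).
      unfold Rdiv. ring. }
    assert (Z2 : F N (1 / 2) = 0).
    { unfold F. replace (cos ((2 * INR N + 1) * (PI * (1 / 2)))) with 0.
      - unfold Rdiv. ring.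
      - replace ((2 * INR N + 1) * (PI * (1 / 2))) with (PI / 2 + 1 * (INR N * PI)) by field.
        symmetry. rewrite Rmult_1_l. rewrite cos_plus, cos_PI2.
        rewrite (sin_eq_0_1 (INR N * PI)); [ring|]. exists (Z.of_nat N). rewrite <- INR_IZR_INZ. auto. }
    rewrite Z1, Z2 in A.
    assert (B : Rabs (2 * F N t) <= 2 / q / (2 * INR N + 1)).
    { unfold F. assert (S1 := Hsin t Ht).
      assert (Den : 0 < (2 * INR N + 1) * PI * sin (PI * t)) by (apply Rmult_lt_0_compat; [apply Rmult_lt_0_compat|]; lra).
      unfold Rdiv. rewrite !Rabs_mult, (Rabs_pos_eq (/ _)) by (left; apply Rinv_0_lt_compat; auto).
      rewrite (Rabs_pos_eq 2), Rabs_Ropp by lra.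
      replace (2 * / q * / (2 * INR N + 1)) with (2 * (1 * / ((2 * INR N + 1) * 1 * q))) by (field; lra).
      apply Rmult_le_compat_l; [lra|]. apply Rmult_le_compat.
      - apply Rabs_pos.
      - left; apply Rinv_0_lt_compat; auto.
      - assert (C1 := COS_bound ((2 * INR N + 1) * (PI * t))). apply Rabs_le; lra.
      - apply Rinv_le_contravar; [apply Rmult_lt_0_compat; lra|].
        assert (X := PI2_3_2). apply Rmult_le_compat; try lra.
        apply Rmult_le_compat_l; lra. }
    assert (T : Rabs (t - 1 / 2) <= 1) by (apply Rabs_le; lra).
    assert (Q : 0 <= 2 / (q * q) / (2 * INR N + 1)) by (apply Rle_div_r; [lra|]; rewrite Rmult_0_l; apply Rle_div_r; lra).
    assert (A' : 2 / (q * q) / (2 * INR N + 1) * Rabs (t - 1 / 2) <= 2 / (q * q) / (2 * INR N + 1) * 1) by (apply Rmult_le_compat_l; auto).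
    apply Rabs_le_between in B.
    assert (A2 : Rabs (g1 N t - 2 * F N t - (0 - 2 * 0)) <= 2 / (q * q) / (2 * INR N + 1)) by lra.
    apply Rabs_le_between in A2. apply Rabs_le.
    replace ((2 / (q * q) + 2 / q) / (2 * INR N + 1)) with (2 / (q * q) / (2 * INR N + 1) + 2 / q / (2 * INR N + 1)) by (field; lra).
    lra. }
  set (K := 2 / (q * q) + 2 / q) in *.
  apply Rminus_diag_uniq.
  assert (Fin : forall eps, 0 < eps -> Rabs (x * x - x - saw x - (y * y - y - saw y)) <= eps).
  { intros eps He.
    destruct (series_tail_small saw_maj ex_saw_maj saw_maj_nonneg (eps / 4) ltac:(lra)) as [N1 H1].
    destruct (nfloor_ex (Rabs K / (eps / 4))) as [N2 [_ H2]].
    { apply Rle_div_r; [lra|]. rewrite Rmult_0_l. apply Rabs_pos. }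
    set (N := (N1 + S N2)%nat). specialize (H1 N ltac:(unfold N; lia)).
    assert (HNN : Rabs K / (eps / 4) < INR N).
    { eapply Rlt_le_trans; [apply H2|]. rewrite <- S_INR. apply le_INR. unfold N; lia. }
    assert (P := PN N).
    apply Rlt_div_l in HNN; [|lra].
    assert (A := mvt_bound (fun t => t * t - t - Rsum (fun n => saw_term n t) N) (g1 N) y x (eps / 4)).
    assert (T : Rabs (x - y) <= 1) by (apply Rabs_le; lra).
    assert (A' : Rabs (x * x - x - Rsum (fun n => saw_term n x) N - (y * y - y - Rsum (fun n => saw_term n y) N)) <= eps / 4 * Rabs (x - y)).
    { apply A. intros t Ht. split; [apply Hg|].
      assert (Hs2 : d <= t <= 1 - d).
      { destruct Ht as [A1 B1]. split.
        - eapply Rle_trans; [|apply A1]. apply Rmin_glb; lra.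
        - eapply Rle_trans; [apply B1|]. apply Rmax_lub; lra. }
      eapply Rle_trans; [apply Hb; auto|]. apply Rle_div_l; [lra|].
      assert (Z := Rle_abs K). nra. }
    assert (A2 : eps / 4 * Rabs (x - y) <= eps / 4 * 1) by (apply Rmult_le_compat_l; lra).
    assert (Bx := saw_tail x N). assert (By := saw_tail y N).
    assert (A3 : Rabs (x * x - x - Rsum (fun n => saw_term n x) N - (y * y - y - Rsum (fun n => saw_term n y) N)) <= eps / 4) by lra.
    apply Rabs_le_between in A3. apply Rabs_le_between in Bx. apply Rabs_le_between in By. apply Rabs_le. lra. }
  destruct (Req_dec (x * x - x - saw x - (y * y - y - saw y)) 0) as [E|E]; auto.
  apply Rabs_pos_lt in E. specialize (Fin _ (Rlt_gt _ _ (Rmult_lt_0_compat _ (1/2) E ltac:(lra)))). lra.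
Qed.

(** The constant left open by [saw_quadratic_interior] is found by letting the second point tend to
    0, where [saw] is continuous with value 0; the end point 1 follows by periodicity. *)
Lemma saw_unit x : 0 <= x <= 1 -> saw x = x * x - x.
Proof.
  assert (Hin : forall x, 0 < x < 1 -> saw x = x * x - x).
  { intros y Hy. apply Rminus_diag_uniq.
    assert (C : continuous (fun t => t * t - t - saw t) 0).
    { apply (continuous_minus (V := R_NormedModule)); [|apply saw_continuous].
      apply (ex_derive_continuous (V := R_NormedModule)). auto_derive; auto. }
    rewrite continuous_R_iff in C. rewrite saw_0 in C.
    destruct (Req_dec (saw y - (y * y - y)) 0) as [E|E]; auto. exfalso.
    apply Rabs_pos_lt in E.
    destruct (C _ E) as [d [Hd Ht]].
    set (t := Rmin (d / 2) (1 / 2)). assert (T1 := Rmin_l (d / 2) (1 / 2)). assert (T2 := Rmin_r (d / 2) (1 / 2)).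
    assert (T0 : 0 < t) by (unfold t; apply Rmin_pos; lra).
    specialize (Ht t ltac:(rewrite Rminus_0_r, Rabs_pos_eq; unfold t in *; lra)).
    rewrite (saw_quadratic_interior t y) in Ht by (unfold t in *; lra).
    replace (y * y - y - saw y - (0 * 0 - 0 - 0)) with (- (saw y - (y * y - y))) in Ht by ring.
    rewrite Rabs_Ropp in Ht. lra. }
  intros [H0 H1]. destruct (Req_dec x 0) as [->|N0]; [rewrite saw_0; ring|].
  destruct (Req_dec x 1) as [->|N1]; [|apply Hin; lra].
  assert (E : saw 1 = saw 0).
  { unfold saw. apply Series_ext. intros n. unfold saw_term. do 2 f_equal.
    replace (2 * PI * INR (S n) * 1) with (0 + 2 * INR (S n) * PI) by ring. rewrite cos_period. f_equal. ring. }
  rewrite E, saw_0. ring.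
Qed.

Lemma saw_periodic k x : saw (x + INR k) = saw x.
Proof.
  unfold saw. apply Series_ext. intros n. unfold saw_term. do 2 f_equal.
  replace (2 * PI * INR (S n) * (x + INR k)) with (2 * PI * INR (S n) * x + 2 * INR (S n * k) * PI).
  - apply cos_period.
  - rewrite mult_INR. ring.
Qed.

Lemma saw_shift k x : INR k <= x <= INR k + 1 -> saw x = (x - INR k) * (x - INR k) - (x - INR k).
Proof.
  intros H. rewrite <- (saw_unit (x - INR k)) by lra. rewrite <- (saw_periodic k (x - INR k)). f_equal. ring.
Qed.

(** * Continuation of zeta *)


Lemma real_curve_cont (f : R -> R) t : continuous f t -> curve_cont (fun u => RtoC (f u)) t.
Proof. intros H. apply continuous_pair_iff. split; simpl; auto. apply continuous_const. Qed.

Lemma saw_quarter x : 0 <= x -> Rabs (saw x) <= 1 / 4.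
Proof.
  intros Hx. destruct (nfloor_ex x Hx) as [k [H1 H2]].
  rewrite (saw_shift k) by lra. set (u := x - INR k).
  assert (Hu : 0 <= u <= 1) by (unfold u; split; lra). clearbody u. assert (Hq : 0 <= (u - 1 / 2) * (u - 1 / 2)) by apply Rle_0_sqr. apply Rabs_le. split; nra.
Qed.

(** With x = e^t the integral of f(x) x^(-s-2) over x > 1 becomes the Laplace transform of f(e^t) at
    s + 1. All Mellin integrals below are written in this way. *)
Definition sawexp (t : R) : C := RtoC (saw (exp t)).

Lemma sawexp_ebound : ebound sawexp (1 / 4) 0.
Proof.
  split.
  - intros t. apply real_curve_cont. apply (continuous_comp exp saw); [|apply saw_continuous].
    apply (ex_derive_continuous (V := R_NormedModule)). auto_derive; auto.
  - intros t _. unfold sawexp. rewrite Rmult_0_l, exp_0, Rmult_1_r, Cmod_R. apply saw_quarter.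
    left. apply exp_pos.
Qed.

(* Euler-Maclaurin: [zeta s = 1/(s-1) + 1/2 - s(s+1)/2 * int_1^oo ({x}^2-{x}) x^(-s-2) dx] for [Re s > -1], times [s - 1]. *)
Definition zetaW (s : C) : C :=
  (1 + (s - 1) * (/ RtoC 2 - s * (s + 1) / RtoC 2 * Lap sawexp (s + 1)))%C.

Lemma zetaW_hol s : -1 < fst s -> Chol zetaW s.
Proof.
  intros H. unfold zetaW, Cdiv.
  apply Chol_plus; [apply Chol_const|]. apply Chol_mult.
  - apply Chol_minus; [apply Chol_id|apply Chol_const].
  - apply Chol_minus; [apply Chol_const|]. apply Chol_mult.
    + apply Chol_mult; [|apply Chol_const]. apply Chol_mult; [apply Chol_id|].
      apply Chol_plus; [apply Chol_id|apply Chol_const].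
    + apply (Chol_comp (Lap sawexp) (fun s => s + 1)%C).
      * apply (lap_holomorphic _ (1/4) 0); [apply sawexp_ebound|simpl; lra].
      * apply Chol_plus; [apply Chol_id|apply Chol_const].
Qed.

Lemma zetaW_1 : zetaW (RtoC 1) = RtoC 1.
Proof. unfold zetaW. ring. Qed.

(** Keeps the bottom edge of the contour free of zeros. A zero would give (s+1)/2 = s(s+1)(s-1)/2
    times the Laplace integral, which is at most 1/(4(s+1)) because |saw| <= 1/4; hence (s+1)/2 <=
    |s(s-1)|/8 <= 1/8, although (s+1)/2 >= 1/4. *)
Lemma zetaW_real s : - (1 / 2) <= s <= 1 -> zetaW (RtoC s) <> RtoC 0.
Proof.
  intros Hs. destruct (Req_dec s 1) as [->|N].
  { rewrite zetaW_1. intros E; injection E; lra. }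
  assert (HL := Lap_bound sawexp (1 / 4) 0 (RtoC s + 1)%C sawexp_ebound ltac:(simpl; lra)).
  simpl in HL. set (L := Lap sawexp (RtoC s + 1)%C) in *.
  intros E. unfold zetaW in E. fold L in E.
  assert (E2 : ((RtoC s + 1) / RtoC 2)%C = (RtoC (s * (s + 1) * (s - 1) / 2) * L)%C).
  { replace (RtoC (s * (s + 1) * (s - 1) / 2)) with (RtoC s * (RtoC s + 1) * (RtoC s - 1) / RtoC 2)%C.
    2: { apply C_ext; simpl; field. }
    transitivity ((1 + (RtoC s - 1) * (/ RtoC 2 - RtoC s * (RtoC s + 1) / RtoC 2 * L)) + RtoC s * (RtoC s + 1) * (RtoC s - 1) / RtoC 2 * L)%C.
    - field.
    - rewrite E. ring. }
  apply (f_equal Cmod) in E2. rewrite Cmod_mult in E2.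
  replace ((RtoC s + 1) / RtoC 2)%C with (RtoC ((s + 1) / 2)) in E2 by (apply C_ext; simpl; field).
  rewrite !Cmod_R in E2. rewrite (Rabs_pos_eq ((s + 1) / 2)) in E2 by lra.
  assert (B : Rabs (s * (s + 1) * (s - 1) / 2) * Cmod L <= Rabs (s * (s + 1) * (s - 1) / 2) * (1 / 4 / (s + 1 - 0))).
  { apply Rmult_le_compat_l; [apply Rabs_pos|]. exact HL. }
  replace (s * (s + 1) * (s - 1) / 2) with (s * (s - 1) * ((s + 1) / 2)) in B by field.
  rewrite Rabs_mult, (Rabs_pos_eq ((s + 1) / 2)) in B by lra.
  replace (Rabs (s * (s - 1)) * ((s + 1) / 2) * (1 / 4 / (s + 1 - 0))) with (Rabs (s * (s - 1)) / 8) in B by (field; lra).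
  assert (C1 : Rabs (s * (s - 1)) <= 1) by (apply Rabs_le; nra).
  replace (s * (s - 1) * ((s + 1) / 2)) with (s * (s + 1) * (s - 1) / 2) in B by field.
  replace (Rabs (s * (s - 1)) * ((s + 1) / 2)) with (Rabs (s * (s + 1) * (s - 1) / 2)) in B.
  2: { rewrite <- (Rabs_pos_eq ((s + 1) / 2)) by lra. rewrite <- Rabs_mult. f_equal. field. }
  lra.
Qed.

(** Between x = k and x = k + 1 the function {x}^2 - {x} is a quadratic polynomial, so in t = log x
    the integrand is a sum of three exponentials. The right side is the error of the trapezoidal
    rule for x^(-s). *)
Lemma saw_block (s : C) k : (1 <= k)%nat -> s <> RtoC 0 -> s <> RtoC 1 -> (s + 1)%C <> RtoC 0 ->
  (- (s * (s + 1) / RtoC 2) * CI (lapf sawexp (s + 1)) (ln (INR k)) (ln (INR (S k))))%C =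
  ((cpow k (- s) + cpow (S k) (- s)) / RtoC 2
   - (cpow (S k) (1 - s) - cpow k (1 - s)) / (1 - s))%C.
Proof.
  intros Hk N0 N1 N2.
  assert (N1' : (1 - s)%C <> RtoC 0) by (apply Cminus_neq; auto).
  assert (N0' : (- s)%C <> RtoC 0) by (intros E; apply N0; replace s with (- - s)%C by ring; rewrite E; ring).
  assert (N2' : (- (s + 1))%C <> RtoC 0) by (intros E; apply N2; replace (s + 1)%C with (- - (s + 1))%C by ring; rewrite E; ring).
  set (K := INR k). assert (HK : 0 < K) by (apply lt_0_INR; lia).
  assert (HSK : INR (S k) = K + 1) by (unfold K; apply S_INR).
  set (a := ln K). set (b := ln (INR (S k))).
  assert (Hab : a <= b) by (apply ln_le; [auto|rewrite HSK; lra]).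
  assert (Ea : exp a = K) by (apply exp_ln; auto).
  assert (Eb : exp b = K + 1) by (unfold b; rewrite HSK; apply exp_ln; lra).
  assert (I1 := is_CI_Cexp _ a b N1').
  assert (I2 := is_CI_scal (- RtoC (2 * K + 1))%C _ _ _ _ (is_CI_Cexp _ a b N0')).
  assert (I3 := is_CI_scal (RtoC (K * K + K)) _ _ _ _ (is_CI_Cexp _ a b N2')).
  assert (I := is_CI_plus _ _ _ _ _ _ (is_CI_plus _ _ _ _ _ _ I1 I2) I3).
  assert (PW : forall t, a < t < b ->
    (Cexp ((1 - s) * RtoC t) + - RtoC (2 * K + 1) * Cexp (- s * RtoC t) + RtoC (K * K + K) * Cexp (- (s + 1) * RtoC t))%C
    = lapf sawexp (s + 1) t).
  { intros t Ht. unfold lapf, sawexp.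
    rewrite (saw_shift k) by (fold K; rewrite <- Eb; rewrite <- Ea at 1; split; apply exp_mono; lra).
    fold K. set (u := exp t).
    replace ((1 - s) * RtoC t)%C with (- ((s + 1) * RtoC t) + RtoC t + RtoC t)%C by ring.
    replace (- s * RtoC t)%C with (- ((s + 1) * RtoC t) + RtoC t)%C by ring.
    replace (- (s + 1) * RtoC t)%C with (- ((s + 1) * RtoC t))%C by ring.
    rewrite !Cexp_add, !Cexp_R. fold u.
    replace (RtoC ((u - K) * (u - K) - (u - K))) with (RtoC u * RtoC u - RtoC (2 * K + 1) * RtoC u + RtoC (K * K + K))%C
      by (apply C_ext; simpl; ring).
    ring. }
  assert (EI := fun H => CI_unique _ _ _ _ (is_CI_ext _ (lapf sawexp (s + 1)%C) a b _ H I)).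
  rewrite EI by (rewrite Rmin_left, Rmax_right by auto; exact PW).
  unfold cpow. fold K a b.
  assert (X : forall y Y, exp y = Y -> Cexp ((1 - s) * RtoC y) = (Cexp (- (s + 1) * RtoC y) * RtoC Y * RtoC Y)%C /\
       Cexp (- s * RtoC y) = (Cexp (- (s + 1) * RtoC y) * RtoC Y)%C).
  { intros y Y <-. rewrite <- Cexp_R, <- !Cexp_add. split; f_equal; ring. }
  destruct (X a K Ea) as [-> ->]. destruct (X b (K + 1) Eb) as [-> ->].
  set (u := Cexp (- (s + 1) * RtoC a)). set (v := Cexp (- (s + 1) * RtoC b)).
  replace (RtoC (2 * K + 1)) with (RtoC 2 * RtoC K + 1)%C by (apply C_ext; simpl; ring).
  replace (RtoC (K * K + K)) with (RtoC K * RtoC K + RtoC K)%C by (apply C_ext; simpl; ring).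
  replace (RtoC (K + 1)) with (RtoC K + 1)%C by (apply C_ext; simpl; ring).
  field. repeat split; auto.
Qed.

Lemma cpow_1 w : cpow 1 w = RtoC 1.
Proof. unfold cpow. simpl INR. rewrite ln_1. rewrite <- Cexp_0. f_equal. ring. Qed.

Lemma zeta_partial (s : C) N : s <> RtoC 0 -> s <> RtoC 1 -> (s + 1)%C <> RtoC 0 ->
  Csum (fun k => cpow (S k) (- s)) N =
  (- (s * (s + 1) / RtoC 2) * CI (lapf sawexp (s + 1)) 0 (ln (INR (S N))) + / RtoC 2
   - cpow (S N) (- s) / RtoC 2 + (cpow (S N) (1 - s) - 1) / (1 - s))%C.
Proof.
  intros N0 N1 N2. assert (N1' : (1 - s)%C <> RtoC 0) by (apply Cminus_neq; auto).
  assert (Hc : forall t, curve_cont (lapf sawexp (s + 1)) t) by (intros; apply lapf_cont, sawexp_ebound).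
  induction N.
  - change (INR 1) with 1. rewrite ln_1, CI_point, !cpow_1. simpl. field. auto.
  - change (Csum (fun k => cpow (S k) (- s)) (S N)) with (Csum (fun k => cpow (S k) (- s)) N + cpow (S N) (- s))%C.
    rewrite IHN. rewrite <- (CI_chasles _ 0 (ln (INR (S N))) (ln (INR (S (S N))))) by (apply ex_CI_all; auto).
    assert (B := saw_block s (S N) ltac:(lia) N0 N1 N2).
    set (X := CI (lapf sawexp (s + 1)) 0 (ln (INR (S N)))) in *.
    set (Y := CI (lapf sawexp (s + 1)) (ln (INR (S N))) (ln (INR (S (S N))))) in *.
    replace (- (s * (s + 1) / RtoC 2) * (X + Y))%C with (- (s * (s + 1) / RtoC 2) * X + - (s * (s + 1) / RtoC 2) * Y)%C by ring.
    rewrite B. field. auto.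
Qed.

Lemma ln_INR_large X : exists N0, forall N, (N0 <= N)%nat -> X <= ln (INR (S N)) /\ 0 <= ln (INR (S N)).
Proof.
  destruct (nfloor_ex (exp X)) as [N0 [_ H]]; [left; apply exp_pos|].
  exists N0. intros N HN. split.
  - rewrite <- (ln_exp X). apply ln_le; [apply exp_pos|]. apply le_INR in HN. rewrite S_INR. lra.
  - rewrite <- ln_1. apply ln_le; [lra|]. rewrite S_INR. assert (Z := pos_INR N). lra.
Qed.

Lemma Cmod_cpow k w : Cmod (cpow k w) = exp (fst w * ln (INR k)).
Proof. unfold cpow. rewrite Cmod_Cexp. simpl. f_equal. ring. Qed.

Lemma zeta_continuation s : 1 < fst s -> Cser (fun k => cpow (S k) (- s)) (zetaW s / (s - 1))%C.
Proof.
  intros Hs.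
  assert (N0 : s <> RtoC 0) by (intros ->; simpl in Hs; lra).
  assert (N1 : s <> RtoC 1) by (intros ->; simpl in Hs; lra).
  assert (N2 : (s + 1)%C <> RtoC 0) by (intros E; apply (f_equal fst) in E; simpl in E; lra).
  assert (N1' : (1 - s)%C <> RtoC 0) by (apply Cminus_neq; auto).
  assert (N1'' : (s - 1)%C <> RtoC 0) by (apply Cminus_neq; auto).
  intros eps He.
  assert (HL := Lap_spec _ _ _ (s + 1)%C sawexp_ebound ltac:(simpl; lra)).
  set (A := Cmod (s * (s + 1) / RtoC 2)). assert (PA : 0 <= A) by apply Cmod_ge_0.
  destruct (HL (eps / 3 / (A + 1))) as [X1 H1]; [apply Rdiv_lt_0_compat; lra|].
  destruct (exp_decay 1 (fst s) ltac:(lra) (eps / 3) ltac:(lra)) as [X2 [_ H2]].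
  destruct (exp_decay (/ Cmod (1 - s)) (fst s - 1) ltac:(lra) (eps / 3) ltac:(lra)) as [X3 [_ H3]].
  destruct (ln_INR_large (Rmax X1 (Rmax X2 X3))) as [M HM].
  assert (M0 := Rmax_l X1 (Rmax X2 X3)). assert (M1 := Rmax_r X1 (Rmax X2 X3)).
  assert (M2 := Rmax_l X2 X3). assert (M3 := Rmax_r X2 X3).
  exists M. intros N HN. destruct (HM N HN) as [G1 G2].
  rewrite zeta_partial by auto. unfold zetaW.
  set (X := ln (INR (S N))) in *. set (I := CI (lapf sawexp (s + 1)) 0 X) in *. set (L := Lap sawexp (s + 1)) in *.
  replace (_ - _)%C with (- (s * (s + 1) / RtoC 2 * (I - L)) + - (cpow (S N) (- s) / RtoC 2) + / (1 - s) * cpow (S N) (1 - s))%C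
    by (field; auto).
  eapply Rle_trans; [apply Cmod_triangle|].
  eapply Rle_trans; [apply Rplus_le_compat_r, Cmod_triangle|].
  rewrite !Cmod_opp. unfold Cdiv at 2. rewrite (Cmod_mult (s * (s + 1) / RtoC 2)), (Cmod_mult (cpow (S N) (- s))), (Cmod_mult (/ (1 - s))).
  fold A. rewrite (Cmod_inv (1 - s)) by auto.
  rewrite !Cmod_cpow. fold X.
  assert (B1 : A * Cmod (I - L) <= (A + 1) * (eps / 3 / (A + 1))).
  { apply Rmult_le_compat; auto; try apply Cmod_ge_0; try lra. apply H1; lra. }
  replace ((A + 1) * (eps / 3 / (A + 1))) with (eps / 3) in B1 by (field; lra).
  assert (B2 := H2 X ltac:(lra)). assert (B3 := H3 X ltac:(lra)).
  replace (fst (- s)%C * X) with (- (fst s * X)) by (simpl; ring).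
  replace (fst (1 - s)%C * X) with (- ((fst s - 1) * X)) by (simpl; ring).
  assert (C2 : Cmod (/ RtoC 2) <= 1).
  { rewrite Cmod_inv by (intros E; injection E; lra). rewrite Cmod_R, Rabs_pos_eq by lra. lra. }
  assert (B4 : exp (- (fst s * X)) * Cmod (/ RtoC 2) <= exp (- (fst s * X)) * 1).
  { apply Rmult_le_compat_l; auto. left; apply exp_pos. }
  lra.
Qed.

(** The assumptions of the theorem on [zeta], in the vocabulary of [Chol] and [Cser]; [zeta 1] stays
    unconstrained. *)
Definition is_zeta (zeta : C -> C) : Prop :=
  (forall s, s <> RtoC 1 -> Chol zeta s) /\
  (forall s, 1 < fst s -> Cser (fun k => cpow (S k) (- s)) (zeta s)).

(** Recovers the real points that [identity_horizontal] leaves out. *)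
Lemma zero_by_continuity f x : Ccont f (x, 0) -> (forall b, b <> 0 -> f (x, b) = RtoC 0) -> f (x, 0) = RtoC 0.
Proof.
  intros Hc H. apply Cmod_small_0. intros eps He. rewrite Ccont_iff in Hc.
  destruct (Hc eps He) as [d [Hd Hw]].
  assert (K := Hw (x, d / 2)). rewrite H in K by lra.
  replace (0 - f (x, 0%R))%C with (- f (x, 0%R))%C in K by ring. rewrite Cmod_opp in K. left. apply K.
  replace ((x, (d / 2)%R) - (x, 0%R))%C with (Ci * RtoC (d / 2))%C by (apply C_ext; simpl; ring).
  rewrite Cmod_mult, Cmod_Ci, Cmod_R, Rabs_pos_eq; lra.
Qed.

Lemma half_plane_zero_near f A c : A < fst c -> (forall s, A < fst s -> f s = RtoC 0) -> zero_near f c.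
Proof.
  intros Hc H. exists (fst c - A). split; [lra|]. intros w Hw. apply H.
  assert (Z := fst_le_Cmod (w - c)). simpl in Z.
  assert (Y := Rle_abs (- (fst w + - fst c))). rewrite Rabs_Ropp in Y. lra.
Qed.

Lemma zeta_W zeta s : is_zeta zeta -> -1 < fst s -> s <> RtoC 1 -> ((s - 1) * zeta s)%C = zetaW s.
Proof.
  intros [Hh Hd] Hs N1.
  set (D := fun s => ((s - 1) * zeta s - zetaW s)%C).
  assert (HD : forall s, -1 < fst s -> s <> RtoC 1 -> Chol D s).
  { intros z Hz Nz. apply Chol_minus; [|apply zetaW_hol; auto].
    apply Chol_mult; [|apply Hh; auto]. apply Chol_minus; [apply Chol_id|apply Chol_const]. }
  assert (Z0 : forall z, 1 < fst z -> D z = RtoC 0).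
  { intros z Hz. unfold D.
    assert (Nz : (z - 1)%C <> RtoC 0) by (apply Cminus_neq; intros ->; simpl in Hz; lra).
    rewrite (Cser_unique _ _ _ (Hd z Hz) (zeta_continuation z Hz)). field; auto. }
  assert (Zb : forall b, b <> 0 -> D (fst s, b) = RtoC 0).
  { intros b Hb. apply (identity_horizontal D (-1) b Hb) with (x0 := 2); auto; try lra.
    - intros z Hz Nz. apply HD; auto. intros ->. simpl in Nz. lra.
    - apply (half_plane_zero_near D 1); auto. simpl; lra. }
  assert (E : D s = RtoC 0).
  { destruct s as [x y]. destruct (Req_dec y 0) as [->|Ny]; [|apply Zb; auto].
    apply zero_by_continuity; auto. apply Chol_cont, HD; auto. }
  unfold D in E. replace ((s - 1) * zeta s)%C with ((s - 1) * zeta s - zetaW s + zetaW s)%C by ring.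
  rewrite E. ring.
Qed.

(** * Polar series and two-sided Laplace transforms *)


Definition Polar (a p : nat -> C) (z : C) : C :=
  epsilon (inhabits (RtoC 0)) (Cser (fun k => a k * / (z - p k))%C).

(** A point with coefficient 0 carries no pole, so [z] may coincide with it. This matters because
    many of the sums c_q(n) can vanish. *)
Definition away (a p : nat -> C) (z : C) (d : R) : Prop :=
  0 < d /\ forall k, a k <> RtoC 0 -> d <= Cmod (z - p k).

Lemma Cinv_bound (x : C) d : 0 < d -> d <= Cmod x -> Cmod (/ x) <= / d.
Proof.
  intros Hd Hx. rewrite Cmod_inv.
  - apply Rinv_le_contravar; auto.
  - intros E. rewrite E, Cmod_0 in Hx. lra.
Qed.

Lemma polar_dominated (a p : nat -> C) z d k : away a p z d -> Cmod (a k * / (z - p k)) <= / d * Cmod (a k).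
Proof.
  intros [Hd H]. rewrite Cmod_mult, Rmult_comm.
  destruct (classic (a k = RtoC 0)) as [E|N].
  - rewrite E, Cmod_0. lra.
  - apply Rmult_le_compat_r; [apply Cmod_ge_0|]. apply Cinv_bound; auto.
Qed.

Lemma polar_spec a p z d : ex_series (fun k => Cmod (a k)) -> away a p z d ->
  Cser (fun k => a k * / (z - p k))%C (Polar a p z).
Proof.
  intros Ha Hz. unfold Polar. apply epsilon_spec.
  destruct (Cser_dominated (fun k => a k * / (z - p k))%C (fun k => / d * Cmod (a k))) as [l [Hl _]].
  - apply (ex_series_scal (V := R_NormedModule)); auto.
  - intros k. apply polar_dominated; auto.
  - eauto.
Qed.

Lemma polar_bound a p z d : ex_series (fun k => Cmod (a k)) -> away a p z d ->
  Cmod (Polar a p z) <= / d * Series (fun k => Cmod (a k)).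
Proof.
  intros Ha Hz. rewrite <- Series_scal_l.
  apply (Cser_bound (fun k => a k * / (z - p k))%C).
  - apply (ex_series_scal (V := R_NormedModule)); auto.
  - intros k. apply polar_dominated; auto.
  - eapply polar_spec; eauto.
Qed.

Lemma away_near a p z w d : away a p z d -> Cmod (w - z) < d / 2 -> away a p w (d / 2).
Proof.
  intros [Hd H] Hw. split; [lra|]. intros k Hk. specialize (H k Hk).
  assert (T := Cmod_tri3 z w (p k)). rewrite (Cmod_sym z w) in T. lra.
Qed.

(** Termwise differentiation, with the exact remainder (w-z)^2 / ((w-p)(z-p)^2) for each term. *)
Lemma polar_hol a p z d : ex_series (fun k => Cmod (a k)) -> away a p z d -> Chol (Polar a p) z.
Proof.
  intros Ha Hz. assert (Hd : 0 < d) by apply Hz.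
  set (q := fun k => (a k * / (z - p k) * / (z - p k))%C).
  assert (Hq : forall k, Cmod (q k) <= / d * / d * Cmod (a k)).
  { intros k. unfold q. rewrite Cmod_mult.
    destruct (classic (a k = RtoC 0)) as [E|N].
    - rewrite E. replace (0 * / (z - p k))%C with (RtoC 0) by ring. rewrite Cmod_0. lra.
    - replace (/ d * / d * Cmod (a k)) with (/ d * Cmod (a k) * / d) by ring.
      apply Rmult_le_compat; try apply Cmod_ge_0.
      + apply polar_dominated; auto.
      + apply Cinv_bound; auto. apply Hz; auto. }
  assert (Eq : ex_series (fun k => / d * / d * Cmod (a k))) by (apply (ex_series_scal (V := R_NormedModule)); auto).
  destruct (Cser_dominated q _ Eq Hq) as [l [Hl _]].
  exists (- l)%C.
  apply (Cder_quadratic _ _ _ (Series (fun k => 2 / d * / d * / d * Cmod (a k))) (d / 2)); [lra|].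
  intros w Hw. assert (Aw := away_near _ _ _ _ _ Hz Hw).
  assert (S1 := polar_spec _ _ _ _ Ha Hz). assert (S2 := polar_spec _ _ _ _ Ha Aw).
  assert (S := Cser_plus _ _ _ _ (Cser_plus _ _ _ _ S2 (Cser_scal (- (1))%C _ _ S1)) (Cser_scal (w - z)%C _ _ Hl)).
  replace (Polar a p w - Polar a p z - - l * (w - z))%C with (Polar a p w + - (1) * Polar a p z + (w - z) * l)%C by ring.
  rewrite Rmult_comm, <- Series_scal_l.
  refine (Cser_bound _ _ _ _ _ S).
  - apply (ex_series_scal (V := R_NormedModule)). apply (ex_series_scal (V := R_NormedModule)). auto.
  - intros k. unfold q.
    destruct (classic (a k = RtoC 0)) as [E|N].
    + rewrite E. replace (_ + _ + _)%C with (RtoC 0) by ring. rewrite !Cmod_0. lra.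
    + destruct Hz as [_ Hz]. destruct Aw as [_ Aw]. specialize (Hz k N). specialize (Aw k N).
      assert (Z1 : (z - p k)%C <> RtoC 0) by (intros E; rewrite E, Cmod_0 in Hz; lra).
      assert (Z2 : (w - p k)%C <> RtoC 0) by (intros E; rewrite E, Cmod_0 in Aw; lra).
      replace (_ + _ + _)%C with ((w - z) * (w - z) * (a k * / (w - p k) * / (z - p k) * / (z - p k)))%C by (field; auto).
      rewrite (Cmod_mult ((w - z) * (w - z))), (Cmod_mult (w - z) (w - z)), !(Cmod_mult _ (/ _)).
      apply Rmult_le_compat_l; [apply Rmult_le_pos; apply Cmod_ge_0|].
      replace (2 / d * / d * / d * Cmod (a k)) with (Cmod (a k) * / (d / 2) * / d * / d) by (field; lra).
      assert (P : 0 < / d) by (apply Rinv_0_lt_compat; auto).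
      assert (G := Cmod_ge_0).
      repeat apply Rmult_le_compat; auto; try (apply Cinv_bound; auto; lra); try lra;
        repeat apply Rmult_le_pos; auto.
Qed.

(** * Two-sided Laplace transforms and the transform of the cosine *)

Lemma CI_shift f a b l : ex_CI f (a + l) (b + l) -> CI (fun t => f (t + l)) a b = CI f (a + l) (b + l).
Proof.
  intros Hf. apply CI_unique. apply CI_correct in Hf.
  assert (Z := is_RInt_comp_lin (V := C_R_NormedModule) f 1 l a b (CI f (a + l) (b + l))).
  rewrite !Rmult_1_l in Z. specialize (Z Hf). eapply is_CI_ext; [|apply Z]. intros t _. simpl.
  rewrite Rmult_1_l. apply C_ext; simpl; unfold scal; simpl; unfold mult; simpl; ring.
Qed.

Lemma CI_reflect f Y : (forall t, curve_cont f t) -> CI (fun t => f (- t)) 0 Y = CI f (- Y) 0.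
Proof.
  intros Hf.
  assert (E1 : ex_CI f 0 (- Y)) by (apply ex_CI_all; auto).
  assert (H := CI_correct _ _ _ E1).
  assert (Z := is_RInt_comp_opp (V := C_R_NormedModule) f 0 Y (CI f 0 (- Y))).
  rewrite Ropp_0 in Z. specialize (Z H).
  rewrite (CI_swap f 0 (- Y)) by auto.
  apply CI_unique.
  assert (Z2 := is_CI_scal (- (1))%C _ _ _ _ Z).
  replace (- CI f 0 (- Y))%C with (- (1) * CI f 0 (- Y))%C by ring.
  eapply is_CI_ext; [|exact Z2]. intros t _. cbv beta.
  apply C_ext; simpl; unfold opp; simpl; ring.
Qed.

(** Shifting by [lam] is a rescaling by e^lam in the Mellin integral. Only the two-sided integral is
    multiplied by a power: either half alone gains or loses the piece between 0 and [lam]. *)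
Lemma bilap_shift (B : R -> C) (w : C) lam l1 l2 m1 m2 : (forall t, curve_cont B t) ->
  is_lap B w l1 -> is_lap (fun t => B (- t)) (- w) l2 ->
  is_lap (fun t => B (t + lam)) w m1 -> is_lap (fun t => B (- t + lam)) (- w) m2 ->
  (m1 + m2)%C = (Cexp (w * RtoC lam) * (l1 + l2))%C.
Proof.
  intros HB H1 H2 H3 H4.
  set (g := lapf B w).
  assert (Hg : forall t, curve_cont g t) by (intros; apply lapf_cont; auto).
  assert (Hgl : forall t, curve_cont (fun u => g (u + lam)) t).
  { intros t. apply (continuous_comp (fun u => u + lam) g); auto.
    apply (continuous_plus (V := R_NormedModule)); [apply continuous_id|apply continuous_const]. }
  set (E := Cexp (w * RtoC lam)).
  (* For finite ranges the identity is exact, with upper limits X + lam and X - lam on the right;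
     the claim follows as X grows. *)
  assert (Fin : forall X, Cplus (CI (lapf (fun t => B (t + lam)) w) 0 X) (CI (lapf (fun t => B (- t + lam)) (- w)) 0 X)
     = Cmult E (Cplus (CI g 0 (X + lam)) (CI (lapf (fun t => B (- t)) (- w)) 0 (X - lam)))).
  { intros X.
    rewrite (CI_ext_all (lapf (fun t => B (t + lam)) w) (fun t => Cmult E (g (t + lam)))).
    2: { intros t. unfold lapf, g, lapf, E.
         replace (Cexp (- (w * RtoC t))) with (Cexp (w * RtoC lam) * Cexp (- (w * RtoC (t + lam))))%C; [ring|].
         rewrite <- Cexp_add. f_equal. apply C_ext; simpl; ring. }
    rewrite (CI_ext_all (lapf (fun t => B (- t + lam)) (- w)) (fun t => (fun u => Cmult E (g (u + lam))) (- t))).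
    2: { intros t. unfold lapf, g, lapf, E.
         replace (Cexp (- (- w * RtoC t))) with (Cexp (w * RtoC lam) * Cexp (- (w * RtoC (- t + lam))))%C; [ring|].
         rewrite <- Cexp_add. f_equal. apply C_ext; simpl; ring. }
    rewrite (CI_ext_all (lapf (fun t => B (- t)) (- w)) (fun t => g (- t))).
    2: { intros t. unfold lapf, g, lapf. f_equal. f_equal. apply C_ext; simpl; ring. }
    rewrite (CI_reflect (fun u => Cmult E (g (u + lam)))).
    2: { intros t. apply cont_mult; [apply cont_const|auto]. }
    rewrite (CI_reflect g) by auto.
    rewrite !CI_scal by (apply ex_CI_all; auto).
    rewrite <- Cmult_plus_distr_l. f_equal.
    rewrite Cplus_comm, CI_chasles by (apply ex_CI_all; auto).
    rewrite CI_shift by (apply ex_CI_all; auto).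
    rewrite Cplus_comm, CI_chasles by (apply ex_CI_all; auto).
    f_equal; ring. }
  assert (Z : ((m1 + m2) - E * (l1 + l2))%C = RtoC 0).
  { apply Cmod_small_0. intros eps He.
    assert (P : 0 < Cmod E + 1) by (assert (Q := Cmod_ge_0 E); lra).
    destruct (H1 (eps / 4 / (Cmod E + 1))) as [X1 K1]; [apply Rdiv_lt_0_compat; lra|].
    destruct (H2 (eps / 4 / (Cmod E + 1))) as [X2 K2]; [apply Rdiv_lt_0_compat; lra|].
    destruct (H3 (eps / 4) ltac:(lra)) as [X3 K3]. destruct (H4 (eps / 4) ltac:(lra)) as [X4 K4].
    set (X := Rabs X1 + Rabs X2 + Rabs X3 + Rabs X4 + Rabs lam).
    assert (A1 := Rle_abs X1). assert (A2 := Rle_abs X2). assert (A3 := Rle_abs X3). assert (A4 := Rle_abs X4).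
    assert (A5 := Rle_abs lam). assert (A6 := Rle_abs (- lam)). rewrite Rabs_Ropp in A6.
    assert (P1 := Rabs_pos X1). assert (P2 := Rabs_pos X2). assert (P3 := Rabs_pos X3). assert (P4 := Rabs_pos X4).
    assert (P5 := Rabs_pos lam).
    specialize (K1 (X + lam) ltac:(unfold X; lra) ltac:(unfold X; lra)).
    specialize (K2 (X - lam) ltac:(unfold X; lra) ltac:(unfold X; lra)).
    specialize (K3 X ltac:(unfold X; lra) ltac:(unfold X; lra)).
    specialize (K4 X ltac:(unfold X; lra) ltac:(unfold X; lra)).
    specialize (Fin X). fold g in K1.
    set (a := CI (lapf (fun t => B (t + lam)) w) 0 X) in *.
    set (b := CI (lapf (fun t => B (- t + lam)) (- w)) 0 X) in *.
    set (c := CI g 0 (X + lam)) in *. set (d := CI (lapf (fun t => B (- t)) (- w)) 0 (X - lam)) in *.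
    replace (m1 + m2 - E * (l1 + l2))%C with (- (a - m1) + - (b - m2) + (E * ((c - l1) + (d - l2)) + ((a + b) - E * (c + d))))%C by ring.
    rewrite Fin. replace (E * (c + d) - E * (c + d))%C with (RtoC 0) by ring. rewrite Cplus_0_r.
    eapply Rle_trans; [apply Cmod_triangle|].
    eapply Rle_trans; [apply Rplus_le_compat_r, Cmod_triangle|].
    rewrite !Cmod_opp, Cmod_mult.
    assert (T : Cmod E * Cmod (c - l1 + (d - l2)) <= (Cmod E + 1) * (eps / 4 / (Cmod E + 1) + eps / 4 / (Cmod E + 1))).
    { apply Rmult_le_compat; try apply Cmod_ge_0; [lra|]. eapply Rle_trans; [apply Cmod_triangle|]. lra. }
    replace ((Cmod E + 1) * (eps / 4 / (Cmod E + 1) + eps / 4 / (Cmod E + 1))) with (eps / 2) in T by (field; lra). lra. }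
  replace (m1 + m2)%C with ((m1 + m2) - E * (l1 + l2) + E * (l1 + l2))%C by ring. rewrite Z. ring.
Qed.

Lemma RtoC_Rsum f N : RtoC (Rsum f N) = Csum (fun n => RtoC (f n)) N.
Proof. induction N; simpl; auto. rewrite RtoC_plus, IHN. auto. Qed.

Lemma cos_le_sq x : Rabs (cos x - 1) <= x * x / 2.
Proof.
  assert (H : forall y, 0 <= y -> Rabs (cos y - 1) <= y * y / 2).
  { intros y Hy. destruct (COS_bound y) as [B1 B2].
    rewrite Rabs_left1 by lra.
    destruct (Req_dec y 0) as [->|N]; [rewrite cos_0; lra|].
    assert (Sb : forall c, 0 <= c -> sin c <= c).
    { intros c [Hc|<-]; [left; apply sin_lt_x; auto|rewrite sin_0; lra]. }
    destruct (MVT_gen (fun u => cos u - 1 + u * u / 2) 0 y (fun u => - sin u + u)) as [c [Hc E]].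
    - intros u _. auto_derive; auto. field.
    - intros u _. reg.
    - rewrite Rmin_left, Rmax_right in Hc by lra. rewrite cos_0 in E.
      assert (Z := Sb c ltac:(lra)). assert (0 <= (- sin c + c) * (y - 0)) by (apply Rmult_le_pos; lra). lra. }
  destruct (Rle_lt_dec 0 x) as [Hx|Hx]; [apply H; auto|].
  rewrite <- (cos_neg x). replace (x * x / 2) with (- x * - x / 2) by field. apply H. lra.
Qed.

(** A compromise between x^2 near 0 and 2 far out. With the exponent 1/2 the sum of n^(-2) sqrt n
    still converges, and the integral near 0 asks for Re s < -1/2, which is where the strip of the
    functional equation comes from. *)
Lemma cos_le_sqrt x : 0 <= x -> Rabs (cos x - 1) <= 2 * sqrt x.
Proof.
  intros Hx. destruct (Rle_lt_dec 1 x) as [H|H].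
  - assert (B := COS_bound x). assert (1 <= sqrt x) by (rewrite <- sqrt_1; apply sqrt_le_1; lra).
    apply Rabs_le. lra.
  - eapply Rle_trans; [apply cos_le_sq|].
    assert (S := sqrt_sqrt x Hx). assert (P := sqrt_pos x).
    assert (sqrt x <= 1) by (rewrite <- sqrt_1; apply sqrt_le_1; lra). nra.
Qed.

Definition cosexp (t : R) : C := RtoC (cos (exp t)).
Definition cosm1 (t : R) : C := RtoC (cos (exp t) - 1).

(** Integrating the j-th Taylor term of cos y - 1 against y^(-s-2) over [0, 1] gives [cos_coef j] /
    (2j + 1 - s): a pole at an odd number, with the sign reversed in comparison with [Polar]. *)
Definition cos_coef (j : nat) : C := RtoC ((-1) ^ (S j) / INR (fact (2 * S j))).
Definition odd_pole (j : nat) : C := RtoC (2 * INR j + 1).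

(* [Lfun s] continues [int_0^oo (cos y - 1) y^(-s-2) dy] from [-1 < Re s < 1] to [Re s > -1]: the part
   over [0, 1] is expanded in powers of [y]. *)
Definition Lfun (s : C) : C := (Lap cosexp (s + 1) - / (s + 1) - Polar cos_coef odd_pole s)%C.
(** Classically 2^s pi^(s-1) sin(pi s/2) Gamma(1-s), because the Mellin integral in [Lfun] equals
    -Gamma(-s-1) sin(pi s/2). *)
Definition chi (s : C) : C := (- (s * (s + 1) / RtoC PI) * Cexp (s * RtoC (ln (2 * PI))) * Lfun s)%C.

Lemma cosexp_ebound : ebound cosexp 1 0.
Proof.
  split.
  - intros t. apply real_curve_cont.
    apply (ex_derive_continuous (V := R_NormedModule)). auto_derive; auto.
  - intros t _. unfold cosexp. rewrite Rmult_0_l, exp_0, Rmult_1_r, Cmod_R.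
    assert (B := COS_bound (exp t)). apply Rabs_le. lra.
Qed.

Lemma Cmod_cos_coef j : Cmod (cos_coef j) = / INR (fact (2 * S j)).
Proof.
  unfold cos_coef. rewrite Cmod_R. assert (P := INR_fact_lt_0 (2 * S j)).
  unfold Rdiv. rewrite Rabs_mult, (Rabs_pos_eq (/ _)) by (left; apply Rinv_0_lt_compat; auto).
  rewrite pow_1_abs. ring.
Qed.

Lemma cos_series y : is_series (fun k => (-1) ^ k / INR (fact (2 * k)) * y ^ (2 * k)) (cos y).
Proof.
  unfold cos. destruct (exist_cos (Rsqr y)) as [l Hl]. unfold cos_in, infinite_sum in Hl.
  apply is_series_Reals. intros eps He. destruct (Hl eps He) as [N HN]. exists N. intros n Hn.
  specialize (HN n Hn).
  rewrite (sum_eq _ (fun i => cos_n i * Rsqr y ^ i)); auto.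
  intros i _. unfold cos_n. f_equal. unfold Rsqr. rewrite pow_mult. f_equal. simpl. ring.
Qed.

(** * The functional equation *)


Lemma ex_series_cos_coef : ex_series (fun j => Cmod (cos_coef j)).
Proof.
  apply (ex_series_dominated _ (fun n => / (INR (S n) * INR (S n)))).
  - intros n. split; [apply Cmod_ge_0|].
    rewrite Cmod_cos_coef. apply Rinv_le_contravar; [apply INR_sq_pos|].
    rewrite <- mult_INR. apply le_INR.
    replace (2 * S n)%nat with (S (S (2 * n))) by lia.
    change (fact (S (S (2 * n)))) with (S (S (2 * n)) * (S (2 * n) * fact (2 * n)))%nat.
    assert (F := lt_O_fact (2 * n)). nia.
  - apply ex_series_inv_sq.
Qed.

(** The factor y^2 is kept because with y = e^(-t) it becomes the decay e^(-2t) under which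
    [lap_series] is applied. *)
Lemma cos_remainder y N : 0 <= y <= 1 ->
  Rabs (cos y - 1 - Rsum (fun j => (-1) ^ S j / INR (fact (2 * S j)) * y ^ (2 * S j)) N)
  <= series_tail (fun j => Cmod (cos_coef j)) N * (y * y).
Proof.
  intros Hy.
  set (f := fun j => (-1) ^ S j / INR (fact (2 * S j)) * y ^ (2 * S j)).
  set (c := fun j => Cmod (cos_coef j)).
  assert (Hf : forall j, Rabs (f j) <= y * y * c j).
  { intros j. unfold f, c. rewrite Rabs_mult. rewrite Rmult_comm.
    replace (Rabs ((-1) ^ S j / INR (fact (2 * S j)))) with (Cmod (cos_coef j)) by (unfold cos_coef; rewrite Cmod_R; auto).
    apply Rmult_le_compat_r; [apply Cmod_ge_0|].
    rewrite Rabs_pos_eq by (apply pow_le; lra).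
    replace (2 * S j)%nat with (2 + 2 * j)%nat by lia. rewrite pow_add.
    replace (y ^ 2) with (y * y) by ring.
    rewrite <- (Rmult_1_r (y * y)) at 2. apply Rmult_le_compat_l; [nra|].
    rewrite <- (pow1 (2 * j)). apply pow_incr. lra. }
  assert (E : Series f = cos y - 1).
  { apply is_series_unique.
    assert (H2 := is_series_incr_1 (V := R_NormedModule) (fun k => (-1) ^ k / INR (fact (2 * k)) * y ^ (2 * k)) (cos y - 1)).
    apply H2.
    cbv beta. match goal with |- is_series _ ?l => replace l with (cos y) end; [apply cos_series|].
    simpl. unfold plus; simpl. field. }
  rewrite <- E.
  assert (Em : ex_series (fun j => y * y * c j)) by (apply (ex_series_scal (V := R_NormedModule)); apply ex_series_cos_coef).
  eapply Rle_trans; [apply (Rsum_tail_bound f (fun j => y * y * c j) N Em Hf)|].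
  unfold series_tail. rewrite Series_scal_l. lra.
Qed.

Lemma Polar_unique a p z l : Cser (fun k => a k * / (z - p k))%C l -> Polar a p z = l.
Proof.
  intros H. apply (Cser_unique (fun k => a k * / (z - p k))%C); auto.
  unfold Polar. apply epsilon_spec. eauto.
Qed.

Lemma cosm1_neg_ebound : ebound (fun v => cosm1 (- v)) (1 / 2) (- (2)).
Proof.
  split.
  - intros t. apply real_curve_cont.
    apply (ex_derive_continuous (V := R_NormedModule)). auto_derive; auto.
  - intros t _. unfold cosm1. rewrite Cmod_R. eapply Rle_trans; [apply cos_le_sq|].
    replace (- (2) * t) with (- t + - t) by ring. rewrite exp_plus. lra.
Qed.

Lemma cosm1_ebound : ebound cosm1 2 0.
Proof.
  split.
  - intros t. apply real_curve_cont.
    apply (ex_derive_continuous (V := R_NormedModule)). auto_derive; auto.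
  - intros t _. unfold cosm1. rewrite Rmult_0_l, exp_0, Rmult_1_r, Cmod_R.
    assert (B := COS_bound (exp t)). apply Rabs_le. lra.
Qed.

Lemma Cexp_pow_neg n v : Cexp (RtoC (- INR n) * RtoC v) = RtoC (exp (- v) ^ n).
Proof.
  rewrite <- RtoC_mult, Cexp_R. f_equal.
  induction n.
  - simpl. rewrite Ropp_0, Rmult_0_l, exp_0. auto.
  - rewrite S_INR, <- tech_pow_Rmult, <- IHn, <- exp_plus. f_equal. ring.
Qed.

Lemma two_le_INR j : 2 <= INR (2 * S j).
Proof. replace 2 with (INR 2) by (simpl; ring). apply le_INR. lia. Qed.

(** The part of the Mellin integral over 0 < y < 1, integrated term by term through the power
    series; the variable is v = -log y. *)
Lemma lap_cosm1_neg (s : C) : fst s < 1 -> Lap (fun v => cosm1 (- v)) (- (s + 1)) = (- Polar cos_coef odd_pole s)%C.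
Proof.
  intros Hs.
  set (f := fun j v => (cos_coef j * Cexp (RtoC (- INR (2 * S j)) * RtoC v))%C).
  assert (H : Cser (fun j => Lap (f j) (- (s + 1))%C) (Lap (fun v => cosm1 (- v)) (- (s + 1)))).
  { apply (lap_series f _ (1 / 2) (- (2)) (series_tail (fun j => Cmod (cos_coef j)))).
    - apply cosm1_neg_ebound.
    - simpl; lra.
    - intros j. exists (Cmod (cos_coef j) * 1). apply ebound_scal.
      eapply ebound_weaken; [apply ebound_exp|lra|].
      change (- INR (2 * S j) <= - (2)). assert (X := two_le_INR j). lra.
    - apply series_tail_small; [apply ex_series_cos_coef|]. intros; apply Cmod_ge_0.
    - intros N t Ht. unfold cosm1.
      rewrite (Csum_ext _ (fun j => RtoC ((-1) ^ S j / INR (fact (2 * S j)) * exp (- t) ^ (2 * S j)))).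
      2: { intros j _. unfold f. rewrite Cexp_pow_neg, RtoC_mult. reflexivity. }
      rewrite <- RtoC_Rsum, <- RtoC_minus, Cmod_R.
      replace (- (2) * t) with (- t + - t) by ring. rewrite exp_plus.
      apply cos_remainder. split; [left; apply exp_pos|]. rewrite <- exp_0. apply exp_mono. lra. }
  rewrite (Polar_unique cos_coef odd_pole s (- Lap (fun v => cosm1 (- v)) (- (s + 1)))%C); [ring|].
  replace (- Lap (fun v => cosm1 (- v)) (- (s + 1)))%C with (- (1) * Lap (fun v => cosm1 (- v)) (- (s + 1)))%C by ring.
  apply (Cser_ext (fun j => - (1) * Lap (f j) (- (s + 1)))%C); [|apply Cser_scal; auto].
  intros j. unfold f.
  assert (Q : fst (RtoC (- INR (2 * S j))) < fst (- (s + 1))%C).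
  { change (- INR (2 * S j) < - (fst s + 1)). assert (X := two_le_INR j). lra. }
  rewrite (Lap_unique _ _ _ (is_lap_scal (cos_coef j) _ _ _ (fun t => exp_C_cont _ t) (is_lap_exp _ _ Q))).
  assert (E : (- (s + 1) - RtoC (- INR (2 * S j)))%C = (- (s - odd_pole j))%C).
  { unfold odd_pole. rewrite mult_INR, (S_INR j). apply C_ext; simpl; ring. }
  rewrite E.
  assert (N : (s - odd_pole j)%C <> RtoC 0).
  { intros E2. apply (f_equal fst) in E2. unfold odd_pole in E2. simpl in E2. assert (Z := pos_INR j). lra. }
  field. auto.
Qed.

Lemma Lfun_lap s : -1 < fst s < 1 -> Lfun s = (Lap cosm1 (s + 1) + Lap (fun v => cosm1 (- v)) (- (s + 1)))%C.
Proof.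
  intros Hs. rewrite lap_cosm1_neg by lra. unfold Lfun.
  rewrite (Lap_unique cosm1 (s + 1) (Lap cosexp (s + 1) - / (s + 1))%C); [ring|].
  assert (H1 := Lap_spec _ _ _ (s + 1)%C cosexp_ebound ltac:(simpl; lra)).
  assert (H2 := is_lap_exp (RtoC 0) (s + 1)%C ltac:(simpl; lra)).
  assert (H3 := is_lap_scal (- (1))%C _ _ _ (fun t => exp_C_cont _ t) H2).
  assert (H4 := is_lap_plus _ _ _ _ _ (proj1 cosexp_ebound) (fun t => cont_mult (fun _ => (- (1))%C) _ t (cont_const _ _) (exp_C_cont _ t)) H1 H3).
  replace (Lap cosexp (s + 1) - / (s + 1))%C with (Lap cosexp (s + 1) + - (1) * / (s + 1 - 0))%C.
  2: { replace (s + 1 - 0)%C with (s + 1)%C by ring. ring. }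
  eapply is_lap_ext; [|exact H4]. intros t _. cbv beta.
  replace (RtoC 0 * RtoC t)%C with (RtoC 0) by ring. rewrite Cexp_0. unfold cosexp, cosm1.
  rewrite RtoC_minus. ring.
Qed.

(** In the variable t = log x the n-th Fourier term is, up to a factor, [cosm1] shifted by the
    logarithm of its frequency. *)
Definition saw_scale (n : nat) : R := ln (2 * PI * INR (S n)).

Lemma saw_scale_pos n : 0 < 2 * PI * INR (S n).
Proof.
  assert (P : 0 < INR (S n)) by (apply lt_0_INR; lia). assert (Q := PI_RGT_0).
  apply Rmult_lt_0_compat; lra.
Qed.

Lemma saw_term_exp n t : RtoC (saw_term n (exp t)) = (RtoC (/ (PI * PI * (INR (S n) * INR (S n)))) * cosm1 (t + saw_scale n))%C.
Proof.
  unfold cosm1, saw_term, saw_scale. rewrite exp_plus, exp_ln by apply saw_scale_pos.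
  rewrite <- RtoC_mult. f_equal. unfold Rdiv. rewrite Rmult_comm. f_equal. f_equal. f_equal. ring.
Qed.

Lemma lap_saw_term (s : C) n : -1 < fst s < 1 ->
  (Lap (fun t => RtoC (saw_term n (exp t))) (s + 1) + Lap (fun t => RtoC (saw_term n (exp (- t)))) (- (s + 1)))%C
  = (RtoC (/ (PI * PI * (INR (S n) * INR (S n)))) * (Cexp ((s + 1) * RtoC (saw_scale n)) * Lfun s))%C.
Proof.
  intros Hs. rewrite Lfun_lap by auto.
  set (K := / (PI * PI * (INR (S n) * INR (S n)))). set (lam := saw_scale n).
  assert (PK : 0 < PI * PI * (INR (S n) * INR (S n))) by (apply Rmult_lt_0_compat; [apply PI_sq_pos|apply INR_sq_pos]).
  assert (PK' : 0 < K) by (apply Rinv_0_lt_compat; auto).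
  assert (C1 : forall t, curve_cont cosm1 t) by apply cosm1_ebound.
  assert (B1 : ebound (fun t => cosm1 (t + lam)) 2 0).
  { split.
    - intros t. apply (continuous_comp (fun u => u + lam) cosm1); auto.
      apply (continuous_plus (V := R_NormedModule)); [apply continuous_id|apply continuous_const].
    - intros t _. unfold cosm1. rewrite Rmult_0_l, exp_0, Rmult_1_r, Cmod_R.
      assert (B := COS_bound (exp (t + lam))). apply Rabs_le. lra. }
  assert (B2 : ebound (fun t => cosm1 (- t + lam)) (exp (lam + lam) / 2) (- (2))).
  { split.
    - intros t. apply (continuous_comp (fun u => - u + lam) cosm1); auto.
      apply (ex_derive_continuous (V := R_NormedModule)). auto_derive; auto.
    - intros t _. unfold cosm1. rewrite Cmod_R. eapply Rle_trans; [apply cos_le_sq|].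
      replace (- (2) * t) with (- t + - t) by ring. rewrite !exp_plus. lra. }
  assert (W1 : 0 < fst (s + 1)%C) by (simpl; lra). assert (W2 : - (2) < fst (- (s + 1))%C) by (simpl; lra).
  assert (H := bilap_shift cosm1 (s + 1)%C lam _ _ _ _ C1
    (Lap_spec _ _ _ _ cosm1_ebound W1) (Lap_spec _ _ _ _ cosm1_neg_ebound W2)
    (Lap_spec _ _ _ _ B1 W1) (Lap_spec _ _ _ _ B2 W2)).
  rewrite <- H.
  rewrite (Lap_unique (fun t => RtoC (saw_term n (exp t))) (s + 1) (RtoC K * Lap (fun t => cosm1 (t + lam)%R) (s + 1))%C).
  - rewrite (Lap_unique (fun t => RtoC (saw_term n (exp (- t)))) (- (s + 1)) (RtoC K * Lap (fun t => cosm1 (- t + lam)%R) (- (s + 1)))%C).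
    + ring.
    + eapply is_lap_ext; [|apply is_lap_scal; [apply B2|apply (Lap_spec _ _ _ _ B2 W2)]].
      intros t _. symmetry. apply saw_term_exp.
  - eapply is_lap_ext; [|apply is_lap_scal; [apply B1|apply (Lap_spec _ _ _ _ B1 W1)]].
    intros t _. symmetry. apply saw_term_exp.
Qed.

Definition saw_maj2 (n : nat) : R := 2 * sqrt (2 * PI) / (PI * PI) * Rpower (INR (S n)) (- (3 / 2)).

Lemma ex_saw_maj2 : ex_series saw_maj2.
Proof. apply (ex_series_scal (V := R_NormedModule)). apply ex_series_power. lra. Qed.

Lemma saw_maj2_pos n : 0 <= saw_maj2 n.
Proof.
  unfold saw_maj2. assert (P := PI_sq_pos). assert (Q := sqrt_pos (2 * PI)).
  apply Rmult_le_pos; [|left; apply exp_pos]. apply Rle_div_r; lra.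
Qed.

Lemma saw_term_small n t : Rabs (saw_term n (exp (- t))) <= saw_maj2 n * exp (- (1 / 2) * t).
Proof.
  unfold saw_term, saw_maj2. assert (A := PI_sq_pos). assert (B := INR_sq_pos n).
  assert (P : 0 < INR (S n)) by (apply lt_0_INR; lia).
  assert (AB : 0 < PI * PI * (INR (S n) * INR (S n))) by (apply Rmult_lt_0_compat; auto).
  assert (Q := saw_scale_pos n). assert (E := exp_pos (- t)). assert (Ppi := PI_RGT_0).
  unfold Rdiv at 1. rewrite Rabs_mult, (Rabs_pos_eq (/ _)) by (left; apply Rinv_0_lt_compat; auto).
  apply Rle_trans with (2 * sqrt (2 * PI * INR (S n) * exp (- t)) * / (PI * PI * (INR (S n) * INR (S n)))).
  - apply Rmult_le_compat_r; [left; apply Rinv_0_lt_compat; auto|]. apply cos_le_sqrt.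
    apply Rmult_le_pos; lra.
  - apply Req_le. rewrite sqrt_mult by lra. rewrite sqrt_mult by lra.
    replace (sqrt (exp (- t))) with (exp (- (1 / 2) * t)).
    2: { rewrite <- (sqrt_square (exp (- (1 / 2) * t))) by (left; apply exp_pos). f_equal.
         rewrite <- exp_plus. f_equal. field. }
    replace (Rpower (INR (S n)) (- (3 / 2))) with (sqrt (INR (S n)) * / (INR (S n) * INR (S n))).
    + field. split; lra.
    + rewrite <- Rpower_sqrt by auto. unfold Rpower.
      replace (- (3 / 2) * ln (INR (S n))) with (/ 2 * ln (INR (S n)) + - (ln (INR (S n)) + ln (INR (S n)))) by field.
      rewrite exp_plus, exp_Ropp, exp_plus, !exp_ln by auto. reflexivity.
Qed.

Lemma saw_curve n (g : R -> R) t : continuous g t -> curve_cont (fun u => RtoC (saw_term n (g u))) t.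
Proof. intros Hg. apply real_curve_cont. apply (continuous_comp g (saw_term n)); auto. apply saw_term_continuous. Qed.

(** On 0 < x < 1 the integral of (x^2 - x) x^(-s-2) is 1/(1-s) + 1/s. The range x > 1, with bounded
    terms, asks for Re s > -1; the range x < 1, with the square root bound, for Re s < -1/2. *)
Lemma lap_saw_two_sided (s : C) : -1 < fst s < - (1 / 2) ->
  Cser (fun n => Lap (fun t => RtoC (saw_term n (exp t))) (s + 1) + Lap (fun t => RtoC (saw_term n (exp (- t)))) (- (s + 1)))%C
   (Lap sawexp (s + 1) + (/ (1 - s) + / s))%C.
Proof.
  intros Hs.
  assert (Ce : forall t, continuous exp t) by (intros; apply (ex_derive_continuous (V := R_NormedModule)); auto_derive; auto).
  assert (Ce' : forall t, continuous (fun t => exp (- t)) t) by (intros; apply (ex_derive_continuous (V := R_NormedModule)); auto_derive; auto).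
  apply Cser_plus.
  - apply (lap_series (fun n t => RtoC (saw_term n (exp t))) sawexp (1 / 4) 0 (series_tail saw_maj)).
    + apply sawexp_ebound.
    + simpl; lra.
    + intros n. exists (saw_maj n). split.
      * intros t. apply saw_curve; auto.
      * intros t _. rewrite Cmod_R, Rmult_0_l, exp_0, Rmult_1_r. apply saw_term_bound.
    + apply series_tail_small; [apply ex_saw_maj|apply saw_maj_nonneg].
    + intros N t _. rewrite Rmult_0_l, exp_0, Rmult_1_r. unfold sawexp.
      rewrite <- RtoC_Rsum, <- RtoC_minus, Cmod_R. apply saw_tail.
  - set (g := fun t => RtoC (saw (exp (- t)))).
    assert (W : - (1 / 2) < fst (- (s + 1))%C) by (simpl; lra).
    assert (Hg : ebound g (Series saw_maj2) (- (1 / 2))).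
    { split.
      - intros t. apply real_curve_cont. apply (continuous_comp (fun t => exp (- t)) saw); auto. apply saw_continuous.
      - intros t _. unfold g. rewrite Cmod_R.
        assert (R1 := Rsum_tail_bound (fun n => saw_term n (exp (- t))) (fun n => exp (- (1 / 2) * t) * saw_maj2 n) 0).
        rewrite series_tail_0 in R1. rewrite Series_scal_l in R1. simpl in R1. rewrite Rminus_0_r in R1.
        rewrite Rmult_comm. apply R1.
        + apply (ex_series_scal (V := R_NormedModule)), ex_saw_maj2.
        + intros n. rewrite Rmult_comm. apply saw_term_small. }
    replace (/ (1 - s) + / s)%C with (Lap g (- (s + 1))%C).
    + apply (lap_series (fun n t => RtoC (saw_term n (exp (- t)))) g (Series saw_maj2) (- (1 / 2)) (series_tail saw_maj2)); auto.
      * intros n. exists (saw_maj2 n). split.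
        -- intros t. apply (saw_curve n (fun t => exp (- t))); auto.
        -- intros t _. rewrite Cmod_R. apply saw_term_small.
      * apply series_tail_small; [apply ex_saw_maj2|apply saw_maj2_pos].
      * intros N t _. unfold g. rewrite <- RtoC_Rsum, <- RtoC_minus, Cmod_R.
        eapply Rle_trans; [apply (Rsum_tail_bound (fun n => saw_term n (exp (- t))) (fun n => exp (- (1 / 2) * t) * saw_maj2 n))|].
        -- apply (ex_series_scal (V := R_NormedModule)), ex_saw_maj2.
        -- intros n. rewrite Rmult_comm. apply saw_term_small.
        -- unfold series_tail. rewrite Series_scal_l. lra.
    + assert (H1 := is_lap_exp (RtoC (- (2))) (- (s + 1))%C ltac:(simpl; lra)).
      assert (H2 := is_lap_exp (RtoC (- (1))) (- (s + 1))%C ltac:(simpl; lra)).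
      assert (H3 := is_lap_scal (- (1))%C _ _ _ (fun t => exp_C_cont _ t) H2).
      assert (H4 := is_lap_plus _ _ _ _ _ (fun t => exp_C_cont _ t) (fun t => cont_mult (fun _ => (- (1))%C) _ t (cont_const _ _) (exp_C_cont _ t)) H1 H3).
      assert (N1 : (1 - s)%C <> RtoC 0) by (intros E; apply (f_equal fst) in E; simpl in E; lra).
      assert (N0 : s <> RtoC 0) by (intros E; apply (f_equal fst) in E; simpl in E; lra).
      replace (/ (1 - s) + / s)%C with (/ (- (s + 1) - RtoC (- (2))) + - (1) * / (- (s + 1) - RtoC (- (1))))%C.
      2: { replace (- (s + 1) - RtoC (- (2)))%C with (1 - s)%C by (apply C_ext; simpl; ring).
           replace (- (s + 1) - RtoC (- (1)))%C with (- s)%C by (apply C_ext; simpl; ring). field. auto. }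
      apply Lap_unique. eapply is_lap_ext; [|exact H4]. intros t Ht. cbv beta. unfold g.
      rewrite saw_unit.
      2: { split; [left; apply exp_pos|]. rewrite <- exp_0. apply exp_mono. lra. }
      rewrite <- !RtoC_mult, !Cexp_R. replace (- (2) * t) with (- t + - t) by ring.
      replace (- (1) * t) with (- t) by ring. rewrite exp_plus, RtoC_minus. ring.
Qed.

(** The contribution 1/(1-s) + 1/s of 0 < x < 1, multiplied by s(s+1)/2, cancels the elementary
    terms 1/(s-1) + 1/2 of the Euler-Maclaurin expression, so only the multiple of zeta(1-s)
    remains. *)
Lemma functional_equation_strip zeta s : is_zeta zeta -> -1 < fst s < - (1 / 2) -> zeta s = (chi s * zeta (1 - s))%C.
Proof.
  intros Hz Hs.
  assert (N1 : s <> RtoC 1) by (intros E; apply (f_equal fst) in E; simpl in E; lra).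
  assert (N0 : s <> RtoC 0) by (intros E; apply (f_equal fst) in E; simpl in E; lra).
  assert (N1' : (s - 1)%C <> RtoC 0) by (apply Cminus_neq; auto).
  assert (N1'' : (1 - s)%C <> RtoC 0) by (apply Cminus_neq; auto).
  assert (HW := zeta_W zeta s Hz ltac:(lra) N1).
  assert (H1 := lap_saw_two_sided s Hs).
  assert (H2 := proj2 Hz (1 - s)%C ltac:(simpl; lra)).
  set (K := (/ RtoC (PI * PI) * Cexp ((s + 1) * RtoC (ln (2 * PI))) * Lfun s)%C).
  assert (Ppi := PI_RGT_0).
  assert (H3 := Cser_scal K _ _ H2).
  (* With m = n + 1, the rescaling contributes m^(s+1) and the Fourier coefficient m^(-2); together
     they are the Dirichlet term m^(-(1-s)). *)
  assert (E : (Lap sawexp (s + 1) + (/ (1 - s) + / s))%C = (K * zeta (1 - s))%C).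
  { apply (Cser_unique _ _ _ H1). eapply Cser_ext; [|exact H3].
    intros n. cbv beta. rewrite lap_saw_term by lra. unfold K, saw_scale, cpow.
    assert (P : 0 < INR (S n)) by (apply lt_0_INR; lia).
    rewrite (ln_mult (2 * PI) (INR (S n))) by lra. set (a := ln (2 * PI)). set (b := ln (INR (S n))).
    replace (/ (PI * PI * (INR (S n) * INR (S n)))) with (/ (PI * PI) * exp (- b + - b)).
    2: { rewrite exp_plus, exp_Ropp. unfold b. rewrite exp_ln by auto. field. lra. }
    rewrite (RtoC_mult (/ (PI * PI))), (RtoC_inv (PI * PI)) by (apply Rgt_not_eq, PI_sq_pos).
    replace ((s + 1) * RtoC (a + b))%C with ((s + 1) * RtoC a + (s + 1) * RtoC b)%C by (rewrite RtoC_plus; ring).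
    replace (- (1 - s) * RtoC b)%C with ((s + 1) * RtoC b + RtoC (- b + - b))%C by (apply C_ext; simpl; ring).
    rewrite !Cexp_add, Cexp_R. ring. }
  assert (Z : zeta s = (zetaW s / (s - 1))%C) by (rewrite <- HW; field; auto).
  rewrite Z. unfold zetaW.
  assert (E' : Lap sawexp (s + 1) = (K * zeta (1 - s) - (/ (1 - s) + / s))%C) by (rewrite <- E; ring).
  rewrite E'. unfold chi. unfold K.
  replace ((s + 1) * RtoC (ln (2 * PI)))%C with (s * RtoC (ln (2 * PI)) + RtoC (ln (2 * PI)))%C by ring.
  rewrite Cexp_add, Cexp_R, exp_ln by lra. rewrite !RtoC_mult.
  assert (Np : RtoC PI <> RtoC 0) by (apply RtoC_neq; lra).
  field. repeat split; auto.
Qed.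

(** Beyond some index all points are at distance at least 1 from [z], so [d] is a minimum of
    finitely many positive numbers. *)
Lemma away_exists (a p : nat -> C) z : (forall B, exists N, forall k, (N <= k)%nat -> B <= Cmod (p k)) ->
  (forall k, a k <> RtoC 0 -> z <> p k) -> exists d, away a p z d.
Proof.
  intros Hp Hz.
  destruct (Hp (Cmod z + 1)) as [N HN].
  assert (F : forall M, exists d, 0 < d /\ forall k, (k < M)%nat -> a k <> RtoC 0 -> d <= Cmod (z - p k)).
  { induction M.
    - exists 1. split; [lra|]. intros; lia.
    - destruct IHM as [d [Hd H]]. destruct (classic (a M = RtoC 0)) as [E|NE].
      + exists d. split; auto. intros k Hk Ha. destruct (Nat.eq_dec k M) as [->|]; [tauto|]. apply H; auto. lia.
      + assert (P := Cmod_pos _ (Cminus_neq _ _ (Hz M NE))).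
        exists (Rmin d (Cmod (z - p M))). split; [apply Rmin_pos; auto|].
        intros k Hk Ha. destruct (Nat.eq_dec k M) as [->|]; [apply Rmin_r|].
        eapply Rle_trans; [apply Rmin_l|]. apply H; auto. lia. }
  destruct (F N) as [d [Hd H]].
  exists (Rmin d 1). split; [apply Rmin_pos; lra|].
  intros k Ha. destruct (Nat.lt_ge_cases k N) as [L|L].
  - eapply Rle_trans; [apply Rmin_l|]. apply H; auto.
  - eapply Rle_trans; [apply Rmin_r|]. specialize (HN k L).
    assert (T := Cmod_rev (p k) z). rewrite (Cmod_sym (p k) z) in T. lra.
Qed.

Lemma odd_pole_large B : exists N, forall k, (N <= k)%nat -> B <= Cmod (odd_pole k).
Proof.
  destruct (nfloor_ex (Rabs B) (Rabs_pos B)) as [N [_ HN]]. exists (S N). intros k Hk.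
  unfold odd_pole. rewrite Cmod_R. apply le_INR in Hk. rewrite S_INR in Hk.
  assert (Z := pos_INR k). assert (Y := Rle_abs B). rewrite Rabs_pos_eq; lra.
Qed.

Lemma chi_hol s : -1 < fst s -> (forall j, s <> odd_pole j) -> Chol chi s.
Proof.
  intros Hs Hp. destruct (away_exists cos_coef odd_pole s odd_pole_large ltac:(auto)) as [d Hd].
  assert (H1 : Chol (fun s => s + 1)%C s) by (apply Chol_plus; [apply Chol_id|apply Chol_const]).
  unfold chi, Cdiv. apply Chol_mult; [apply Chol_mult|].
  - apply Chol_opp. apply Chol_mult; [|apply Chol_const]. apply Chol_mult; auto. apply Chol_id.
  - apply Chol_Cexp. apply Chol_mult; [apply Chol_id|apply Chol_const].
  - unfold Lfun. apply Chol_minus; [apply Chol_minus|].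
    + apply (Chol_comp (Lap cosexp) (fun s => s + 1)%C); auto.
      apply (lap_holomorphic _ 1 0); [apply cosexp_ebound|simpl; lra].
    + apply Chol_inv; auto. intros E. apply (f_equal fst) in E. simpl in E. lra.
    + apply (polar_hol _ _ _ d); auto. apply ex_series_cos_coef.
Qed.

(** The identity spreads from the strip. The excluded points are 0, where 1 - s meets the pole of
    zeta, and the odd positive integers, where [chi] may have poles; they are all real, so
    horizontal lines avoid them. *)
Theorem functional_equation zeta s : is_zeta zeta -> -1 < fst s -> s <> RtoC 0 -> (forall j, s <> odd_pole j) ->
  zeta s = (chi s * zeta (1 - s))%C.
Proof.
  intros Hz Hs N0 Hp.
  set (D := fun s : C => (zeta s - chi s * zeta (1 - s))%C).
  assert (O0 : odd_pole 0 = RtoC 1) by (unfold odd_pole; simpl; f_equal; ring).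
  assert (HD : forall s : C, -1 < fst s -> s <> RtoC 0 -> (forall j, s <> odd_pole j) -> Chol D s).
  { intros z H1 H2 H3. assert (Nz : z <> RtoC 1) by (rewrite <- O0; auto).
    apply Chol_minus; [apply Hz; auto|]. apply Chol_mult; [apply chi_hol; auto|].
    apply (Chol_comp zeta (fun w => 1 - w)%C).
    - apply Hz. intros E. apply H2. replace z with (1 - (1 - z))%C by ring. rewrite E. ring.
    - apply Chol_minus; [apply Chol_const|apply Chol_id]. }
  assert (Zb : forall b, b <> 0 -> D (fst s, b) = RtoC 0).
  (* The strip -1 < Re s < -1/2 has centre -3/4 and half-width 1/4. *)
  { intros b Hb. apply (identity_horizontal D (-1) b Hb) with (x0 := - (3/4)); auto; try lra.
    - intros z Hz1 Nz. apply HD; auto.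
      + intros ->. simpl in Nz. lra.
      + intros j ->. simpl in Nz. lra.
    - exists (1/4). split; [lra|]. intros w Hw. unfold D.
      assert (Y := fst_le_Cmod (w - (- (3/4), b))). simpl in Y.
      assert (Hw' : Rabs (fst w + - - (3 / 4)) < 1/4) by lra. apply Rabs_def2 in Hw'.
      rewrite (functional_equation_strip zeta w Hz) by lra. ring. }
  assert (E : D s = RtoC 0).
  { destruct s as [x y]. destruct (Req_dec y 0) as [->|Ny]; [|apply Zb; auto].
    apply zero_by_continuity; auto. apply Chol_cont, HD; auto. }
  unfold D in E. replace (zeta s) with (zeta s - chi s * zeta (1 - s) + chi s * zeta (1 - s))%C by ring.
  rewrite E. ring.
Qed.

(** * Generalised Ramanujan sums *)


Lemma dvdb_true a b : (0 < a)%nat -> dvdb a b = true <-> Nat.divide a b.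
Proof. intros Ha. unfold dvdb. rewrite Nat.eqb_eq. apply Nat.Lcm0.mod_divide. Qed.

(** * The Moebius function *)

(** For n >= 2 the search range 2..n contains [n] itself, so the default is reached only for n <
    2. *)
Definition least_divisor (n : nat) : nat :=
  match find (fun d => dvdb d n) (seq 2 (n - 1)) with Some d => d | None => n end.

Lemma least_divisor_spec n : (2 <= n)%nat ->
  (2 <= least_divisor n)%nat /\ Nat.divide (least_divisor n) n /\
  forall d, (2 <= d)%nat -> Nat.divide d n -> (least_divisor n <= d)%nat.
Proof.
  intros Hn. unfold least_divisor.
  assert (G : forall len start, (2 <= start)%nat -> (start <= n)%nat -> (n < start + len)%nat ->
     exists p, find (fun d => dvdb d n) (seq start len) = Some p /\ (start <= p)%nat /\ Nat.divide p n /\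
       forall d, (start <= d)%nat -> Nat.divide d n -> (p <= d)%nat).
  { induction len; intros start H1 H2 H3; [lia|]. simpl.
    destruct (dvdb start n) eqn:E.
    - apply dvdb_true in E; [|lia]. exists start. auto.
    - assert (ND : ~ Nat.divide start n) by (rewrite <- dvdb_true by lia; rewrite E; discriminate).
      assert (start <> n) by (intros ->; apply ND; exists 1%nat; lia).
      destruct (IHlen (S start)) as [p [P1 [P2 [P3 P4]]]]; try lia.
      exists p. split; auto. split; [lia|]. split; auto. intros d Hd Dd. apply P4; auto.
      destruct (Nat.eq_dec d start); [subst; tauto|lia]. }
  destruct (G (n - 1)%nat 2%nat) as [p [P1 [P2 [P3 P4]]]]; try lia.
  rewrite P1. auto.
Qed.

(* The Moebius function by recursion on the least prime factor, for which [fuel = n] steps suffice. *)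
Fixpoint mu_fuel (fuel n : nat) : R :=
  match fuel with
  | O => 0
  | S f => if Nat.eqb n 1 then 1 else
      let p := least_divisor n in
      if dvdb p (n / p) then 0 else - mu_fuel f (n / p)
  end.

Definition mu (n : nat) : R := mu_fuel n n.

Lemma div_least_lt n : (2 <= n)%nat -> (1 <= n / least_divisor n < n)%nat.
Proof.
  intros Hn. destruct (least_divisor_spec n Hn) as [H1 [[k Hk] _]].
  rewrite Hk at 1 3. rewrite Nat.div_mul by lia. split; nia.
Qed.

Lemma mu_fuel_enough f1 : forall f2 n, (1 <= n)%nat -> (n <= f1)%nat -> (n <= f2)%nat -> mu_fuel f1 n = mu_fuel f2 n.
Proof.
  induction f1; intros f2 n Hn H1 H2; [lia|]. destruct f2; [lia|]. simpl.
  destruct (Nat.eqb n 1) eqn:E; auto. apply Nat.eqb_neq in E.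
  destruct (dvdb _ _); auto. f_equal.
  assert (Z := div_least_lt n ltac:(lia)). apply IHf1; lia.
Qed.

Lemma mu_1 : mu 1 = 1.
Proof. reflexivity. Qed.

Lemma mu_rec n : (2 <= n)%nat -> mu n = if dvdb (least_divisor n) (n / least_divisor n) then 0 else - mu (n / least_divisor n).
Proof.
  intros Hn. assert (Z := div_least_lt n Hn). unfold mu. set (m := (n / least_divisor n)%nat) in *.
  destruct n as [|n]; [lia|].
  change (mu_fuel (S n) (S n)) with (if Nat.eqb (S n) 1 then 1 else
    if dvdb (least_divisor (S n)) m then 0 else - mu_fuel n m).
  destruct (Nat.eqb (S n) 1) eqn:E; [apply Nat.eqb_eq in E; lia|].
  destruct (dvdb _ _); auto. f_equal. apply mu_fuel_enough; lia.
Qed.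

Lemma mu_bound n : Rabs (mu n) <= 1.
Proof.
  unfold mu. generalize n at 1. intros f. revert n. induction f; intros n; simpl.
  - rewrite Rabs_R0. lra.
  - destruct (Nat.eqb n 1); [rewrite Rabs_R1; lra|]. destruct (dvdb _ _); [rewrite Rabs_R0; lra|].
    rewrite Rabs_Ropp. auto.
Qed.

Definition Lsum (f : nat -> R) (l : list nat) : R := fold_right Rplus 0 (map f l).

Lemma Lsum_perm f l l' : Permutation l l' -> Lsum f l = Lsum f l'.
Proof. unfold Lsum. induction 1; simpl; lra. Qed.

Lemma Lsum_ext f g l : (forall x, In x l -> f x = g x) -> Lsum f l = Lsum g l.
Proof.
  unfold Lsum. induction l; simpl; intros H; auto. rewrite IHl by auto. rewrite H by auto. auto.
Qed.

Lemma Lsum_filter f P l : Lsum f l = Lsum f (filter P l) + Lsum f (filter (fun x => negb (P x)) l).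
Proof.
  unfold Lsum. induction l; simpl; [lra|]. destruct (P a); simpl; lra.
Qed.

Lemma Lsum_opp f l : Lsum (fun x => - f x) l = - Lsum f l.
Proof. unfold Lsum. induction l; simpl; lra. Qed.

Lemma Lsum_zero l : Lsum (fun _ => 0) l = 0.
Proof. unfold Lsum. induction l; simpl; lra. Qed.

Lemma Lsum_map f g l : Lsum f (map g l) = Lsum (fun x => f (g x)) l.
Proof. unfold Lsum. rewrite map_map. auto. Qed.

Definition divs (n : nat) : list nat := filter (fun d => dvdb d n) (seq 1 n).

Lemma in_divs d n : (1 <= n)%nat -> In d (divs n) <-> (1 <= d)%nat /\ Nat.divide d n.
Proof.
  intros Hn. unfold divs. rewrite filter_In, in_seq. split.
  - intros [H1 H2]. split; [lia|]. apply dvdb_true; auto. lia.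
  - intros [H1 H2]. split.
    + apply Nat.divide_pos_le in H2; lia.
    + apply dvdb_true; auto.
Qed.

Lemma divs_nodup n : NoDup (divs n).
Proof. apply NoDup_filter, seq_NoDup. Qed.

(* Multiplication by the least prime factor of [n] pairs the remaining squarefree divisors with opposite signs. *)
Lemma mu_sum n : (2 <= n)%nat -> Lsum mu (divs n) = 0.
Proof.
  intros Hn. destruct (least_divisor_spec n Hn) as [P1 [P2 P3]].
  set (p := least_divisor n) in *.
  assert (LD : forall d, (1 <= d)%nat -> Nat.divide d n -> Nat.divide p d -> least_divisor d = p).
  { intros d Hd D1 D2. assert (p <= d)%nat by (apply Nat.divide_pos_le; auto; lia).
    destruct (least_divisor_spec d ltac:(lia)) as [Q1 [Q2 Q3]].
    apply Nat.le_antisymm; [apply Q3; auto|]. apply P3; auto. eapply Nat.divide_trans; eauto. }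
  rewrite (Lsum_filter mu (fun d => dvdb p d)).
  rewrite (Lsum_filter mu (fun d => dvdb p (d / p)) (filter (fun d => dvdb p d) (divs n))).
  set (A := filter (fun d => negb (dvdb p d)) (divs n)).
  set (B := filter (fun d => negb (dvdb p (d / p))) (filter (fun d => dvdb p d) (divs n))).
  assert (HA : forall d, In d A <-> (1 <= d)%nat /\ Nat.divide d n /\ ~ Nat.divide p d).
  { intros d. unfold A. rewrite filter_In, in_divs, negb_true_iff by lia.
    rewrite <- (dvdb_true p d) by lia. destruct (dvdb p d); intuition congruence. }
  assert (HB : forall d, In d B <-> (1 <= d)%nat /\ Nat.divide d n /\ Nat.divide p d /\ ~ Nat.divide p (d / p)).
  { intros d. unfold B. rewrite !filter_In, in_divs, negb_true_iff by lia.
    rewrite <- (dvdb_true p d), <- (dvdb_true p (d / p)) by lia.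
    destruct (dvdb p d), (dvdb p (d / p)); intuition congruence. }
  rewrite (Lsum_ext mu (fun _ => 0) (filter (fun d => dvdb p (d / p)) _)).
  2: { intros d Hd. rewrite !filter_In, in_divs in Hd by lia. destruct Hd as [[[H1 H2] H3] H4].
       apply dvdb_true in H3; [|lia].
       assert (p <= d)%nat by (apply Nat.divide_pos_le; auto; lia).
       rewrite mu_rec by lia. rewrite (LD d) by auto. rewrite H4. auto. }
  rewrite Lsum_zero.
  rewrite (Lsum_ext mu (fun d => - mu (d / p)) B).
  2: { intros d Hd. apply HB in Hd. destruct Hd as [H1 [H2 [H3 H4]]].
       assert (p <= d)%nat by (apply Nat.divide_pos_le; auto; lia).
       rewrite mu_rec by lia. rewrite (LD d) by auto.
       destruct (dvdb p (d / p)) eqn:E; auto. apply dvdb_true in E; [tauto|lia]. }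
  rewrite Lsum_opp. rewrite <- (Lsum_map mu (fun d => d / p)%nat).
  rewrite (Lsum_perm mu _ A); [lra|].
  apply NoDup_Permutation.
  - apply NoDup_map_NoDup_ForallPairs.
    + intros x y Hx Hy E. apply HB in Hx. apply HB in Hy.
      destruct Hx as [_ [_ [[u Hu] _]]]. destruct Hy as [_ [_ [[v Hv] _]]]. subst x y.
      rewrite !Nat.div_mul in E by lia. subst. auto.
    + unfold B. apply NoDup_filter, NoDup_filter, divs_nodup.
  - unfold A. apply NoDup_filter, divs_nodup.
  - intros e. rewrite HA, in_map_iff. split.
    + intros [d [E Hd]]. apply HB in Hd. destruct Hd as [H1 [H2 [[k Hk] H4]]]. subst d.
      rewrite Nat.div_mul in E, H4 by lia. subst e. split; [nia|]. split; auto.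
      eapply Nat.divide_trans; [|exact H2]. exists p; lia.
    + intros [H1 [H2 H3]]. exists (e * p)%nat. rewrite Nat.div_mul by lia. split; auto.
      apply HB. rewrite Nat.div_mul by lia. split; [nia|]. split; [|split; auto].
      2: exists e; auto.
      (* Primality of [p] enters here: a common divisor greater than 1 divides [n], hence is at
         least the least divisor [p], and being at most [p] it equals [p], which does not divide
         [e]. *)
      assert (G : Nat.gcd p e = 1%nat).
      { assert (g1 := Nat.gcd_divide_l p e). assert (g2 := Nat.gcd_divide_r p e).
        assert (g0 : Nat.gcd p e <> 0%nat) by (intros E; apply Nat.gcd_eq_0 in E; lia).
        destruct (Nat.eq_dec (Nat.gcd p e) 1); auto. exfalso.
        assert (L := P3 (Nat.gcd p e) ltac:(lia) (Nat.divide_trans _ _ _ g1 P2)).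
        apply Nat.divide_pos_le in g1 as L2; [|lia].
        replace (Nat.gcd p e) with p in g2 by lia. tauto. }
      destruct H2 as [k Hk].
      assert (Q : Nat.divide p k).
      { apply (Nat.gauss p e k); auto. rewrite Nat.mul_comm, <- Hk. auto. }
      destruct Q as [j Hj]. exists j. rewrite Hk, Hj. lia.
Qed.

Lemma csum_app l l' : csum (l ++ l') = (csum l + csum l')%C.
Proof. unfold csum. induction l; simpl; [ring|]. rewrite IHl. ring. Qed.

Lemma csum_filter_seq (f : nat -> C) P s N :
  csum (map f (filter P (seq s N))) = Csum (fun k => if P (s + k)%nat then f (s + k)%nat else RtoC 0) N.
Proof.
  induction N; auto. rewrite seq_S, filter_app, map_app, csum_app, IHN. simpl Csum. f_equal.
  simpl. destruct (P (s + N)%nat); simpl; ring.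
Qed.

Lemma RtoC_Lsum f l : RtoC (Lsum f l) = csum (map (fun d => RtoC (f d)) l).
Proof. unfold Lsum, csum. induction l; simpl; auto. rewrite RtoC_plus, IHl. auto. Qed.

Lemma Csum_swap (f : nat -> nat -> C) N M :
  Csum (fun i => Csum (fun j => f i j) M) N = Csum (fun j => Csum (fun i => f i j) N) M.
Proof.
  induction N; simpl.
  - induction M; simpl; auto. rewrite <- IHM. ring.
  - rewrite IHN. rewrite <- Csum_plus. auto.
Qed.

Lemma Csum_zero N : Csum (fun _ => RtoC 0) N = RtoC 0.
Proof. induction N; simpl; auto. rewrite IHN. ring. Qed.

Lemma Csum_single (f : nat -> C) k N : (k < N)%nat -> (forall j, (j < N)%nat -> j <> k -> f j = RtoC 0) -> Csum f N = f k.
Proof.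
  induction N; intros Hk H; [lia|]. simpl. destruct (Nat.eq_dec k N) as [->|Nk].
  - rewrite (Csum_ext f (fun _ => RtoC 0)) by (intros; apply H; lia). rewrite Csum_zero. ring.
  - rewrite IHN by (auto; lia). rewrite (H N) by lia. ring.
Qed.

(* Dirichlet convolution; the values [x 0] and [y 0] are ignored. *)
Definition dconv (x y : nat -> C) (n : nat) : C :=
  Csum (fun i => Csum (fun j => if Nat.eqb (S i * S j) n then x (S i) * y (S j) else RtoC 0)%C n) n.

(** A range common to all [n] up to [N] is what allows the sums over [n], [i] and [j] to be
    interchanged in [dconv_partial]. *)
Lemma dconv_wide x y n N : (n <= N)%nat -> dconv x y n =
  Csum (fun i => Csum (fun j => if Nat.eqb (S i * S j) n then x (S i) * y (S j) else RtoC 0)%C N) N.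
Proof.
  intros H. unfold dconv. replace N with (n + (N - n))%nat by lia. rewrite Csum_split.
  rewrite (Csum_ext (fun i => Csum (fun j => if Nat.eqb (S (n + i) * S j) n then x (S (n + i)) * y (S j) else RtoC 0)%C (n + (N - n))) (fun _ => RtoC 0)).
  - rewrite Csum_zero, Cplus_0_r. apply Csum_ext. intros i Hi. rewrite Csum_split.
    rewrite (Csum_ext (fun j => if Nat.eqb (S i * S (n + j)) n then x (S i) * y (S (n + j)) else RtoC 0)%C (fun _ => RtoC 0)).
    + rewrite Csum_zero, Cplus_0_r. auto.
    + intros j Hj. destruct (Nat.eqb_spec (S i * S (n + j)) n); auto. nia.
  - intros i Hi. rewrite (Csum_ext _ (fun _ => RtoC 0)); [apply Csum_zero|].
    intros j Hj. destruct (Nat.eqb_spec (S (n + i) * S j) n); auto. nia.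
Qed.

Lemma dconv_div x y n : (1 <= n)%nat -> dconv x y n =
  Csum (fun j => if dvdb (S j) n then x (n / S j)%nat * y (S j) else RtoC 0)%C n.
Proof.
  intros Hn. unfold dconv. rewrite Csum_swap. apply Csum_ext. intros j Hj.
  destruct (dvdb (S j) n) eqn:E.
  - apply dvdb_true in E; [|lia]. destruct E as [k Hk].
    rewrite Hk at 2. rewrite Nat.div_mul by lia.
    rewrite (Csum_single _ (k - 1)%nat).
    + destruct k; [lia|]. replace (S (S k - 1)) with (S k) by lia.
      destruct (Nat.eqb_spec (S k * S j) n); auto. lia.
    + nia.
    + intros i Hi Ni. destruct (Nat.eqb_spec (S i * S j) n) as [e|]; auto. exfalso. apply Ni. nia.
  - rewrite (Csum_ext _ (fun _ => RtoC 0)); [apply Csum_zero|].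
    intros i Hi. destruct (Nat.eqb_spec (S i * S j) n) as [e|]; auto.
    exfalso. assert (dvdb (S j) n = true) by (apply dvdb_true; [lia|]; exists (S i); lia). congruence.
Qed.

Lemma dconv_one_mu n : (1 <= n)%nat -> dconv (fun _ => RtoC 1) (fun d => RtoC (mu d)) n = if Nat.eqb n 1 then RtoC 1 else RtoC 0.
Proof.
  intros Hn. rewrite dconv_div by auto.
  transitivity (RtoC (Lsum mu (divs n))).
  - rewrite RtoC_Lsum. unfold divs. rewrite csum_filter_seq. apply Csum_ext. intros j Hj.
    change (1 + j)%nat with (S j). destruct (dvdb (S j) n); auto. ring.
  - destruct (Nat.eqb_spec n 1) as [->|N1].
    + unfold divs, Lsum. simpl. rewrite mu_1. f_equal. ring.
    + rewrite mu_sum by lia. auto.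
Qed.

(** * Moebius inversion for generalised Ramanujan sums *)

(** These are the Dirichlet coefficients of sigma: sigma_{1-s/beta}(n) is the sum of m^beta m^(-s)
    over m^beta dividing n. *)
Definition pow_part (beta n m : nat) : R := if dvdb (m ^ beta) n then INR (m ^ beta) else 0.

(** A geometric sum with ratio w satisfying w^M = 1. Reducing [n] modulo [M] shows that w differs
    from 1 unless M divides n, since then cos x = 1 - 2 sin^2(x/2) < 1. *)
Lemma root_of_unity_sum (n M : nat) : (1 <= M)%nat ->
  Csum (fun h => Cexp (Ci * RtoC (2 * PI * INR n * INR h / INR M))%C) M = if dvdb M n then RtoC (INR M) else RtoC 0.
Proof.
  intros HM. assert (PM : 0 < INR M) by (apply lt_0_INR; lia). assert (Ppi := PI_RGT_0).
  set (w := Cexp (Ci * RtoC (2 * PI * INR n / INR M))).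
  rewrite (Csum_ext _ (fun h => Cpow w h)).
  2: { intros h _. induction h.
       - simpl. rewrite Rmult_0_r. unfold Rdiv. rewrite Rmult_0_l, Cmult_0_r. apply Cexp_0.
       - rewrite Cpow_S, <- IHh. unfold w. rewrite <- Cexp_add. f_equal. rewrite S_INR.
         apply C_ext; simpl; field; lra. }
  assert (Per : forall k : nat, Cexp (Ci * RtoC (2 * PI * INR k)) = RtoC 1).
  { intros k. unfold Cexp. simpl. replace (0 * (2 * PI * INR k) - 1 * 0) with 0 by ring.
    replace (0 * 0 + 1 * (2 * PI * INR k)) with (0 + 2 * INR k * PI) by ring.
    rewrite cos_period, sin_period, exp_0, cos_0, sin_0. apply C_ext; simpl; ring. }
  assert (G : forall N, ((w - 1) * Csum (fun h => Cpow w h) N)%C = (Cpow w N - 1)%C).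
  { induction N; simpl; [ring|]. rewrite Cmult_plus_distr_l, IHN. ring. }
  assert (WM : Cpow w M = RtoC 1).
  { rewrite <- (Per n). unfold w.
    assert (PW : forall h, Cpow (Cexp (Ci * RtoC (2 * PI * INR n / INR M))) h = Cexp (Ci * RtoC (2 * PI * INR n * INR h / INR M))).
    { induction h.
      - simpl. rewrite Rmult_0_r. unfold Rdiv. rewrite Rmult_0_l, Cmult_0_r, Cexp_0. auto.
      - rewrite Cpow_S, IHh. rewrite <- Cexp_add. f_equal. rewrite S_INR. apply C_ext; simpl; field; lra. }
    rewrite PW. f_equal. apply C_ext; simpl; field; lra. }
  assert (WR : w = Cexp (Ci * RtoC (2 * PI * INR (n mod M) / INR M))).
  { unfold w. rewrite (Nat.div_mod_eq n M) at 1. rewrite plus_INR, mult_INR.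
    replace (Ci * RtoC (2 * PI * (INR M * INR (n / M) + INR (n mod M)) / INR M))%C
      with (Ci * RtoC (2 * PI * INR (n / M)) + Ci * RtoC (2 * PI * INR (n mod M) / INR M))%C
      by (apply C_ext; simpl; field; lra).
    rewrite Cexp_add, Per. ring. }
  destruct (dvdb M n) eqn:E; unfold dvdb in E.
  - apply Nat.eqb_eq in E. rewrite E in WR. simpl in WR.
    replace (Ci * RtoC (2 * PI * 0 / INR M))%C with (RtoC 0) in WR by (apply C_ext; simpl; field; lra).
    rewrite Cexp_0 in WR. rewrite WR.
    assert (Z : forall N, Csum (fun h => Cpow (RtoC 1) h) N = RtoC (INR N)).
    { induction N; auto. rewrite S_INR, RtoC_plus, <- IHN. simpl Csum. rewrite Cpow_1_l. auto. }
    apply Z.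
  - apply Nat.eqb_neq in E. specialize (G M). rewrite WM in G.
    assert (NW : (w - 1)%C <> RtoC 0).
    { intros E2. apply (f_equal fst) in E2. rewrite WR in E2. unfold Cexp in E2. simpl in E2.
      set (x := 2 * PI * INR (n mod M) / INR M) in *.
      replace (0 * x - 1 * 0) with 0 in E2 by ring. replace (0 * 0 + 1 * x) with x in E2 by ring.
      rewrite exp_0 in E2.
      assert (Hx : 0 < x / 2 < PI).
      { assert (B := Nat.mod_upper_bound n M ltac:(lia)). apply lt_INR in B.
        assert (B0 : 0 < INR (n mod M)) by (apply lt_0_INR; lia).
        unfold x. split.
        - apply Rdiv_lt_0_compat; [|lra]. apply Rdiv_lt_0_compat; auto. apply Rmult_lt_0_compat; lra.
        - replace (2 * PI * INR (n mod M) / INR M / 2) with (PI * (INR (n mod M) / INR M)) by (field; lra).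
          rewrite <- (Rmult_1_r PI) at 2. apply Rmult_lt_compat_l; auto. apply Rlt_div_l; lra. }
      assert (S0 := sin_gt_0 (x / 2) (proj1 Hx) (proj2 Hx)).
      replace x with (2 * (x / 2)) in E2 by field. rewrite cos_2a_sin in E2. nra. }
    replace (Csum (fun h => Cpow w h) M) with (/ (w - 1) * ((w - 1) * Csum (fun h => Cpow w h) M))%C by (field; auto).
    rewrite G. ring.
Qed.

Lemma Csum_multiples (F : nat -> C) D M : (1 <= D)%nat ->
  Csum (fun h => if dvdb D h then F h else RtoC 0) (D * M) = Csum (fun j => F (D * j)%nat) M.
Proof.
  intros HD. induction M.
  - rewrite Nat.mul_0_r. auto.
  - replace (D * S M)%nat with (D * M + D)%nat by lia. rewrite Csum_split, IHM. simpl. f_equal.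
    rewrite (Csum_single _ 0%nat); try lia.
    + rewrite Nat.add_0_r. destruct (dvdb D (D * M)) eqn:E; auto.
      assert (dvdb D (D * M) = true) by (apply dvdb_true; [lia|]; exists M; lia). congruence.
    + intros j Hj Nj. destruct (dvdb D (D * M + j)) eqn:E; auto. apply dvdb_true in E; [|lia].
      destruct E as [k Hk]. exfalso. assert (k = M) by nia. nia.
Qed.

Lemma pow_divide a b k : Nat.divide a b -> Nat.divide (a ^ k) (b ^ k).
Proof. intros [c ->]. exists (c ^ k)%nat. apply Nat.pow_mul_l. Qed.

Lemma gcd_pow_1 a b k : Nat.gcd a b = 1%nat -> Nat.gcd (a ^ k) b = 1%nat.
Proof.
  intros H. induction k; simpl.
  - apply Nat.divide_1_r. exact (Nat.gcd_divide_l 1 b).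
  - rewrite Nat.gcd_comm.
    assert (g1 := Nat.gcd_divide_l b (a * a ^ k)). assert (g2 := Nat.gcd_divide_r b (a * a ^ k)).
    set (g := Nat.gcd b (a * a ^ k)) in *.
    assert (Nat.gcd g a = 1%nat).
    { apply Nat.divide_1_r. rewrite <- H. apply Nat.gcd_greatest; [apply Nat.gcd_divide_r|].
      eapply Nat.divide_trans; [apply Nat.gcd_divide_l|exact g1]. }
    apply Nat.gauss in g2; auto. apply Nat.divide_1_r. rewrite <- IHk. apply Nat.gcd_greatest; auto.
Qed.

(** After division by the gcd, u^k divides v^k with u and v coprime, which forces u = 1. *)
Lemma pow_divide_inv a b k : (1 <= k)%nat -> (1 <= a)%nat -> Nat.divide (a ^ k) (b ^ k) -> Nat.divide a b.
Proof.
  intros Hk Ha H.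
  destruct (Nat.eq_dec b 0) as [->|Nb]; [exists 0%nat; auto|].
  set (g := Nat.gcd a b). assert (g1 := Nat.gcd_divide_l a b). assert (g2 := Nat.gcd_divide_r a b). fold g in g1, g2.
  assert (g0 : g <> 0%nat) by (intros E; unfold g in E; apply Nat.gcd_eq_0 in E; lia).
  destruct g1 as [u Hu]. destruct g2 as [v Hv].
  assert (Huv : Nat.gcd u v = 1%nat).
  { assert (E := Nat.gcd_mul_mono_r u v g). rewrite <- Hu, <- Hv in E. fold g in E. nia. }
  rewrite Hu, Hv, !Nat.pow_mul_l in H.
  assert (gk : (g ^ k <> 0)%nat) by (apply Nat.pow_nonzero; auto).
  apply Nat.mul_divide_cancel_r in H; auto.
  assert (G : Nat.gcd (u ^ k) (v ^ k) = 1%nat).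
  { apply gcd_pow_1. rewrite Nat.gcd_comm. apply gcd_pow_1. rewrite Nat.gcd_comm. auto. }
  assert (U : (u ^ k = 1)%nat).
  { apply Nat.divide_1_r. rewrite <- G. apply Nat.gcd_greatest; auto. apply Nat.divide_refl. }
  assert (u = 1%nat).
  { destruct (Nat.eq_dec u 1); auto. exfalso.
    destruct u as [|[|u]]; try lia.
    assert (Z := Nat.pow_gt_1 (S (S u)) k ltac:(lia) ltac:(lia)). lia. }
  subst u. exists v. lia.
Qed.

Lemma lcm_pow_divide d e beta h : (1 <= d)%nat -> (1 <= e)%nat -> Nat.divide (d ^ beta) h -> Nat.divide (e ^ beta) h ->
  Nat.divide (Nat.lcm d e ^ beta) h.
Proof.
  intros Hd He [x Hx] [y Hy].
  set (g := Nat.gcd d e). assert (g1 := Nat.gcd_divide_l d e). assert (g2 := Nat.gcd_divide_r d e). fold g in g1, g2.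
  assert (g0 : g <> 0%nat) by (intros E; unfold g in E; apply Nat.gcd_eq_0 in E; lia).
  destruct g1 as [u Hu]. destruct g2 as [v Hv].
  assert (Huv : Nat.gcd u v = 1%nat).
  { assert (E := Nat.gcd_mul_mono_r u v g). rewrite <- Hu, <- Hv in E. fold g in E. nia. }
  assert (L : Nat.lcm d e = (u * v * g)%nat).
  { unfold Nat.lcm. fold g. rewrite Hv at 1. rewrite Nat.div_mul by auto. rewrite Hu. lia. }
  rewrite L, !Nat.pow_mul_l.
  assert (gk : (g ^ beta <> 0)%nat) by (apply Nat.pow_nonzero; auto).
  assert (E : (x * u ^ beta = y * v ^ beta)%nat).
  { rewrite Hu, Nat.pow_mul_l in Hx. rewrite Hv, Nat.pow_mul_l in Hy. nia. }
  assert (G : Nat.gcd (u ^ beta) (v ^ beta) = 1%nat).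
  { apply gcd_pow_1. rewrite Nat.gcd_comm. apply gcd_pow_1. rewrite Nat.gcd_comm. auto. }
  assert (D : Nat.divide (v ^ beta) x).
  { apply (Nat.gauss _ (u ^ beta)); [|rewrite Nat.gcd_comm; auto]. exists y. lia. }
  destruct D as [z ->]. exists z. rewrite Hx, Hu, Nat.pow_mul_l. lia.
Qed.

(** The admissible [d] are closed under least common multiples, so the largest of them is a multiple
    of all. This [g] plays the part of a gcd, and [g = 1] is the coprimality in the definition of
    c_q. *)
Lemma common_power_divisor beta q h : (1 <= q)%nat -> exists g, (1 <= g)%nat /\
  forall d, (1 <= d)%nat -> (Nat.divide d q /\ Nat.divide (d ^ beta) h) <-> Nat.divide d g.
Proof.
  intros Hq.
  set (P := fun d => (1 <= d)%nat /\ Nat.divide d q /\ Nat.divide (d ^ beta) h).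
  assert (P1 : P 1%nat).
  { split; auto. split; [exists q; lia|]. exists h. rewrite Nat.pow_1_l. lia. }
  assert (M : forall k, exists g, P g /\ forall d, P d -> (d <= k)%nat -> (d <= g)%nat).
  { induction k.
    - exists 1%nat. split; auto.
    - destruct IHk as [g [Hg Hm]]. destruct (classic (P (S k) /\ (g <= S k)%nat)) as [[H L]|H].
      + exists (S k). split; auto.
      + exists g. split; auto. intros d Hd Ld. destruct (Nat.eq_dec d (S k)) as [->|]; [|apply Hm; auto; lia].
        destruct (Nat.le_gt_cases g (S k)); [tauto|lia]. }
  destruct (M q) as [g [[G1 [G2 G3]] Gm]].
  exists g. split; auto. intros d Hd. split.
  - intros [D1 D2].
    assert (L : P (Nat.lcm d g)).
    { assert (Nat.lcm d g <> 0)%nat by (intros E; apply Nat.lcm_eq_0 in E; lia).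
      split; [lia|]. split; [apply Nat.lcm_least; auto|]. apply lcm_pow_divide; auto. }
    assert (LE : (Nat.lcm d g <= g)%nat).
    { apply Gm; auto. destruct L as [_ [L _]]. apply Nat.divide_pos_le in L; lia. }
    assert (D := Nat.divide_lcm_r d g). assert (E := Nat.divide_lcm_l d g). destruct L as [L1 _].
    apply Nat.divide_pos_le in D; [|lia]. replace (Nat.lcm d g) with g in E by lia. auto.
  - intros D. split; [eapply Nat.divide_trans; eauto|].
    eapply Nat.divide_trans; [|exact G3]. apply pow_divide; auto.
Qed.

(** The right side is the sum of mu over the divisors of [g], which is 1 for [g = 1] and 0
    otherwise. *)
Lemma beta_coprime_mu beta q h : (1 <= beta)%nat -> (1 <= q)%nat ->
  (if beta_coprime beta q h then RtoC 1 else RtoC 0) =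
  Csum (fun j => if dvdb (S j) q then (if dvdb (S j ^ beta) h then RtoC (mu (S j)) else RtoC 0) else RtoC 0) q.
Proof.
  intros Hb Hq. destruct (common_power_divisor beta q h Hq) as [g [Hg HG]].
  assert (pp : forall d, (1 <= d)%nat -> (0 < d ^ beta)%nat) by (intros d Hd; apply Nat.neq_0_lt_0, Nat.pow_nonzero; lia).
  assert (E1 : Csum (fun j => if dvdb (S j) q then (if dvdb (S j ^ beta) h then RtoC (mu (S j)) else RtoC 0) else RtoC 0) q
    = RtoC (Lsum mu (filter (fun d => dvdb (d ^ beta) h) (divs q)))).
  { rewrite RtoC_Lsum. unfold divs.
    assert (FF : forall l : list nat, filter (fun d => dvdb (d ^ beta) h) (filter (fun d => dvdb d q) l) = filter (fun d => dvdb d q && dvdb (d ^ beta) h)%bool l).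
    { induction l; auto. simpl. destruct (dvdb a q); simpl; rewrite <- IHl; auto. }
    rewrite FF, csum_filter_seq. apply Csum_ext. intros j _. change (1 + j)%nat with (S j).
    destruct (dvdb (S j) q), (dvdb (S j ^ beta) h); auto. }
  rewrite E1. rewrite (Lsum_perm mu _ (divs g)).
  2: { apply NoDup_Permutation; [apply NoDup_filter, divs_nodup|apply divs_nodup|].
       intros d. rewrite filter_In, !in_divs by auto. split.
       - intros [[D1 D2] D3]. split; auto. apply dvdb_true in D3; [|auto]. apply HG; auto.
       - intros [D1 D2]. apply HG in D2; auto. destruct D2. repeat split; auto. apply dvdb_true; auto. }
  assert (BC : beta_coprime beta q h = true <-> g = 1%nat).
  { unfold beta_coprime. rewrite forallb_forall. split.
    - intros H. destruct (Nat.eq_dec g 1); auto. exfalso.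
      assert (D := proj2 (HG g Hg) (Nat.divide_refl g)). destruct D as [D1 D2].
      assert (Lq : (g <= q)%nat) by (apply Nat.divide_pos_le; auto).
      assert (Lb : (q <= q ^ beta)%nat) by (rewrite <- (Nat.pow_1_r q) at 1; apply Nat.pow_le_mono_r; lia).
      specialize (H g ltac:(apply in_seq; lia)).
      rewrite (proj2 (dvdb_true _ _ (pp g Hg)) D2), (proj2 (dvdb_true _ _ (pp g Hg)) (pow_divide _ _ _ D1)) in H. discriminate.
    - intros -> d Hd. apply in_seq in Hd. apply negb_true_iff. apply andb_false_iff.
      destruct (dvdb (d ^ beta) h) eqn:A; auto. destruct (dvdb (d ^ beta) (q ^ beta)) eqn:B; auto. exfalso.
      apply dvdb_true in A; [|apply pp; lia]. apply dvdb_true in B; [|apply pp; lia].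
      apply pow_divide_inv in B; try lia.
      assert (D := proj1 (HG d ltac:(lia)) (conj B A)). apply Nat.divide_1_r in D. lia. }
  destruct (beta_coprime beta q h).
  - rewrite (proj1 BC eq_refl). unfold divs, Lsum. simpl. rewrite mu_1. f_equal. ring.
  - rewrite mu_sum; auto. destruct (Nat.eq_dec g 1) as [e|]; [apply BC in e; discriminate|lia].
Qed.

(** The coprimality condition is replaced by its Moebius sum. For fixed d dividing q only multiples
    of d^beta remain, and they form a complete sum over roots of unity of order (q/d)^beta. *)
Theorem c_beta_convolution beta q n : (1 <= beta)%nat -> (1 <= q)%nat ->
  c_beta beta q n = dconv (fun m => RtoC (pow_part beta n m)) (fun d => RtoC (mu d)) q.
Proof.
  intros Hb Hq. rewrite dconv_div by auto. unfold c_beta. rewrite csum_filter_seq.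
  set (e := fun h => Cexp (Ci * RtoC (2 * PI * INR n * INR h / INR (q ^ beta)))%C).
  rewrite (Csum_ext _ (fun h => Csum (fun j => if dvdb (S j) q then (if dvdb (S j ^ beta) h then RtoC (mu (S j)) * e h else RtoC 0) else RtoC 0)%C q)).
  2: { intros h _. change (0 + h)%nat with h.
       transitivity ((if beta_coprime beta q h then RtoC 1 else RtoC 0) * e h)%C.
       - unfold e. destruct (beta_coprime beta q h); ring.
       - rewrite beta_coprime_mu by auto. rewrite Cmult_comm, <- Csum_scal. apply Csum_ext. intros j _.
         destruct (dvdb (S j) q), (dvdb (S j ^ beta) h); ring. }
  rewrite Csum_swap. apply Csum_ext. intros j Hj.
  destruct (dvdb (S j) q) eqn:E; [|apply Csum_zero].
  apply dvdb_true in E; [|lia]. destruct E as [m Hm].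
  assert (Hm1 : (1 <= m)%nat) by (destruct m; lia).
  assert (HD : (1 <= S j ^ beta)%nat) by (apply Nat.neq_0_lt_0, Nat.pow_nonzero; lia).
  assert (HMm : (1 <= m ^ beta)%nat) by (apply Nat.neq_0_lt_0, Nat.pow_nonzero; lia).
  replace (q / S j)%nat with m by (rewrite Hm, Nat.div_mul by lia; auto).
  assert (Q : (q ^ beta = S j ^ beta * m ^ beta)%nat) by (rewrite Hm, Nat.pow_mul_l; lia).
  rewrite Q at 1. rewrite (Csum_multiples (fun h => RtoC (mu (S j)) * e h)%C) by auto.
  rewrite Csum_scal, Cmult_comm. f_equal.
  rewrite (Csum_ext _ (fun h => Cexp (Ci * RtoC (2 * PI * INR n * INR h / INR (m ^ beta)))%C)).
  - rewrite root_of_unity_sum by auto. unfold pow_part. destruct (dvdb (m ^ beta) n); auto.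
  - intros h _. unfold e. rewrite Q, !mult_INR. do 3 f_equal. field.
    split; apply not_0_INR; lia.
Qed.

(** * Dirichlet products *)


Lemma Rsum_split f N k : Rsum f (N + k) = Rsum f N + Rsum (fun j => f (N + j)%nat) k.
Proof.
  induction k; simpl.
  - rewrite Nat.add_0_r. ring.
  - rewrite Nat.add_succ_r. simpl. rewrite IHk. ring.
Qed.

Lemma Rsum_plus f g N : Rsum (fun n => f n + g n) N = Rsum f N + Rsum g N.
Proof. induction N; simpl; [ring|]. rewrite IHN. ring. Qed.

Lemma Rsum_nonneg f N : (forall n, 0 <= f n) -> 0 <= Rsum f N.
Proof. intros H. induction N; simpl; [lra|]. specialize (H N). lra. Qed.

Lemma Rsum_Series m N : ex_series m -> (forall n, 0 <= m n) -> Rsum m N <= Series m.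
Proof. intros Hm Hp. rewrite <- series_tail_0. apply (Rsum_le_tail m 0 N); auto. Qed.

Lemma Csum_prod f g N M : Csum (fun i => Csum (fun j => f i * g j)%C M) N = (Csum f N * Csum g M)%C.
Proof. induction N; simpl; [ring|]. rewrite IHN, Csum_scal. ring. Qed.

(** Each pair with product at most [N] meets exactly one [n], so the partial sums run over the
    lattice points under a hyperbola. *)
Lemma dconv_partial x y N : Csum (fun n => dconv x y (S n)) N =
  Csum (fun i => Csum (fun j => if Nat.leb (S i * S j) N then x (S i) * y (S j) else RtoC 0)%C N) N.
Proof.
  rewrite (Csum_ext _ (fun n => Csum (fun i => Csum (fun j => if Nat.eqb (S i * S j) (S n) then x (S i) * y (S j) else RtoC 0)%C N) N)).
  2: { intros n Hn. apply dconv_wide. lia. }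
  rewrite Csum_swap. apply Csum_ext. intros i _. rewrite Csum_swap. apply Csum_ext. intros j _.
  destruct (Nat.leb_spec (S i * S j) N).
  - rewrite (Csum_single _ (S i * S j - 1)%nat).
    + destruct (Nat.eqb_spec (S i * S j) (S (S i * S j - 1))); auto. lia.
    + lia.
    + intros k Hk Nk. destruct (Nat.eqb_spec (S i * S j) (S k)); auto. lia.
  - rewrite (Csum_ext _ (fun _ => RtoC 0)); [apply Csum_zero|].
    intros k Hk. destruct (Nat.eqb_spec (S i * S j) (S k)); auto. lia.
Qed.

Lemma dconv_norm x y n : Cmod (dconv x y n) <= fst (dconv (fun k => RtoC (Cmod (x k))) (fun k => RtoC (Cmod (y k))) n).
Proof.
  unfold dconv.
  assert (G : forall (F : nat -> C) (H : nat -> C) N, (forall i, Cmod (F i) <= fst (H i)) -> Cmod (Csum F N) <= fst (Csum H N)).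
  { intros F H N HF. induction N; simpl; [rewrite Cmod_0; lra|].
    eapply Rle_trans; [apply Cmod_triangle|]. specialize (HF N). lra. }
  apply G. intros i. apply G. intros j. destruct (Nat.eqb _ _).
  - rewrite Cmod_mult. simpl. lra.
  - rewrite Cmod_0. simpl. lra.
Qed.

Lemma dconv_abs_series x y : ex_series (fun k => Cmod (x (S k))) -> ex_series (fun k => Cmod (y (S k))) ->
  ex_series (fun n => Cmod (dconv x y (S n))).
Proof.
  intros Hx Hy.
  apply (ex_series_bounded _ (Series (fun k => Cmod (x (S k))) * Series (fun k => Cmod (y (S k))))).
  { intros; apply Cmod_ge_0. }
  intros N.
  set (x' := fun k => RtoC (Cmod (x k))). set (y' := fun k => RtoC (Cmod (y k))).
  apply Rle_trans with (Rsum (fun n => fst (dconv x' y' (S n))) N).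
  { apply Rsum_le; intros n _; apply dconv_norm. }
  assert (E : forall F M, Rsum (fun n => fst (F n : C)) M = fst (Csum F M)).
  { intros F M. induction M; simpl; auto. rewrite IHM. auto. }
  rewrite (E (fun n => dconv x' y' (S n))), dconv_partial.
  apply Rle_trans with (fst (Csum (fun i => Csum (fun j => x' (S i) * y' (S j))%C N) N)).
  - assert (G : forall (F H : nat -> C) M, (forall i, fst (F i) <= fst (H i)) -> fst (Csum F M) <= fst (Csum H M)).
    { intros F H M HF. induction M; simpl; [lra|]. specialize (HF M). lra. }
    apply G. intros i. apply G. intros j. destruct (Nat.leb _ _); [lra|]. unfold x', y'. simpl.
    assert (P := Rmult_le_pos _ _ (Cmod_ge_0 (x (S i))) (Cmod_ge_0 (y (S j)))). lra.
  - rewrite (Csum_prod (fun i => x' (S i)) (fun j => y' (S j))). unfold x', y'.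
    rewrite <- !RtoC_Rsum. rewrite <- RtoC_mult. simpl.
    apply Rmult_le_compat; try (apply Rsum_nonneg; intros; apply Cmod_ge_0);
      apply Rsum_Series; auto; intros; apply Cmod_ge_0.
Qed.

(** The partial sum differs from the product of partial sums by pairs beyond the hyperbola. In such
    a pair one index is at least [M], so the difference is controlled by the tails of the two
    absolute series. *)
Lemma dconv_series x y X Y : ex_series (fun k => Cmod (x (S k))) -> ex_series (fun k => Cmod (y (S k))) ->
  Cser (fun k => x (S k)) X -> Cser (fun k => y (S k)) Y -> Cser (fun n => dconv x y (S n)) (X * Y)%C.
Proof.
  intros Ex Ey HX HY eps He.
  set (mx := fun k => Cmod (x (S k))) in *. set (my := fun k => Cmod (y (S k))) in *.
  assert (Px : forall n, 0 <= mx n) by (intros; apply Cmod_ge_0).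
  assert (Py : forall n, 0 <= my n) by (intros; apply Cmod_ge_0).
  set (A := Series mx). set (B := Series my).
  assert (PA : 0 <= A) by (apply Series_nonneg; auto). assert (PB : 0 <= B) by (apply Series_nonneg; auto).
  set (e := eps / (4 * (A + B + 1))).
  assert (Pe : 0 < e) by (apply Rdiv_lt_0_compat; lra).
  destruct (series_tail_small mx Ex Px e Pe) as [N1 T1]. destruct (series_tail_small my Ey Py e Pe) as [N2 T2].
  set (M := (N1 + N2)%nat).
  assert (TX := T1 M ltac:(unfold M; lia)). assert (TY := T2 M ltac:(unfold M; lia)).
  (* If both zero-based indices are below [M], the product of their successors is at most M^2 <= N;
     the extra [M] covers small cases and gives N >= M. *)
  exists (M * M + M)%nat. intros N HN.
  assert (BX := Cser_tail_bound (fun k => x (S k)) X mx Ex (fun n => Rle_refl _) HX N).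
  assert (BY := Cser_tail_bound (fun k => y (S k)) Y my Ey (fun n => Rle_refl _) HY N).
  assert (TXN := T1 N ltac:(unfold M in HN; nia)). assert (TYN := T2 N ltac:(unfold M in HN; nia)).
  set (sx := Csum (fun k => x (S k)) N) in *. set (sy := Csum (fun k => y (S k)) N) in *.
  assert (Bsx : Cmod sx <= A).
  { eapply Rle_trans; [apply Csum_Cmod|]. apply Rsum_Series; auto. }
  assert (BYY : Cmod Y <= B) by (apply (Cser_bound (fun k => y (S k)) Y my); auto; intros; apply Rle_refl).
  assert (D1 : Cmod (Csum (fun n => dconv x y (S n)) N - sx * sy) <= 2 * e * (A + B)).
  { rewrite dconv_partial. unfold sx, sy. rewrite <- Csum_prod.
    replace (Csum (fun i => Csum (fun j => if Nat.leb (S i * S j) N then x (S i) * y (S j) else RtoC 0)%C N) N -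
       Csum (fun i => Csum (fun j => x (S i) * y (S j))%C N) N)%C
      with (Csum (fun i => Csum (fun j => if Nat.leb (S i * S j) N then RtoC 0 else - (1) * (x (S i) * y (S j)))%C N) N).
    2: { unfold Cminus. replace (- Csum (fun i => Csum (fun j => x (S i) * y (S j))%C N) N)%C
          with (- (1) * Csum (fun i => Csum (fun j => x (S i) * y (S j))%C N) N)%C by ring.
         rewrite <- Csum_scal, <- Csum_plus. apply Csum_ext. intros i _.
         rewrite <- Csum_scal, <- Csum_plus. apply Csum_ext. intros j _. destruct (Nat.leb _ _); ring. }
    set (ix := fun i => if Nat.ltb i M then 0 else mx i). set (iy := fun j => if Nat.ltb j M then 0 else my j).
    apply Rle_trans with (Rsum (fun i => Rsum (fun j => ix i * my j + mx i * iy j) N) N).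
    - eapply Rle_trans; [apply Csum_Cmod|]. apply Rsum_le. intros i _.
      eapply Rle_trans; [apply Csum_Cmod|]. apply Rsum_le. intros j _.
      assert (P0 : 0 <= ix i) by (unfold ix; destruct (Nat.ltb _ _); [lra|auto]).
      assert (P1 : 0 <= iy j) by (unfold iy; destruct (Nat.ltb _ _); [lra|auto]).
      assert (Q1 := Rmult_le_pos _ _ P0 (Py j)). assert (Q2 := Rmult_le_pos _ _ (Px i) P1).
      destruct (Nat.leb_spec (S i * S j) N).
      + rewrite Cmod_0. lra.
      + rewrite Cmod_mult, Cmod_m1, Rmult_1_l, Cmod_mult. fold (mx i) (my j).
        destruct (Nat.ltb_spec i M) as [Li|Li].
        * unfold iy in *. destruct (Nat.ltb_spec j M) as [Lj|Lj]; [nia|]. lra.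
        * unfold ix in *. destruct (Nat.ltb_spec i M); [lia|]. lra.
    - assert (FX : Rsum ix N <= e).
      { replace N with (M + (N - M))%nat by nia. rewrite Rsum_split.
        rewrite (Rsum_ext ix (fun _ => 0 * 0)).
        2: { intros k Hk. unfold ix. destruct (Nat.ltb_spec k M); [ring|lia]. }
        rewrite Rsum_scal, Rmult_0_l, Rplus_0_l.
        rewrite (Rsum_ext _ (fun j => mx (M + j)%nat)).
        2: { intros k _. unfold ix. destruct (Nat.ltb_spec (M + k) M); [lia|auto]. }
        eapply Rle_trans; [apply Rsum_le_tail; auto|auto]. }
      assert (FY : Rsum iy N <= e).
      { replace N with (M + (N - M))%nat by nia. rewrite Rsum_split.
        rewrite (Rsum_ext iy (fun _ => 0 * 0)).
        2: { intros k Hk. unfold iy. destruct (Nat.ltb_spec k M); [ring|lia]. }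
        rewrite Rsum_scal, Rmult_0_l, Rplus_0_l.
        rewrite (Rsum_ext _ (fun j => my (M + j)%nat)).
        2: { intros k _. unfold iy. destruct (Nat.ltb_spec (M + k) M); [lia|auto]. }
        eapply Rle_trans; [apply Rsum_le_tail; auto|auto]. }
      rewrite (Rsum_ext _ (fun i => Rsum my N * ix i + Rsum iy N * mx i)).
      2: { intros i _. rewrite Rsum_plus, !Rsum_scal. ring. }
      rewrite Rsum_plus, !Rsum_scal.
      assert (SX := Rsum_Series mx N Ex Px). assert (SY := Rsum_Series my N Ey Py). fold A in SX. fold B in SY.
      assert (N1' := Rsum_nonneg mx N Px). assert (N2' := Rsum_nonneg my N Py).
      assert (N3 : 0 <= Rsum ix N) by (apply Rsum_nonneg; intros k; unfold ix; destruct (Nat.ltb _ _); [lra|auto]).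
      assert (N4 : 0 <= Rsum iy N) by (apply Rsum_nonneg; intros k; unfold iy; destruct (Nat.ltb _ _); [lra|auto]).
      assert (Rsum my N * Rsum ix N <= B * e) by (apply Rmult_le_compat; auto).
      assert (Rsum iy N * Rsum mx N <= e * A) by (apply Rmult_le_compat; auto).
      assert (0 <= e * (A + B)) by (apply Rmult_le_pos; lra). lra. }
  replace (Csum (fun n => dconv x y (S n)) N - X * Y)%C
    with ((Csum (fun n => dconv x y (S n)) N - sx * sy) + (sx * (sy - Y) + (sx - X) * Y))%C by ring.
  eapply Rle_trans; [apply Cmod_triangle|].
  assert (D2 : Cmod (sx * (sy - Y) + (sx - X) * Y) <= A * e + e * B).
  { eapply Rle_trans; [apply Cmod_triangle|]. rewrite !Cmod_mult.
    apply Rplus_le_compat; apply Rmult_le_compat; try apply Cmod_ge_0; auto; lra. }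
  assert (Ee : e * (A + B + 1) = eps / 4) by (unfold e; field; lra). nra.
Qed.

Lemma cpow_mult d e w : (1 <= d)%nat -> (1 <= e)%nat -> cpow (d * e) w = (cpow d w * cpow e w)%C.
Proof.
  intros Hd He. unfold cpow. rewrite mult_INR, ln_mult by (apply lt_0_INR; lia).
  rewrite <- Cexp_add. f_equal. rewrite RtoC_plus. ring.
Qed.

Lemma dconv_cpow a b w n : dconv (fun d => a d * cpow d w)%C (fun e => b e * cpow e w)%C n = (cpow n w * dconv a b n)%C.
Proof.
  unfold dconv. rewrite <- Csum_scal. apply Csum_ext. intros i _. rewrite <- Csum_scal. apply Csum_ext. intros j _.
  destruct (Nat.eqb_spec (S i * S j) n) as [<-|]; [|ring].
  rewrite cpow_mult by lia. ring.
Qed.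

Lemma Cmod_cpow_neg k s : (1 <= k)%nat -> Cmod (cpow k (- s)) = Rpower (INR k) (- fst s).
Proof. intros Hk. rewrite Cmod_cpow. reflexivity. Qed.

Lemma ex_series_bounded_coef (a : nat -> C) K s : (forall k, Cmod (a (S k)) <= K) -> 1 < fst s ->
  ex_series (fun k => Cmod (a (S k) * cpow (S k) (- s))).
Proof.
  intros Ha Hs.
  apply (ex_series_dominated _ (fun k => K * Rpower (INR (S k)) (- fst s))).
  - intros k. split; [apply Cmod_ge_0|].
    rewrite Cmod_mult, Cmod_cpow_neg by lia. apply Rmult_le_compat_r; auto. left; apply exp_pos.
  - apply (ex_series_scal (V := R_NormedModule)). apply ex_series_power; auto.
Qed.

(** Supplies at once the nonvanishing of zeta for Re s > 1 and a bound for 1/zeta that depends on Re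
    s alone. *)
Lemma zeta_mu zeta s : is_zeta zeta -> 1 < fst s ->
  exists m, Cser (fun k => RtoC (mu (S k)) * cpow (S k) (- s))%C m /\ (zeta s * m)%C = RtoC 1 /\
    Cmod m <= Series (fun k => Rpower (INR (S k)) (- fst s)).
Proof.
  intros Hz Hs.
  assert (Hmu : forall k, Cmod (RtoC (mu (S k)) * cpow (S k) (- s)) <= Rpower (INR (S k)) (- fst s)).
  { intros k. rewrite Cmod_mult, Cmod_R, Cmod_cpow_neg by lia.
    assert (B := mu_bound (S k)). assert (P := exp_pos (- fst s * ln (INR (S k)))).
    rewrite <- (Rmult_1_l (Rpower _ _)) at 2. apply Rmult_le_compat_r; auto. left; exact P. }
  assert (Ep := ex_series_power (fst s) Hs).
  destruct (Cser_dominated _ _ Ep Hmu) as [m [Hm _]].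
  exists m. split; auto. split.
  - assert (H := dconv_series (fun d => RtoC 1 * cpow d (- s))%C (fun d => RtoC (mu d) * cpow d (- s))%C (zeta s) m).
    apply (Cser_unique (fun n => dconv (fun d => RtoC 1 * cpow d (- s))%C (fun d => RtoC (mu d) * cpow d (- s))%C (S n))).
    + apply H; auto.
      * apply (ex_series_bounded_coef (fun _ => RtoC 1) 1); auto. intros; rewrite Cmod_1; lra.
      * apply (ex_series_bounded_coef (fun d => RtoC (mu d)) 1); auto. intros; rewrite Cmod_R; apply mu_bound.
      * eapply Cser_ext; [|apply (proj2 Hz); auto]. intros k; cbv beta; ring.
    + intros eps He. exists 1%nat. intros N HN.
      rewrite (Csum_single _ 0%nat); [|lia|].
      * rewrite dconv_cpow, dconv_one_mu by lia. simpl Nat.eqb. rewrite cpow_1.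
        replace (1 * 1 - 1)%C with (RtoC 0) by ring. rewrite Cmod_0. lra.
      * intros j Hj Nj. rewrite dconv_cpow, dconv_one_mu by lia.
        destruct (Nat.eqb_spec (S j) 1); [lia|ring].
  - apply (Cser_bound _ _ _ Ep Hmu Hm).
Qed.

Lemma zeta_nonzero zeta s : is_zeta zeta -> 1 < fst s -> zeta s <> RtoC 0.
Proof.
  intros Hz Hs E. destruct (zeta_mu zeta s Hz Hs) as [m [_ [H _]]]. rewrite E in H.
  replace (0 * m)%C with (RtoC 0) in H by ring. injection H; lra.
Qed.

Lemma zeta_inv_bound zeta s : is_zeta zeta -> 1 < fst s -> Cmod (/ zeta s) <= Series (fun k => Rpower (INR (S k)) (- fst s)).
Proof.
  intros Hz Hs. assert (N := zeta_nonzero zeta s Hz Hs). destruct (zeta_mu zeta s Hz Hs) as [m [_ [H B]]].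
  replace (/ zeta s)%C with m; auto.
  replace m with (/ zeta s * (zeta s * m))%C by (field; auto). rewrite H. ring.
Qed.

(** * The Dirichlet series of sigma / zeta *)

Definition sigma_at (beta n : nat) (s : C) : C := sigma_beta beta (RtoC 1 - s / RtoC (INR beta)) n.

Lemma pow_part_large beta n m : (1 <= beta)%nat -> (1 <= n)%nat -> (n < m)%nat -> pow_part beta n m = 0.
Proof.
  intros Hb Hn Hm. unfold pow_part. destruct (dvdb (m ^ beta) n) eqn:E; auto. exfalso.
  assert (Lb : (m <= m ^ beta)%nat) by (rewrite <- (Nat.pow_1_r m) at 1; apply Nat.pow_le_mono_r; lia).
  apply dvdb_true in E; [|lia]. apply Nat.divide_pos_le in E; lia.
Qed.

Lemma pow_part_nonneg beta n m : 0 <= pow_part beta n m.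
Proof. unfold pow_part. destruct (dvdb _ _); [apply pos_INR|lra]. Qed.

Lemma cpow_shift beta d s : (1 <= beta)%nat -> (1 <= d)%nat ->
  cpow d (RtoC (INR beta) * (1 - s / RtoC (INR beta))) = (RtoC (INR (d ^ beta)) * cpow d (- s))%C.
Proof.
  intros Hb Hd. unfold cpow.
  assert (Pb : 0 < INR beta) by (apply lt_0_INR; lia). assert (Pd : 0 < INR d) by (apply lt_0_INR; lia).
  assert (Nb : RtoC (INR beta) <> RtoC 0) by (apply RtoC_neq; lra).
  replace (RtoC (INR beta) * (1 - s / RtoC (INR beta)) * RtoC (ln (INR d)))%C
    with (RtoC (INR beta * ln (INR d)) + - s * RtoC (ln (INR d)))%C by (rewrite RtoC_mult; field; auto).
  rewrite Cexp_add, Cexp_R. f_equal. f_equal. rewrite pow_INR, <- Rpower_pow by auto. reflexivity.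
Qed.

Lemma sigma_at_sum beta n s : (1 <= beta)%nat -> (1 <= n)%nat ->
  sigma_at beta n s = Csum (fun k => RtoC (pow_part beta n (S k)) * cpow (S k) (- s))%C n.
Proof.
  intros Hb Hn. unfold sigma_at, sigma_beta. rewrite csum_filter_seq. apply Csum_ext. intros k _.
  change (1 + k)%nat with (S k). unfold pow_part. destruct (dvdb (S k ^ beta) n); [|ring].
  apply cpow_shift; lia.
Qed.

Lemma sigma_at_series beta n s : (1 <= beta)%nat -> (1 <= n)%nat ->
  Cser (fun k => RtoC (pow_part beta n (S k)) * cpow (S k) (- s))%C (sigma_at beta n s).
Proof.
  intros Hb Hn eps He. exists n. intros N HN. rewrite sigma_at_sum by auto.
  replace N with (n + (N - n))%nat by lia. rewrite Csum_split.
  rewrite (Csum_ext (fun j => RtoC (pow_part beta n (S (n + j))) * cpow (S (n + j)) (- s))%C (fun _ => RtoC 0)).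
  - rewrite Csum_zero. rewrite Cplus_0_r. replace (_ - _)%C with (RtoC 0) by ring. rewrite Cmod_0. lra.
  - intros j _. rewrite pow_part_large by lia. ring.
Qed.

Lemma pow_part_bound beta n m : (1 <= n)%nat -> (1 <= m)%nat -> pow_part beta n m <= INR n.
Proof.
  intros Hn Hm. unfold pow_part. destruct (dvdb (m ^ beta) n) eqn:E; [|apply pos_INR].
  apply le_INR. apply dvdb_true in E; [|apply Nat.neq_0_lt_0, Nat.pow_nonzero; lia].
  apply Nat.divide_pos_le in E; lia.
Qed.

(** The finite Dirichlet series of sigma is multiplied by that of 1/zeta; [c_beta_convolution]
    identifies the coefficients of the product. *)
Theorem c_beta_dirichlet zeta beta n s : is_zeta zeta -> (1 <= beta)%nat -> (1 <= n)%nat -> 1 < fst s ->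
  ex_series (fun k => Cmod (c_beta beta (S k) n * cpow (S k) (- s))) /\
  Cser (fun k => c_beta beta (S k) n * cpow (S k) (- s))%C (sigma_at beta n s * / zeta s)%C.
Proof.
  intros Hz Hb Hn Hs.
  destruct (zeta_mu zeta s Hz Hs) as [m [Hm [Em _]]].
  assert (NZ := zeta_nonzero zeta s Hz Hs).
  assert (E : m = (/ zeta s)%C).
  { replace m with (/ zeta s * (zeta s * m))%C by (field; auto). rewrite Em. ring. }
  set (x := fun d => (RtoC (pow_part beta n d) * cpow d (- s))%C). set (y := fun d => (RtoC (mu d) * cpow d (- s))%C).
  assert (Ex : ex_series (fun k => Cmod (x (S k)))).
  { apply (ex_series_bounded_coef (fun d => RtoC (pow_part beta n d)) (INR n)); auto.
    intros k. rewrite Cmod_R, Rabs_pos_eq by apply pow_part_nonneg. apply pow_part_bound; lia. }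
  assert (Ey : ex_series (fun k => Cmod (y (S k)))).
  { apply (ex_series_bounded_coef (fun d => RtoC (mu d)) 1); auto. intros; rewrite Cmod_R; apply mu_bound. }
  assert (Ec : forall k, (c_beta beta (S k) n * cpow (S k) (- s))%C = dconv x y (S k)).
  { intros k. unfold x, y. rewrite dconv_cpow, c_beta_convolution by lia. ring. }
  split.
  - eapply ex_series_ext; [|apply (dconv_abs_series x y Ex Ey)]. intros k. cbv beta. rewrite Ec. auto.
  - eapply Cser_ext; [intros k; symmetry; apply Ec|]. rewrite <- E.
    apply dconv_series; auto. apply sigma_at_series; auto.
Qed.

(** * The quotient sigma / zeta on vertical lines *)


(* [chi] is finite at [1 - s], so the nonvanishing of [zeta (1 - s)] passes to [zeta s]. *)
Lemma zeta_nonzero_left zeta (s : C) : is_zeta zeta -> fst s < 0 -> snd s <> 0 -> zeta s <> RtoC 0.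
Proof.
  intros Hz Hs Hi E.
  assert (FE := functional_equation zeta (1 - s)%C Hz ltac:(simpl; lra)).
  assert (N := zeta_nonzero zeta (1 - s)%C Hz ltac:(simpl; lra)).
  apply N. rewrite FE.
  - replace (1 - (1 - s))%C with s by ring. rewrite E. ring.
  - intros E2. apply (f_equal snd) in E2. simpl in E2. lra.
  - intros j E2. apply (f_equal snd) in E2. simpl in E2. lra.
Qed.

Lemma zetaW_zero_iff zeta (s : C) : is_zeta zeta -> -1 < fst s -> zetaW s = RtoC 0 <-> (s <> RtoC 1 /\ zeta s = RtoC 0).
Proof.
  intros Hz Hs. split.
  - intros E. assert (N : s <> RtoC 1).
    { intros ->. rewrite zetaW_1 in E. injection E; lra. }
    split; auto. rewrite <- (zeta_W zeta s Hz Hs N) in E.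
    replace (zeta s) with (/ (s - 1) * ((s - 1) * zeta s))%C by (field; apply Cminus_neq; auto).
    rewrite E. ring.
  - intros [N E]. rewrite <- (zeta_W zeta s Hz Hs N), E. ring.
Qed.

Lemma zetaW_left_line zeta y : is_zeta zeta -> zetaW (- (1 / 2), y) <> RtoC 0.
Proof.
  intros Hz E. destruct (Req_dec y 0) as [->|Ny].
  - apply (zetaW_real (- (1 / 2))); auto. lra.
  - apply (zetaW_zero_iff zeta) in E; auto; [|simpl; lra].
    apply (zeta_nonzero_left zeta (- (1 / 2), y)); auto; simpl; try lra. apply E.
Qed.

Lemma zetaW_right zeta (s : C) : is_zeta zeta -> 1 < fst s -> zetaW s <> RtoC 0.
Proof.
  intros Hz Hs E. apply (zetaW_zero_iff zeta) in E; auto; [|lra].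
  apply (zeta_nonzero zeta s); auto. apply E.
Qed.

Lemma sigma_at_hol beta n s : (1 <= beta)%nat -> (1 <= n)%nat -> Chol (sigma_at beta n) s.
Proof.
  intros Hb Hn.
  apply (Chol_ext (fun s => Csum (fun k => RtoC (pow_part beta n (S k)) * cpow (S k) (- s))%C n)).
  { intros w. rewrite sigma_at_sum; auto. }
  assert (G : forall N, Chol (fun s => Csum (fun k => RtoC (pow_part beta n (S k)) * cpow (S k) (- s))%C N) s).
  { induction N; simpl; [apply Chol_const|]. apply Chol_plus; auto. apply Chol_mult; [apply Chol_const|].
    unfold cpow. apply Chol_Cexp. apply Chol_mult; [|apply Chol_const]. apply Chol_opp, Chol_id. }
  apply G.
Qed.

Lemma sigma_at_bound beta n : (1 <= beta)%nat -> (1 <= n)%nat -> exists H, 0 <= H /\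
  forall s, - (2) <= fst s <= 2 -> Cmod (sigma_at beta n s) <= H.
Proof.
  intros Hb Hn. exists (Rsum (fun k => pow_part beta n (S k) * exp (2 * ln (INR (S k)))) n). split.
  - apply Rsum_nonneg. intros k. apply Rmult_le_pos; [apply pow_part_nonneg|left; apply exp_pos].
  - intros s Hs. rewrite sigma_at_sum by auto. eapply Rle_trans; [apply Csum_Cmod|]. apply Rsum_le.
    intros k _. rewrite Cmod_mult, Cmod_R, Rabs_pos_eq by apply pow_part_nonneg.
    apply Rmult_le_compat_l; [apply pow_part_nonneg|]. rewrite Cmod_cpow. apply exp_mono.
    apply Rmult_le_compat_r; [|simpl; lra]. rewrite <- ln_1. apply ln_le; [lra|].
    replace 1 with (INR 1) by auto. apply le_INR. lia.
Qed.

(* [sigma/zeta], with the removable zero of [1/zeta] at [s = 1] filled in. *)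
Definition quot (beta n : nat) (s : C) : C := (sigma_at beta n s * ((s - 1) * / zetaW s))%C.

Lemma quot_hol beta n s : (1 <= beta)%nat -> (1 <= n)%nat -> -1 < fst s -> zetaW s <> RtoC 0 -> Chol (quot beta n) s.
Proof.
  intros Hb Hn Hs N. unfold quot. apply Chol_mult; [apply sigma_at_hol; auto|].
  apply Chol_mult; [apply Chol_minus; [apply Chol_id|apply Chol_const]|].
  apply Chol_inv; auto. apply zetaW_hol; auto.
Qed.

Lemma inv_zeta_W zeta (s : C) : is_zeta zeta -> -1 < fst s -> s <> RtoC 1 -> ((s - 1) * / zetaW s)%C = (/ zeta s)%C.
Proof.
  intros Hz Hs N. assert (N' := Cminus_neq _ _ N). rewrite <- (zeta_W zeta s Hz Hs N).
  (* At a zero of [zeta] both sides are 0 by the convention for [Cinv]. *)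
  destruct (classic (zeta s = RtoC 0)) as [E|NE].
  - rewrite E. replace ((s - 1) * 0)%C with (RtoC 0) by ring. rewrite Cinv_0. ring.
  - field. auto.
Qed.

Lemma quot_zeta zeta beta n s : is_zeta zeta -> -1 < fst s -> s <> RtoC 1 -> quot beta n s = (sigma_at beta n s * / zeta s)%C.
Proof. intros. unfold quot. rewrite (inv_zeta_W zeta); auto. Qed.

Definition left_line (beta n : nat) (y : R) : C := quot beta n (- (1 / 2), y).
Definition right_line (beta n : nat) (y : R) : C := quot beta n ((3 / 2)%R, y).

(** On Re s = 3/2 every odd integer is at distance at least 1/2, so [Lfun] is bounded and only the
    factor s(s+1) grows. The sign of [y] anticipates the reflection to Re s = -1/2. *)
Lemma chi_bound_line : exists K, 0 <= K /\ forall y, 0 <= y -> Cmod (chi ((3 / 2)%R, (- y)%R)) <= K * ((3 + y) * (3 + y)).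
Proof.
  set (Sc := Series (fun j => Cmod (cos_coef j))).
  assert (PS : 0 <= Sc) by (apply Series_nonneg; [apply ex_series_cos_coef|intros; apply Cmod_ge_0]).
  assert (Ppi := PI_RGT_0).
  exists (/ PI * exp (3 / 2 * ln (2 * PI)) * (1 + 1 + / (1 / 2) * Sc)).
  assert (P0 : 0 < / PI) by (apply Rinv_0_lt_compat; auto).
  assert (P1 := exp_pos (3 / 2 * ln (2 * PI))).
  split.
  { apply Rmult_le_pos; [apply Rmult_le_pos; lra|]. assert (0 <= / (1 / 2) * Sc) by (apply Rmult_le_pos; lra). lra. }
  intros y Hy. set (w := ((3 / 2)%R, (- y)%R) : C).
  assert (Hw : 3 / 2 <= Cmod w).
  { eapply Rle_trans; [|apply fst_le_Cmod]. unfold w; simpl. rewrite Rabs_pos_eq; lra. }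
  assert (Hw1 : 5 / 2 <= Cmod (w + 1)).
  { eapply Rle_trans; [|apply fst_le_Cmod]. unfold w; simpl. rewrite Rabs_pos_eq; lra. }
  assert (A1 : Cmod w <= 3 + y).
  { eapply Rle_trans; [apply Cmod_le_abs|]. unfold w; simpl. rewrite Rabs_Ropp, !Rabs_pos_eq; lra. }
  assert (A2 : Cmod (w + 1) <= 3 + y).
  { eapply Rle_trans; [apply Cmod_le_abs|]. unfold w; simpl.
    rewrite (Rabs_pos_eq (3 / 2 + 1)) by lra. replace (- y + 0) with (- y) by ring. rewrite Rabs_Ropp, Rabs_pos_eq; lra. }
  assert (HL : Cmod (Lfun w) <= 1 + 1 + / (1 / 2) * Sc).
  { unfold Lfun.
    assert (B1 := Lap_bound cosexp 1 0 (w + 1)%C cosexp_ebound ltac:(simpl; lra)).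
    assert (B1' : 1 / (fst (w + 1)%C - 0) <= 1) by (simpl; apply Rle_div_l; lra).
    assert (B2 : Cmod (/ (w + 1)) <= / (5 / 2)) by (apply Cinv_bound; lra).
    assert (B3 : Cmod (Polar cos_coef odd_pole w) <= / (1 / 2) * Sc).
    { apply polar_bound; [apply ex_series_cos_coef|]. split; [lra|]. intros k _.
      eapply Rle_trans; [|apply fst_le_Cmod]. unfold w, odd_pole. simpl.
      destruct k.
      - simpl. rewrite Rabs_pos_eq; lra.
      - rewrite S_INR. assert (Z := pos_INR k). rewrite Rabs_left1; lra. }
    eapply Rle_trans; [apply Cmod_triangle|]. rewrite Cmod_opp. apply Rplus_le_compat; auto.
    eapply Rle_trans; [apply Cmod_triangle|]. rewrite Cmod_opp. lra. }
  unfold chi. rewrite !Cmod_mult, Cmod_opp, Cmod_Cexp. unfold Cdiv. rewrite !Cmod_mult.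
  rewrite Cmod_inv, Cmod_R, (Rabs_pos_eq PI) by (try lra; apply RtoC_neq; lra).
  replace (fst (w * RtoC (ln (2 * PI)))%C) with (3 / 2 * ln (2 * PI)) by (unfold w; simpl; ring).
  replace (/ PI * exp (3 / 2 * ln (2 * PI)) * (1 + 1 + / (1 / 2) * Sc) * ((3 + y) * (3 + y)))
    with ((3 + y) * (3 + y) * / PI * exp (3 / 2 * ln (2 * PI)) * (1 + 1 + / (1 / 2) * Sc)) by ring.
  assert (G := Cmod_ge_0).
  repeat apply Rmult_le_compat; auto; try lra; repeat apply Rmult_le_pos; auto; lra.
Qed.

(** Reflection to w = 1 - s gives 1/zeta(s) = chi(w)/zeta(w), of at most quadratic growth. Any c > 0
    absorbs this, hence the transform at -iz exists for every z in the upper half-plane. *)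
Lemma left_line_ebound zeta beta n c : is_zeta zeta -> (1 <= beta)%nat -> (1 <= n)%nat -> 0 < c ->
  exists M, ebound (left_line beta n) M c.
Proof.
  intros Hz Hb Hn Hc.
  destruct (sigma_at_bound beta n Hb Hn) as [H [PH HH]].
  destruct chi_bound_line as [K [PK HK]].
  set (Z := Series (fun k => Rpower (INR (S k)) (- (3 / 2)))).
  exists (H * (K * Z) * (2 / (c * c) * exp (c * 3))). split.
  - intros t. apply ver_cont. apply Chol_cont, quot_hol; auto; [simpl; lra|]. apply (zetaW_left_line zeta); auto.
  - intros y Hy. unfold left_line.
    set (s := (- (1 / 2), y) : C). set (w := ((3 / 2)%R, (- y)%R) : C).
    assert (Ew : (1 - w)%C = s) by (unfold w, s; apply C_ext; simpl; field).
    assert (Ns : s <> RtoC 1) by (unfold s; intros E; injection E; intros; lra).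
    rewrite (quot_zeta zeta); auto; [|simpl; lra].
    assert (FE := functional_equation zeta w Hz ltac:(simpl; lra)).
    assert (FE' : zeta w = (chi w * zeta s)%C).
    { rewrite <- Ew. apply FE.
      - unfold w; intros E; injection E; intros; lra.
      - intros j E. apply (f_equal fst) in E. unfold w, odd_pole in E. simpl in E.
        destruct j; [simpl in E; lra|]. rewrite S_INR in E. assert (P := pos_INR j). lra. }
    assert (Nw := zeta_nonzero zeta w Hz ltac:(simpl; lra)).
    assert (Nz : zeta s <> RtoC 0) by (intros E; apply Nw; rewrite FE', E; ring).
    assert (Nc : chi w <> RtoC 0) by (intros E; apply Nw; rewrite FE', E; ring).
    replace (/ zeta s)%C with (chi w * / zeta w)%C by (rewrite FE'; field; auto).
    rewrite !Cmod_mult.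
    assert (B1 := HH s ltac:(simpl; lra)). assert (B2 := HK y Hy).
    assert (B3 := zeta_inv_bound zeta w Hz ltac:(simpl; lra)). simpl fst in B3. fold Z in B3.
    assert (B4 := sq_le_exp c (3 + y) Hc ltac:(lra)).
    replace (c * (3 + y)) with (c * 3 + c * y) in B4 by ring. rewrite exp_plus in B4.
    assert (G := Cmod_ge_0).
    assert (PZ : 0 <= Z) by (eapply Rle_trans; [apply G|apply B3]).
    apply Rle_trans with (H * (K * ((3 + y) * (3 + y)) * Z)).
    + apply Rmult_le_compat; auto; [apply Rmult_le_pos; auto|]. apply Rmult_le_compat; auto.
    + replace (H * (K * Z) * (2 / (c * c) * exp (c * 3)) * exp (c * y)) with (H * (K * (2 / (c * c) * (exp (c * 3) * exp (c * y))) * Z)) by ring.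
      apply Rmult_le_compat_l; auto. apply Rmult_le_compat_r; auto. apply Rmult_le_compat_l; auto.
Qed.

(** * The right half-line and the series of simple fractions *)

Definition gcoef (beta n k : nat) : C := (c_beta beta (S k) n * / RtoC (Rpower (INR (S k)) (3 / 2)))%C.
Definition gpole (k : nat) : C := RtoC (ln (INR (S k))).

Lemma Cinv_mult_total (a b : C) : (/ (a * b))%C = (/ a * / b)%C.
Proof.
  destruct (classic (a = RtoC 0)) as [->|Na].
  - replace (0 * b)%C with (RtoC 0) by ring. rewrite Cinv_0. ring.
  - destruct (classic (b = RtoC 0)) as [->|Nb].
    + replace (a * 0)%C with (RtoC 0) by ring. rewrite Cinv_0. ring.
    + field. auto.
Qed.

Lemma pole_term_eq beta n k z : pole_term beta n (S k) z = (gcoef beta n k * / (z - gpole k))%C.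
Proof. unfold pole_term, gcoef, gpole. rewrite Cinv_mult_total. ring. Qed.

Lemma gcoef_cpow beta n k y : (c_beta beta (S k) n * cpow (S k) (- ((3 / 2)%R, y)))%C =
  (gcoef beta n k * Cexp (- (Ci * gpole k) * RtoC y))%C.
Proof.
  unfold gcoef, gpole. rewrite <- Cmult_assoc. f_equal. unfold cpow.
  set (L := ln (INR (S k))).
  replace (- ((3 / 2)%R, y) * RtoC L)%C with (- RtoC (3 / 2 * L) + - (Ci * RtoC L) * RtoC y)%C by (apply C_ext; simpl; ring).
  rewrite Cexp_add, Cexp_opp, Cexp_R. reflexivity.
Qed.

Lemma gcoef_series zeta beta n : is_zeta zeta -> (1 <= beta)%nat -> (1 <= n)%nat -> ex_series (fun k => Cmod (gcoef beta n k)).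
Proof.
  intros Hz Hb Hn. destruct (c_beta_dirichlet zeta beta n ((3 / 2)%R, 0) Hz Hb Hn ltac:(simpl; lra)) as [H _].
  eapply ex_series_ext; [|exact H]. intros k. cbv beta. rewrite gcoef_cpow.
  replace (- (Ci * gpole k) * RtoC 0)%C with (RtoC 0) by ring. rewrite Cexp_0, Cmult_1_r. auto.
Qed.

(** The terms of the Dirichlet series have modulus independent of [y], so one tail bounds the error
    on the whole line. The second conclusion has the form that [lap_series] asks for. *)
Lemma right_line_ebound zeta beta n : is_zeta zeta -> (1 <= beta)%nat -> (1 <= n)%nat ->
  ebound (right_line beta n) (Series (fun k => Cmod (gcoef beta n k))) 0 /\
  forall N y, Cmod (right_line beta n y - Csum (fun k => gcoef beta n k * Cexp (- (Ci * gpole k) * RtoC y))%C N)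
    <= series_tail (fun k => Cmod (gcoef beta n k)) N.
Proof.
  intros Hz Hb Hn. assert (Eg := gcoef_series zeta beta n Hz Hb Hn).
  assert (T : forall y N, Cmod (right_line beta n y - Csum (fun k => gcoef beta n k * Cexp (- (Ci * gpole k) * RtoC y))%C N)
    <= series_tail (fun k => Cmod (gcoef beta n k)) N).
  { intros y N. rewrite Cmod_sym. unfold right_line. rewrite (quot_zeta zeta); auto; [|simpl; lra|].
    2: { intros E. injection E; intros; lra. }
    apply Cser_tail_bound; auto.
    - intros k. rewrite Cmod_mult, Cmod_Cexp.
      replace (fst (- (Ci * gpole k) * RtoC y)%C) with 0 by (unfold gpole; simpl; ring).
      rewrite exp_0. lra.
    - destruct (c_beta_dirichlet zeta beta n ((3 / 2)%R, y) Hz Hb Hn ltac:(simpl; lra)) as [_ H].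
      eapply Cser_ext; [|exact H]. intros k. apply gcoef_cpow. }
  split; auto. split.
  - intros t. apply ver_cont. apply Chol_cont, quot_hol; auto; [simpl; lra|]. apply (zetaW_right zeta); auto. simpl; lra.
  - intros y _. rewrite Rmult_0_l, exp_0, Rmult_1_r. assert (K := T y 0%nat). simpl Csum in K.
    rewrite series_tail_0 in K. replace (right_line beta n y - 0)%C with (right_line beta n y) in K by ring. auto.
Qed.

Definition Gfun (beta n : nat) (z : C) : C := Polar (gcoef beta n) gpole z.

(** At w = -iz the transform of e^(-i y log q) is 1/(w + i log q) = i/(z - log q), and the factor i
    from ds = i dy makes the sign negative. *)
Lemma right_line_laplace zeta beta n z : is_zeta zeta -> (1 <= beta)%nat -> (1 <= n)%nat -> 0 < snd z ->
  (Ci * Lap (right_line beta n) (- (Ci * z)))%C = (- Gfun beta n z)%C.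
Proof.
  intros Hz Hb Hn Hi. destruct (right_line_ebound zeta beta n Hz Hb Hn) as [HB HT].
  set (w := (- (Ci * z))%C). assert (Hw : 0 < fst w) by (unfold w; simpl; lra).
  assert (H := lap_series (fun k y => gcoef beta n k * Cexp (- (Ci * gpole k) * RtoC y))%C _ _ 0 (series_tail (fun k => Cmod (gcoef beta n k))) w HB Hw).
  assert (F0 : forall k, fst (- (Ci * gpole k))%C = 0) by (intros k; unfold gpole; simpl; ring).
  assert (H' : Cser (fun k => Lap (fun y => gcoef beta n k * Cexp (- (Ci * gpole k) * RtoC y))%C w) (Lap (right_line beta n) w)).
  { apply H.
    - intros k. exists (Cmod (gcoef beta n k) * 1). apply ebound_scal. rewrite <- (F0 k). apply ebound_exp.
    - apply series_tail_small; [apply (gcoef_series zeta); auto|intros; apply Cmod_ge_0].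
    - intros N t _. rewrite Rmult_0_l, exp_0, Rmult_1_r. apply HT. }
  unfold Gfun. rewrite (Polar_unique _ _ _ (- Ci * Lap (right_line beta n) w)%C); [ring|].
  eapply Cser_ext; [|apply (Cser_scal (- Ci)%C _ _ H')]. intros k. cbv beta.
  assert (Hk : fst (- (Ci * gpole k))%C < fst w) by (rewrite F0; auto).
  rewrite (Lap_unique _ _ _ (is_lap_scal (gcoef beta n k) _ _ _ (fun t => exp_C_cont _ t) (is_lap_exp _ _ Hk))).
  assert (N : (z - gpole k)%C <> RtoC 0).
  { intros E. apply (f_equal snd) in E. unfold gpole in E. simpl in E. lra. }
  assert (Eq : (w - - (Ci * gpole k))%C = (- Ci * (z - gpole k))%C) by (unfold w; ring).
  rewrite Eq.
  assert (NCi : Ci <> RtoC 0) by (intros E; injection E; lra).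
  assert (NCi' : (- Ci)%C <> RtoC 0) by (intros E; injection E; lra).
  rewrite Cinv_mult_total. replace (- Ci * (gcoef beta n k * (/ - Ci * / (z - gpole k))))%C
    with ((- Ci * / - Ci) * (gcoef beta n k * / (z - gpole k)))%C by ring.
  rewrite Cinv_r by auto. ring.
Qed.

(** * The left half-line and the real segment *)

(** On s = -1/2 + iy one has e^(sz) = e^(-z/2) e^(-(-iz)y) and ds = i dy; the minus sign accounts
    for the downward direction. *)
Definition varpi1_fun (beta n : nat) (z : C) : C :=
  (- (Ci * Cexp (RtoC (- (1 / 2)) * z) * Lap (left_line beta n) (- (Ci * z))))%C.

Lemma varpi1_hol zeta beta n z : is_zeta zeta -> (1 <= beta)%nat -> (1 <= n)%nat -> 0 < snd z -> Chol (varpi1_fun beta n) z.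
Proof.
  intros Hz Hb Hn Hi. destruct (left_line_ebound zeta beta n (snd z / 2) Hz Hb Hn ltac:(lra)) as [M HM].
  unfold varpi1_fun. apply Chol_opp. apply Chol_mult; [apply Chol_mult; [apply Chol_const|]|].
  - apply Chol_Cexp, Chol_mult; [apply Chol_const|apply Chol_id].
  - apply (Chol_comp (Lap (left_line beta n)) (fun z => - (Ci * z))%C).
    + eapply lap_holomorphic; [exact HM|]. simpl. lra.
    + apply Chol_opp, Chol_mult; [apply Chol_const|apply Chol_id].
Qed.

Lemma vertical_exp (x y : R) (z : C) : Cexp ((x, y) * z) = (Cexp (RtoC x * z) * Cexp (- (- (Ci * z) * RtoC y)))%C.
Proof. rewrite <- Cexp_add. f_equal. apply C_ext; simpl; ring. Qed.

(** The argument of [lap_holomorphic] on a compact interval: |t| is bounded by [r] there, so no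
    restriction on [z] arises and the result is entire. *)
Lemma segment_transform_hol (a : R -> C) (p q : R) z : p <= q -> (forall t, p <= t <= q -> curve_cont a t) ->
  Chol (fun z => CI (fun t => a t * Cexp (RtoC t * z))%C p q) z.
Proof.
  intros Hpq Ha. destruct (edge_bounded a p q Ha) as [A HA].
  set (r := Rabs p + Rabs q).
  assert (Hr : forall t, p <= t <= q -> Rabs t <= r).
  { intros t Ht. unfold r. assert (P1 := Rle_abs q). assert (P2 := Rle_abs (- p)). rewrite Rabs_Ropp in P2.
    assert (P3 := Rabs_pos q). assert (P4 := Rabs_pos p). apply Rabs_le. lra. }
  assert (Pr : 0 <= r) by (assert (P3 := Rabs_pos q); assert (P4 := Rabs_pos p); unfold r; lra).
  assert (Ex : forall b : R -> C, (forall t, p <= t <= q -> curve_cont b t) -> ex_CI b p q).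
  { intros b Hb. apply ex_CI_cont. rewrite Rmin_left, Rmax_right by auto. auto. }
  assert (Ce : forall w t, curve_cont (fun t => Cexp (RtoC t * w)) t).
  { intros w t. apply cont_Cexp, cont_mult; [apply RtoC_cont|apply cont_const]. }
  exists (CI (fun t => RtoC t * (a t * Cexp (RtoC t * z)))%C p q).
  apply (Cder_quadratic _ _ _ ((q - p) * (A * exp (r * Cmod z) * (r * r * exp r))) 1); [lra|].
  intros w Hw. set (h := (w - z)%C) in *.
  assert (Ex1 : forall w, ex_CI (fun t => a t * Cexp (RtoC t * w))%C p q).
  { intros v. apply Ex. intros t Ht. apply cont_mult; auto. }
  assert (Ex2 : ex_CI (fun t => RtoC t * (a t * Cexp (RtoC t * z)))%C p q).
  { apply Ex. intros t Ht. apply cont_mult; [apply RtoC_cont|]. apply cont_mult; auto. }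
  replace (CI (fun t => a t * Cexp (RtoC t * w))%C p q - CI (fun t => a t * Cexp (RtoC t * z))%C p q
     - CI (fun t => RtoC t * (a t * Cexp (RtoC t * z)))%C p q * h)%C
    with (CI (fun t => (a t * Cexp (RtoC t * w) - a t * Cexp (RtoC t * z)) - h * (RtoC t * (a t * Cexp (RtoC t * z))))%C p q).
  2: { rewrite CI_minus, CI_minus, CI_scal; auto.
       - ring.
       - apply Ex. intros t Ht. apply cont_minus; apply cont_mult; auto.
       - apply ex_CI_scal; auto. }
  replace ((q - p) * (A * exp (r * Cmod z) * (r * r * exp r)) * (Cmod h * Cmod h))
    with ((q - p) * (A * exp (r * Cmod z) * (r * r * exp r) * (Cmod h * Cmod h))) by ring.
  apply CI_bound; auto.
  - apply Ex. intros t Ht. apply cont_minus; [apply cont_minus; apply cont_mult; auto|].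
    apply cont_mult; [apply cont_const|]. apply cont_mult; [apply RtoC_cont|]. apply cont_mult; auto.
  - intros t Ht.
    replace (a t * Cexp (RtoC t * w) - a t * Cexp (RtoC t * z) - h * (RtoC t * (a t * Cexp (RtoC t * z))))%C
      with (a t * Cexp (RtoC t * z) * (Cexp (RtoC t * h) - 1 - RtoC t * h))%C.
    2: { replace (Cexp (RtoC t * w)) with (Cexp (RtoC t * z) * Cexp (RtoC t * h))%C; [ring|].
         rewrite <- Cexp_add. f_equal. unfold h. ring. }
    assert (HRt := Hr t Ht). assert (G := Cmod_ge_0).
    assert (Eq := Cexp_quadratic (RtoC t * h)). rewrite Cmod_mult, Cmod_R in Eq.
    rewrite !Cmod_mult, Cmod_Cexp.
    replace (A * exp (r * Cmod z) * (r * r * exp r) * (Cmod h * Cmod h))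
      with (A * exp (r * Cmod z) * ((r * Cmod h) * (r * Cmod h) * exp r)) by ring.
    assert (Rt := Rabs_pos t).
    assert (PP : 0 <= Rabs t * Cmod h <= r * Cmod h).
    { split; [apply Rmult_le_pos; auto|apply Rmult_le_compat_r; auto]. }
    apply Rmult_le_compat; auto.
    + apply Rmult_le_pos; auto. left; apply exp_pos.
    + apply Rmult_le_compat; auto. left; apply exp_pos.
      apply exp_mono. simpl. replace (t * fst z - 0 * snd z) with (t * fst z) by ring.
      apply Rle_trans with (Rabs (t * fst z)); [apply Rle_abs|]. rewrite Rabs_mult.
      apply Rmult_le_compat; auto; [apply Rabs_pos|apply fst_le_Cmod].
    + eapply Rle_trans; [exact Eq|]. apply Rmult_le_compat.
      * apply Rmult_le_pos; apply PP.
      * left; apply exp_pos.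
      * apply Rmult_le_compat; apply PP.
      * apply exp_mono. apply Rle_trans with (r * Cmod h); [apply PP|].
        rewrite <- (Rmult_1_r r) at 2. apply Rmult_le_compat_l; lra.
Qed.

(** * Simple zeros: residues and finiteness *)

(** By Caratheodory's form f(s) = phi(s)(s - p) with phi continuous and phi(p) = l, so (s - p)
    k(s)/f(s) equals k(s)/phi(s) near [p]. *)
Lemma resid_simple_zero f k p l : Cder f p l -> l <> RtoC 0 -> f p = RtoC 0 -> Ccont k p ->
  resid (fun s => k s * / f s)%C p (k p * / l)%C.
Proof.
  intros Hf Hl H0 Hk. apply Cder_cara in Hf. destruct Hf as [phi [E [Hc Hp]]]. subst l.
  assert (Hq : Ccont (fun s => k s * / phi s)%C p).
  { apply (cont_mult (T := C_UniformSpace)); auto. apply (cont_inv (T := C_UniformSpace)); auto. }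
  destruct (Ccont_neq0 _ _ Hc Hl) as [d1 [Hd1 Hn]]. rewrite Ccont_iff in Hq.
  intros eps He. destruct (Hq eps He) as [d [Hd Hw]].
  exists (Rmin d1 d). split; [apply Rmin_pos; auto|]. intros s [S1 S2].
  assert (Ns : (s - p)%C <> RtoC 0) by (intros E; rewrite E, Cmod_0 in S1; lra).
  assert (Nphi := Hn s (Rlt_le_trans _ _ _ S2 (Rmin_l _ _))).
  assert (K := Hw s (Rlt_le_trans _ _ _ S2 (Rmin_r _ _))).
  assert (Es : f s = (phi s * (s - p))%C) by (rewrite <- Hp, H0; ring).
  rewrite Es. replace ((s - p) * (k s * / (phi s * (s - p))) - k p * / phi p)%C with (k s * / phi s - k p * / phi p)%C.
  - left; auto.
  - field. auto.
Qed.

(** Close to [p] the error of the linear approximation is at most |l| |w - p| / 2, so |f(w)| is at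
    least that much. *)
Lemma simple_zero_isolated f p l : Cder f p l -> l <> RtoC 0 -> f p = RtoC 0 ->
  exists d, 0 < d /\ forall w, Cmod (w - p) < d -> f w = RtoC 0 -> w = p.
Proof.
  intros Hf Hl H0. assert (Pl := Cmod_pos _ Hl).
  destruct (Hf (Cmod l / 2) ltac:(lra)) as [d [Hd Hw]]. exists d. split; auto.
  intros w Bw E. specialize (Hw w Bw). rewrite E, H0 in Hw.
  replace (0 - 0 - l * (w - p))%C with (- (l * (w - p)))%C in Hw by ring.
  rewrite Cmod_opp, Cmod_mult in Hw. apply Cmod_minus_0.
  assert (G := Cmod_ge_0 (w - p)). destruct (Rle_lt_or_eq_dec _ _ G) as [P|P]; auto.
  assert (Cmod l / 2 * Cmod (w - p) < Cmod l * Cmod (w - p)) by (apply Rmult_lt_compat_r; lra). lra.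
Qed.

(** The zeros lie in the compact rectangle [0, 1] x [0, H]. If no finite list contained them,
    bisection would lead to a point whose arbitrarily small neighbourhoods need more than one entry,
    against isolation. *)
Lemma zeros_finite zeta zeta' : is_zeta zeta -> (forall s, s <> RtoC 1 -> Cder zeta s (zeta' s)) ->
  (forall rho, nontrivial_zero zeta rho -> zeta' rho <> RtoC 0) ->
  forall H, exists l : list C, NoDup l /\ forall x, In x l <-> (nontrivial_zero zeta x /\ 0 < snd x < H).
Proof.
  intros Hz Hd Hs H.
  set (Zs := fun x => nontrivial_zero zeta x /\ 0 < snd x < H).
  assert (Strip : forall x, Zs x -> 0 <= fst x <= 1).
  { intros x [[_ [E _]] Hx]. split; apply Rnot_lt_le; intros L.
    - apply (zeta_nonzero_left zeta x); auto. lra.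
    - apply (zeta_nonzero zeta x); auto. }
  assert (Cov : exists l : list C, forall x, Zs x -> In x l).
  (* The height may fail to be positive: nothing is assumed about [T 0]. *)
  { destruct (Rle_lt_dec H 0) as [HH|HH].
    { exists []. intros x [_ Hx]. lra. }
    apply NNPP. intros N.
    set (Q := fun a b c d => ~ exists l : list C, forall x, Zs x -> onrect a b c d x -> In x l).
    destruct (bisection Q 0 1 0 H) as [x [y [Hx [Hy Hsm]]]]; try lra.
    - intros [l Hl]. apply N. exists l. intros x Zx. apply Hl; auto.
      split; [apply Strip; auto|]. destruct Zx. lra.
    - intros a b c d Hab Hcd HQ m k. apply NNPP. intros NN. apply HQ.
      assert (L1 : exists l : list C, forall x, Zs x -> onrect a m c k x -> In x l) by (apply NNPP; intros X; apply NN; left; exact X).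
      assert (L2 : exists l : list C, forall x, Zs x -> onrect m b c k x -> In x l) by (apply NNPP; intros X; apply NN; right; left; exact X).
      assert (L3 : exists l : list C, forall x, Zs x -> onrect a m k d x -> In x l) by (apply NNPP; intros X; apply NN; right; right; left; exact X).
      assert (L4 : exists l : list C, forall x, Zs x -> onrect m b k d x -> In x l) by (apply NNPP; intros X; apply NN; right; right; right; exact X).
      destruct L1 as [l1 L1], L2 as [l2 L2], L3 as [l3 L3], L4 as [l4 L4].
      exists ((l1 ++ l2) ++ (l3 ++ l4)). intros x Zx [X1 X2]. rewrite !in_app_iff.
      destruct (Rle_lt_dec (fst x) m), (Rle_lt_dec (snd x) k).
      + left; left. apply L1; auto. split; lra.
      + right; left. apply L3; auto. split; lra.
      + left; right. apply L2; auto. split; lra.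
      + right; right. apply L4; auto. split; lra.
    - set (p := (x, y) : C).
      assert (Loc : exists d, 0 < d /\ forall w, Cmod (w - p) < d -> Zs w -> w = p).
      (* The limit point may be s = 1, where [zeta] is uncontrolled, so the case distinction is made
         on [zetaW]. A zero of [zetaW] here is not real, hence it is a nontrivial and simple zero of
         [zeta]. *)
      { destruct (classic (zetaW p = RtoC 0)) as [E|E].
        - assert (Ny : y <> 0).
          { intros ->. apply (zetaW_real x); auto. lra. }
          apply (zetaW_zero_iff zeta) in E; auto; [|simpl; lra]. destruct E as [N1 E].
          assert (NT : nontrivial_zero zeta p).
          { repeat split; auto. intros [k [_ Ek]]. apply (f_equal snd) in Ek. simpl in Ek. lra. }
          destruct (simple_zero_isolated zeta p (zeta' p)) as [d [Hdd Hw]]; auto.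
          exists d. split; auto. intros w Bw [[_ [Ew _]] _]. apply Hw; auto.
        - destruct (Ccont_neq0 zetaW p) as [d [Hdd Hw]]; auto.
          { apply Chol_cont, zetaW_hol. simpl; lra. }
          exists d. split; auto. intros w Bw Zw. exfalso. apply (Hw w Bw).
          apply (zetaW_zero_iff zeta); auto; [|destruct Zw as [[N1 [Ew _]] _]; auto].
          assert (A := Strip w Zw). lra. }
      destruct Loc as [d [Hdd Hw]].
      destruct (Hsm (d / 2) ltac:(lra)) as [a [b [c [e [HQ [H1 [H2 [H3 [H4 [H5 H6]]]]]]]]]].
      apply HQ. exists [p]. intros w Zw [W1 W2]. left. symmetry. apply Hw; auto.
      eapply Rle_lt_trans; [apply Cmod_le_abs|]. simpl.
      assert (Rabs (fst w + - x) < d / 2) by (apply Rabs_def1; lra).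
      assert (Rabs (snd w + - y) < d / 2) by (apply Rabs_def1; lra). lra. }
  destruct Cov as [l Hl].
  (* The covering list is cut down to the zeros themselves and freed from repetitions, since each
     zero must be counted once. *)
  assert (Dec : forall x y : C, {x = y} + {x <> y}) by (intros; apply excluded_middle_informative).
  exists (nodup Dec (filter (fun x => if excluded_middle_informative (Zs x) then true else false) l)).
  split; [apply NoDup_nodup|]. intros x. rewrite nodup_In, filter_In. split.
  - intros [_ F]. destruct (excluded_middle_informative (Zs x)); [auto|discriminate].
  - intros Zx. split; [apply Hl; auto|]. destruct (excluded_middle_informative (Zs x)) as [_|NZ]; [reflexivity|exfalso; exact (NZ Zx)].
Qed.

(** * The contour integral *)


(** Equations coming from lemmas on modules are typed in the carrier of the module; [ring] has to
    see them in [C]. *)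
Ltac complex_ring := match goal with |- @eq _ ?a ?b => change (@eq C a b); ring end.

Definition bottom_fun (beta n : nat) (z : C) : C :=
  CI (fun t => quot beta n (RtoC t) * Cexp (RtoC t * z))%C (- (1 / 2)) (3 / 2).

Lemma zetaW_real_segment zeta t : is_zeta zeta -> - (1 / 2) <= t -> zetaW (RtoC t) <> RtoC 0.
Proof.
  intros Hz Ht. destruct (Rle_lt_dec t 1); [apply zetaW_real; lra|].
  apply (zetaW_right zeta); auto.
Qed.

Lemma quot_real_cont zeta beta n t : is_zeta zeta -> (1 <= beta)%nat -> (1 <= n)%nat -> - (1 / 2) <= t ->
  curve_cont (fun t => quot beta n (RtoC t)) t.
Proof.
  intros Hz Hb Hn Ht. apply (curve_comp_cont (quot beta n) RtoC); [apply RtoC_cont|].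
  apply Chol_cont, quot_hol; auto; [simpl; lra|]. apply (zetaW_real_segment zeta); auto.
Qed.

Lemma bottom_hol zeta beta n z : is_zeta zeta -> (1 <= beta)%nat -> (1 <= n)%nat -> Chol (bottom_fun beta n) z.
Proof.
  intros Hz Hb Hn. apply (segment_transform_hol (fun t => quot beta n (RtoC t))); [lra|].
  intros t Ht. apply (quot_real_cont zeta); auto; lra.
Qed.

(** At t = 1 the integrand contains the arbitrary value [zeta 1] and may differ from that of
    [bottom_fun]. Splitting the segment there leaves the exceptional point as an end point, which
    does not affect the integrals. *)
Lemma bottom_integral zeta beta n z : is_zeta zeta -> (1 <= beta)%nat -> (1 <= n)%nat ->
  is_CI (fun t => sigma_at beta n (RtoC t) * / zeta (RtoC t) * Cexp (RtoC t * z))%C (- (1 / 2)) (3 / 2) (bottom_fun beta n z).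
Proof.
  intros Hz Hb Hn.
  set (f := fun t => (quot beta n (RtoC t) * Cexp (RtoC t * z))%C).
  assert (Hc : forall t, - (1 / 2) <= t -> curve_cont f t).
  { intros t Ht. apply cont_mult; [apply (quot_real_cont zeta); auto|].
    apply cont_Cexp, cont_mult; [apply RtoC_cont|apply cont_const]. }
  assert (E1 : ex_CI f (- (1 / 2)) 1).
  { apply ex_CI_cont. intros t Ht. rewrite Rmin_left in Ht by lra. apply Hc. lra. }
  assert (E2 : ex_CI f 1 (3 / 2)).
  { apply ex_CI_cont. intros t Ht. rewrite Rmin_left in Ht by lra. apply Hc. lra. }
  unfold bottom_fun. fold f. rewrite <- (CI_chasles f (- (1 / 2)) 1 (3 / 2)) by auto.
  apply is_CI_chasles with 1.
  - eapply is_CI_ext; [|apply CI_correct; auto]. rewrite Rmin_left, Rmax_right by lra.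
    intros t Ht. unfold f. rewrite (quot_zeta zeta); auto; [simpl; lra|]. apply RtoC_neq. lra.
  - eapply is_CI_ext; [|apply CI_correct; auto]. rewrite Rmin_left, Rmax_right by lra.
    intros t Ht. unfold f. rewrite (quot_zeta zeta); auto; [simpl; lra|]. apply RtoC_neq. lra.
Qed.

Lemma varpi1_integral zeta beta n z : is_zeta zeta -> (1 <= beta)%nat -> (1 <= n)%nat -> 0 < snd z ->
  is_RInt_gen (V := C_R_NormedModule)
    (fun t : R => Cmult Ci (sigma_at beta n (- (1 / 2), t) * / zeta (- (1 / 2), t) * Cexp ((- (1 / 2), t) * z)))
    (Rbar_locally p_infty) (at_point 0) (varpi1_fun beta n z).
Proof.
  intros Hz Hb Hn Hi.
  destruct (left_line_ebound zeta beta n (snd z / 2) Hz Hb Hn ltac:(lra)) as [M HM].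
  set (w := (- (Ci * z))%C). assert (Hw : snd z / 2 < fst w) by (unfold w; simpl; lra).
  assert (HL := Lap_spec _ _ _ w HM Hw).
  set (K := (Ci * Cexp (RtoC (- (1 / 2)) * z))%C).
  assert (Hc : forall t, curve_cont (lapf (left_line beta n) w) t) by (intros; apply lapf_cont, HM).
  assert (HI : forall X, is_CI (fun t : R => Cmult Ci (sigma_at beta n (- (1 / 2), t) * / zeta (- (1 / 2), t) * Cexp ((- (1 / 2), t) * z)))
     X 0 (- (K * CI (lapf (left_line beta n) w) 0 X))%C).
  { intros X. apply (is_RInt_swap (V := C_R_NormedModule)).
    eapply is_CI_ext; [|apply is_CI_scal, CI_correct, ex_CI_all; auto].
    intros t _. unfold K, lapf, left_line. rewrite vertical_exp. fold w.
    rewrite (quot_zeta zeta); auto; [complex_ring|simpl; lra|]. intros E; injection E; intros; lra. }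
  intros P HP. apply (locally_C_iff (varpi1_fun beta n z) P) in HP. destruct HP as [d [Hd HP]].
  assert (PK : 0 < Cmod K + 1) by (assert (G := Cmod_ge_0 K); lra).
  destruct (HL (d / 2 / (Cmod K + 1))) as [X0 HX]; [apply Rdiv_lt_0_compat; lra|].
  apply (Filter_prod _ _ _ (fun X => Rmax 0 X0 < X) (fun b => b = 0)).
  - exists (Rmax 0 X0). auto.
  - reflexivity.
  - intros X b HX1 ->. simpl fst. simpl snd.
    assert (L1 := Rmax_l 0 X0). assert (L2 := Rmax_r 0 X0).
    exists (- (K * CI (lapf (left_line beta n) w) 0 X))%C. split; [apply HI|].
    apply HP. unfold varpi1_fun. fold w K.
    replace (- (K * CI (lapf (left_line beta n) w) 0 X) - - (K * Lap (left_line beta n) w))%C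
      with (- (K * (CI (lapf (left_line beta n) w) 0 X - Lap (left_line beta n) w)))%C by ring.
    rewrite Cmod_opp, Cmod_mult. specialize (HX X ltac:(lra) ltac:(lra)).
    apply Rle_lt_trans with ((Cmod K + 1) * (d / 2 / (Cmod K + 1))).
    + apply Rmult_le_compat; auto; try apply Cmod_ge_0. lra.
    + replace ((Cmod K + 1) * (d / 2 / (Cmod K + 1))) with (d / 2) by (field; lra). lra.
Qed.

(** * The last term as a meromorphic function *)

Lemma gpole_large B : exists N, forall k, (N <= k)%nat -> B <= Cmod (gpole k).
Proof.
  destruct (ln_INR_large B) as [N HN]. exists N. intros k Hk.
  destruct (HN k Hk) as [H1 H2]. unfold gpole. rewrite Cmod_R, Rabs_pos_eq; auto.
Qed.

Lemma Gfun_away beta n z : (forall q, (1 <= q)%nat -> c_beta beta q n <> RtoC 0 -> z <> RtoC (ln (INR q))) ->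
  exists d, away (gcoef beta n) gpole z d.
Proof.
  intros H. apply away_exists; [apply gpole_large|].
  intros k Hk. apply H; [lia|]. intros E. apply Hk. unfold gcoef. rewrite E. ring.
Qed.

Lemma Gfun_series zeta beta n z d : is_zeta zeta -> (1 <= beta)%nat -> (1 <= n)%nat -> away (gcoef beta n) gpole z d ->
  Cser (fun k => pole_term beta n (S k) z) (Gfun beta n z).
Proof.
  intros Hz Hb Hn Hd. eapply Cser_ext; [intros k; symmetry; apply pole_term_eq|].
  eapply polar_spec; eauto. apply (gcoef_series zeta); auto.
Qed.

Lemma Gfun_hol zeta beta n z d : is_zeta zeta -> (1 <= beta)%nat -> (1 <= n)%nat -> away (gcoef beta n) gpole z d ->
  Chol (Gfun beta n) z.
Proof. intros Hz Hb Hn Hd. eapply polar_hol; eauto. apply (gcoef_series zeta); auto. Qed.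

Lemma gpole_inj j k : gpole j = gpole k -> j = k.
Proof.
  intros E. apply (f_equal fst) in E. change (ln (INR (S j)) = ln (INR (S k))) in E. apply ln_inv in E.
  - apply INR_eq in E. lia.
  - apply lt_0_INR; lia.
  - apply lt_0_INR; lia.
Qed.

Lemma gcoef_erase_series zeta beta n k0 : is_zeta zeta -> (1 <= beta)%nat -> (1 <= n)%nat ->
  ex_series (fun k => Cmod (if Nat.eqb k k0 then RtoC 0 else gcoef beta n k)).
Proof.
  intros Hz Hb Hn. apply (ex_series_dominated _ (fun k => Cmod (gcoef beta n k))).
  - intros k. split; [apply Cmod_ge_0|]. destruct (Nat.eqb k k0); [rewrite Cmod_0; apply Cmod_ge_0|lra].
  - apply (gcoef_series zeta); auto.
Qed.

(** Setting one coefficient to 0, instead of dropping an index, keeps the sequence of points, so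
    [away] and [polar_bound] apply to the rest unchanged. *)
Lemma Gfun_split zeta beta n k0 z d : is_zeta zeta -> (1 <= beta)%nat -> (1 <= n)%nat -> away (gcoef beta n) gpole z d ->
  Gfun beta n z = (gcoef beta n k0 * / (z - gpole k0) + Polar (fun k => if Nat.eqb k k0 then RtoC 0 else gcoef beta n k) gpole z)%C.
Proof.
  intros Hz Hb Hn Hd. set (a' := fun k => if Nat.eqb k k0 then RtoC 0 else gcoef beta n k).
  assert (Eg := gcoef_series zeta beta n Hz Hb Hn).
  apply (Cser_unique (fun k => gcoef beta n k * / (z - gpole k))%C); [eapply polar_spec; eauto|].
  apply (Cser_ext (fun k => (if Nat.eqb k k0 then gcoef beta n k0 * / (z - gpole k0) else RtoC 0) + a' k * / (z - gpole k))%C).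
  { intros k. unfold a'. destruct (Nat.eqb_spec k k0) as [->|]; ring. }
  apply Cser_plus.
  - intros eps He. exists (S k0). intros N HN. rewrite (Csum_single _ k0) by
      (try lia; intros j _ Nj; destruct (Nat.eqb_spec j k0); tauto).
    rewrite Nat.eqb_refl. replace (_ - _)%C with (RtoC 0) by ring. rewrite Cmod_0. lra.
  - apply (polar_spec _ _ _ d).
    + apply (gcoef_erase_series zeta); auto.
    + destruct Hd as [D1 D2]. split; auto. intros k. unfold a'. destruct (Nat.eqb k k0); [tauto|apply D2].
Qed.

(** Near the pole the remaining fractions stay bounded by [B] and the exponential stays above [e0],
    while the singular fraction with its nonzero coefficient grows without bound. *)
Lemma Gfun_blowup zeta beta n k0 : is_zeta zeta -> (1 <= beta)%nat -> (1 <= n)%nat -> c_beta beta (S k0) n <> RtoC 0 ->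
  forall M, exists d, 0 < d /\ forall w, w <> gpole k0 -> Cmod (w - gpole k0) < d ->
    M < Cmod (Cexp (RtoC (3 / 2) * w) * Gfun beta n w).
Proof.
  intros Hz Hb Hn Hc M. set (s := gpole k0).
  set (a' := fun k => if Nat.eqb k k0 then RtoC 0 else gcoef beta n k).
  assert (Eg := gcoef_series zeta beta n Hz Hb Hn).
  assert (Ea : ex_series (fun k => Cmod (a' k))).
  { apply (gcoef_erase_series zeta); auto. }
  destruct (away_exists a' gpole s gpole_large) as [d0 Hd0].
  { intros k Hk E. apply gpole_inj in E. apply Hk. unfold a'. subst. rewrite Nat.eqb_refl. auto. }
  assert (Pd0 : 0 < d0) by apply Hd0.
  assert (Ng : gcoef beta n k0 <> RtoC 0).
  { unfold gcoef. apply Cmult_neq_0; auto. intros E.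
    assert (P : RtoC (Rpower (INR (S k0)) (3 / 2)) <> RtoC 0) by (apply RtoC_neq, Rgt_not_eq, exp_pos).
    assert (Z : (RtoC (Rpower (INR (S k0)) (3 / 2)) * / RtoC (Rpower (INR (S k0)) (3 / 2)))%C = RtoC 1) by (apply Cinv_r; auto).
    rewrite E in Z. replace (RtoC (Rpower (INR (S k0)) (3 / 2)) * 0)%C with (RtoC 0) in Z by ring. injection Z; lra. }
  set (g := Cmod (gcoef beta n k0)). assert (Pg : 0 < g) by (apply Cmod_pos; auto).
  set (B := / (d0 / 2) * Series (fun k => Cmod (a' k))).
  assert (PB : 0 <= B).
  { apply Rmult_le_pos; [left; apply Rinv_0_lt_compat; lra|]. apply Series_nonneg; auto. intros; apply Cmod_ge_0. }
  set (e0 := exp (3 / 2 * (fst s - 1))). assert (Pe : 0 < e0) by apply exp_pos.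
  (* Once the singular fraction exceeds [T], what is left after subtracting [B] and multiplying by
     [e0] is still larger than |M| + 1. *)
  set (T := B + (Rabs M + 1) / e0).
  assert (PT : 0 < T).
  { assert (0 < (Rabs M + 1) / e0) by (apply Rdiv_lt_0_compat; auto; assert (G := Rabs_pos M); lra). unfold T; lra. }
  exists (Rmin 1 (Rmin (d0 / 2) (g / T))). split.
  { repeat apply Rmin_pos; try lra. apply Rdiv_lt_0_compat; auto. }
  intros w Nw Bw.
  assert (B1 := Rlt_le_trans _ _ _ Bw (Rmin_l _ _)).
  assert (B23 := Rlt_le_trans _ _ _ Bw (Rmin_r _ _)).
  assert (B2 := Rlt_le_trans _ _ _ B23 (Rmin_l _ _)).
  assert (B3 := Rlt_le_trans _ _ _ B23 (Rmin_r _ _)).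
  fold s in Nw. assert (Pw := Cmod_pos _ (Cminus_neq _ _ Nw)).
  assert (Aw := away_near _ _ _ _ _ Hd0 B2).
  assert (Aw' : away (gcoef beta n) gpole w (Rmin (d0 / 2) (Cmod (w - s)))).
  { split; [apply Rmin_pos; lra|]. intros k Hk. destruct (Nat.eq_dec k k0) as [->|Nk].
    - apply Rmin_r.
    - eapply Rle_trans; [apply Rmin_l|]. apply Aw. unfold a'. destruct (Nat.eqb_spec k k0); tauto. }
  rewrite (Gfun_split zeta beta n k0 w _ Hz Hb Hn Aw'). fold a' s.
  assert (BP : Cmod (Polar a' gpole w) <= B) by (apply polar_bound; auto).
  rewrite Cmod_mult, Cmod_Cexp.
  assert (E1 : e0 <= exp (fst (RtoC (3 / 2) * w)%C)).
  { apply exp_mono. replace (fst (RtoC (3 / 2) * w)%C) with (3 / 2 * fst w) by (simpl; ring).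
    assert (G := fst_le_Cmod (w - s)). change (fst (w - s)%C) with (fst w - fst s) in G.
    assert (G2 := Rle_abs (- (fst w - fst s))). rewrite Rabs_Ropp in G2. lra. }
  assert (E2 : T < Cmod (gcoef beta n k0 * / (w - s))).
  { rewrite Cmod_mult, Cmod_inv by (apply Cminus_neq; auto). fold g.
    apply Rlt_div_r in B3; auto. change (T < g / Cmod (w - s)). apply Rlt_div_r; auto. lra. }
  assert (E3 := Cmod_rev (gcoef beta n k0 * / (w - s)) (- Polar a' gpole w)).
  rewrite Cmod_opp in E3.
  replace (gcoef beta n k0 * / (w - s) - - Polar a' gpole w)%C with (gcoef beta n k0 * / (w - s) + Polar a' gpole w)%C in E3 by ring.
  set (X := Cmod (gcoef beta n k0 * / (w - s) + Polar a' gpole w)) in *.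
  assert (E4 : (Rabs M + 1) / e0 < X) by (unfold T in *; lra).
  apply Rlt_div_l in E4; auto. assert (G := Rle_abs M). assert (G2 := Rabs_pos M).
  assert (PX : 0 < X).
  { apply (Rmult_lt_reg_r e0); auto. lra. }
  assert (e0 * X <= exp (fst (RtoC (3 / 2) * w)%C) * X) by (apply Rmult_le_compat_r; lra). lra.
Qed.

(** * The rectangle and the limit along T_m *)

(** The tangent inequality gives ln T <= e T - ln e. With e = y/(2c) the power of T costs at most
    exp(T y/2) and a constant, which leaves half of the decay. *)
Lemma top_edge_bound c1 y : 0 < y -> exists K k, 0 < k /\ forall T, 1 <= T -> Rpower T c1 * exp (- (T * y)) <= K * exp (- (k * T)).
Proof.
  intros Hy. set (c := Rabs c1 + 1). assert (Pc : 0 < c) by (unfold c; assert (G := Rabs_pos c1); lra).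
  set (e := y / (2 * c)). assert (Pe : 0 < e) by (apply Rdiv_lt_0_compat; lra).
  exists (exp (c * (- ln e))), (y / 2). split; [lra|]. intros T HT.
  unfold Rpower. rewrite <- !exp_plus. apply exp_mono.
  assert (L0 : 0 <= ln T) by (rewrite <- ln_1; apply ln_le; lra).
  assert (L1 : ln T <= e * T - ln e).
  { assert (P : 0 < e * T) by (apply Rmult_lt_0_compat; lra).
    assert (X := exp_ineq1_le (ln (e * T))). rewrite exp_ln in X by auto. rewrite ln_mult in X by lra. lra. }
  assert (A : c1 * ln T <= c * ln T) by (apply Rmult_le_compat_r; auto; unfold c; assert (G := Rle_abs c1); lra).
  assert (B : c * ln T <= c * (e * T - ln e)) by (apply Rmult_le_compat_l; lra).
  assert (D : c * (e * T) = y / 2 * T) by (unfold e; field; lra). lra.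
Qed.

(** The residue theorem for the rectangle with corners -1/2 and 3/2 + iT. The vertical edges are
    rewritten as truncated Laplace integrals so that their limits are those of [Lap_spec]. *)
Lemma contour_identity zeta zeta' beta n z T (l : list C) : is_zeta zeta -> (1 <= beta)%nat -> (1 <= n)%nat ->
  (forall s, s <> RtoC 1 -> Cder zeta s (zeta' s)) ->
  (forall rho, nontrivial_zero zeta rho -> zeta' rho <> RtoC 0) ->
  0 < T -> (forall x, -1 <= x <= 2 -> zeta (x, T) <> RtoC 0) ->
  NoDup l -> (forall x, In x l <-> nontrivial_zero zeta x /\ 0 < snd x < T) ->
  (RtoC (2 * PI) * Ci * csum (map (fun rho => sigma_at beta n rho * / zeta' rho * Cexp (rho * z)) l))%C =
  (bottom_fun beta n z + Ci * (Cexp (RtoC (3 / 2) * z) * CI (lapf (right_line beta n) (- (Ci * z))) 0 T)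
   - CI (fun x => quot beta n (x, T) * Cexp ((x, T) * z)) (- (1 / 2)) (3 / 2)
   - Ci * (Cexp (RtoC (- (1 / 2)) * z) * CI (lapf (left_line beta n) (- (Ci * z))) 0 T))%C.
Proof.
  intros Hz Hb Hn Hd Hs HT Htop Hnd Hl.
  set (f := fun s => (quot beta n s * Cexp (s * z))%C).
  rewrite <- (residue_theorem l (fun rho => sigma_at beta n rho * / zeta' rho * Cexp (rho * z))%C f (- (1 / 2)) (3 / 2) 0 T); auto; try lra.
  - assert (ER : CI (fun y => f (3 / 2, y)) 0 T = (Cexp (RtoC (3 / 2) * z) * CI (lapf (right_line beta n) (- (Ci * z))) 0 T)%C).
    { rewrite <- CI_scal.
      * apply CI_ext_all. intros t. unfold f, lapf, right_line. rewrite vertical_exp. ring.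
      * apply ex_CI_all. intros t. apply lapf_cont. apply (right_line_ebound zeta); auto. }
    assert (EL : CI (fun y => f (- (1 / 2), y)) 0 T = (Cexp (RtoC (- (1 / 2)) * z) * CI (lapf (left_line beta n) (- (Ci * z))) 0 T)%C).
    { rewrite <- CI_scal.
      * apply CI_ext_all. intros t. unfold f, lapf, left_line. rewrite vertical_exp. ring.
      * apply ex_CI_all. intros t. apply lapf_cont. destruct (left_line_ebound zeta beta n 1 Hz Hb Hn ltac:(lra)) as [M HM]. apply HM. }
    unfold rint. rewrite ER, EL. reflexivity.
  - intros p Hp. apply Hl in Hp. destruct Hp as [[N1 [E _]] Hi]. split; [|lra].
    split; apply Rnot_le_lt; intros L.
    + apply (zeta_nonzero_left zeta p); auto; lra.
    + apply (zeta_nonzero zeta p); auto; lra.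
  - intros s [S1 S2] Ns. unfold f. apply Chol_mult.
    (* A zero of [zetaW] on the closed rectangle is excluded on the real axis by the explicit bound
       and on the top edge by the choice of [T]; any other one belongs to [l]. *)
    + apply quot_hol; auto; [lra|]. intros E.
      destruct (Req_dec (snd s) 0) as [E0|N0].
      * apply (zetaW_real_segment zeta (fst s)); auto; [lra|]. rewrite <- E. f_equal. apply C_ext; auto.
      * apply (zetaW_zero_iff zeta) in E; auto; [|lra]. destruct E as [N1 E].
        apply Ns, Hl. split.
        -- repeat split; auto. intros [k [_ Ek]]. apply (f_equal snd) in Ek. simpl in Ek. lra.
        -- split; [lra|]. destruct S2 as [_ S2]. destruct (Rle_lt_or_eq_dec _ _ S2) as [|Eq]; auto.
           exfalso. apply (Htop (fst s)); [lra|]. rewrite <- Eq, <- surjective_pairing. auto.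
    + apply Chol_Cexp, Chol_mult; [apply Chol_id|apply Chol_const].
  - intros p Hp. apply Hl in Hp. destruct Hp as [NT Hi]. assert (Z := NT). destruct Z as [N1 [E _]].
    assert (Re0 : 0 <= fst p) by (apply Rnot_lt_le; intros L; apply (zeta_nonzero_left zeta p); auto; lra).
    assert (R := resid_simple_zero zeta (fun s => sigma_at beta n s * Cexp (s * z))%C p (zeta' p) (Hd p N1) (Hs p NT) E).
    replace (sigma_at beta n p * / zeta' p * Cexp (p * z))%C with (sigma_at beta n p * Cexp (p * z) * / zeta' p)%C by ring.
    intros eps He. destruct (R) with (eps := eps) as [d [Hdd Hw]]; auto.
    { apply Chol_cont, Chol_mult; [apply sigma_at_hol; auto|]. apply Chol_Cexp, Chol_mult; [apply Chol_id|apply Chol_const]. }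
    assert (P1 := Cmod_pos _ (Cminus_neq _ _ N1)).
    (* Since Re p >= 0, these radii keep [s] to the right of Re s = -1 and away from 1, where [quot]
       agrees with sigma/zeta. *)
    exists (Rmin d (Rmin (1 / 2) (Cmod (p - 1)))). split; [repeat apply Rmin_pos; lra|].
    intros s [S1 S2].
    assert (B1 := Rlt_le_trans _ _ _ S2 (Rmin_l _ _)). assert (B23 := Rlt_le_trans _ _ _ S2 (Rmin_r _ _)).
    assert (B2 := Rlt_le_trans _ _ _ B23 (Rmin_l _ _)). assert (B3 := Rlt_le_trans _ _ _ B23 (Rmin_r _ _)).
    unfold f. rewrite (quot_zeta zeta); auto.
    + replace (sigma_at beta n s * / zeta s * Cexp (s * z))%C with (sigma_at beta n s * Cexp (s * z) * / zeta s)%C by ring.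
      apply Hw. split; auto.
    + assert (G := fst_le_Cmod (s - p)). simpl in G. assert (G2 := Rle_abs (- (fst s + - fst p))). rewrite Rabs_Ropp in G2. lra.
    + intros ->. rewrite Cmod_sym in B3. lra.
Qed.

(** The edge has length 2, |e^(sz)| contributes e^(x Re z - T Im z) with |x| <= 2, and the inverse
    of zeta is bounded by the power of [T] that comes with the choice of heights. *)
Lemma top_edge_estimate zeta beta n z T c1 H : is_zeta zeta -> (1 <= beta)%nat -> (1 <= n)%nat -> 1 <= T ->
  (forall s, - (2) <= fst s <= 2 -> Cmod (sigma_at beta n s) <= H) ->
  (forall x, -1 <= x <= 2 -> 1 < Rpower T c1 * Cmod (zeta (x, T))) ->
  Cmod (CI (fun x => quot beta n (x, T) * Cexp ((x, T) * z))%C (- (1 / 2)) (3 / 2)) <=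
  2 * H * exp (2 * Rabs (fst z)) * (Rpower T c1 * exp (- (T * snd z))).
Proof.
  intros Hz Hb Hn HT HH Htop.
  assert (NZ : forall x, -1 <= x <= 2 -> zeta (x, T) <> RtoC 0).
  { intros x Hx E. specialize (Htop x Hx). rewrite E, Cmod_0 in Htop. lra. }
  assert (Hol : forall x, - (1 / 2) <= x <= 3 / 2 -> Chol (fun s => quot beta n s * Cexp (s * z))%C (x, T)).
  { intros x Hx. apply Chol_mult.
    - apply quot_hol; auto; [simpl; lra|]. intros E. apply (zetaW_zero_iff zeta) in E; auto; [|simpl; lra].
      apply (NZ x); [lra|apply E].
    - apply Chol_Cexp, Chol_mult; [apply Chol_id|apply Chol_const]. }
  replace (2 * H * exp (2 * Rabs (fst z)) * (Rpower T c1 * exp (- (T * snd z))))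
    with ((3 / 2 - - (1 / 2)) * (H * Rpower T c1 * (exp (2 * Rabs (fst z)) * exp (- (T * snd z))))) by field.
  apply CI_bound; [lra| |].
  - apply (hor_ex (fun s => quot beta n s * Cexp (s * z))%C); [lra|]. intros x Hx. apply Chol_cont, Hol; auto.
  - intros x Hx. rewrite (quot_zeta zeta); auto; [|simpl; lra|].
    2: { intros E. injection E; intros; lra. }
    rewrite !Cmod_mult, Cmod_Cexp, Cmod_inv by (apply NZ; lra).
    assert (PZ := Cmod_pos _ (NZ x ltac:(lra))). specialize (Htop x ltac:(lra)).
    assert (G := Cmod_ge_0). assert (B1 := HH (x, T) ltac:(simpl; lra)).
    apply Rmult_le_compat; auto.
    + apply Rmult_le_pos; auto. left; apply Rinv_0_lt_compat; auto.
    + left; apply exp_pos.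
    + apply Rmult_le_compat; auto; [left; apply Rinv_0_lt_compat; auto|].
      apply (Rmult_le_reg_r (Cmod (zeta (x, T)))); auto. rewrite Rinv_l by lra. lra.
    + rewrite <- exp_plus. apply exp_mono. simpl.
      assert (A : x * fst z <= 2 * Rabs (fst z)).
      { apply Rle_trans with (Rabs (x * fst z)); [apply Rle_abs|]. rewrite Rabs_mult.
        apply Rmult_le_compat_r; [apply Rabs_pos|]. apply Rabs_le; lra. }
      lra.
Qed.

Lemma C2PI_neq0 : (RtoC (2 * PI) * Ci)%C <> RtoC 0.
Proof.
  apply Cmult_neq_0.
  - apply RtoC_neq. assert (P := PI_RGT_0). lra.
  - intros E; injection E; lra.
Qed.

(** The asserted identity solved for varpi; [zero_sum_limit] then proves that the sums over zeros
    converge to it. *)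
Definition varpi_fun (beta n : nat) (z : C) : C :=
  (/ (RtoC (2 * PI) * Ci) * (varpi1_fun beta n z + bottom_fun beta n z - Cexp (RtoC (3 / 2) * z) * Gfun beta n z))%C.

Lemma zero_sum_limit zeta zeta' beta n z (T : nat -> R) c1 (L : nat -> list C) : is_zeta zeta -> (1 <= beta)%nat -> (1 <= n)%nat ->
  (forall s, s <> RtoC 1 -> Cder zeta s (zeta' s)) ->
  (forall rho, nontrivial_zero zeta rho -> zeta' rho <> RtoC 0) ->
  (forall m : nat, (1 <= m)%nat -> INR m <= T m /\ (forall x, -1 <= x <= 2 -> 1 < Rpower (T m) c1 * Cmod (zeta (x, T m)))) ->
  (forall m, NoDup (L m) /\ forall x, In x (L m) <-> nontrivial_zero zeta x /\ 0 < snd x < T m) ->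
  0 < snd z ->
  forall eps, 0 < eps -> exists N, forall m, (N <= m)%nat ->
    Cmod (csum (map (fun rho => sigma_at beta n rho * / zeta' rho * Cexp (rho * z))%C (L m)) - varpi_fun beta n z) <= eps.
Proof.
  intros Hz Hb Hn Hd Hs HT HL Hi eps0 He0.
  set (w := (- (Ci * z))%C). assert (Hw : fst w = snd z) by (unfold w; simpl; ring).
  destruct (right_line_ebound zeta beta n Hz Hb Hn) as [HR _].
  destruct (left_line_ebound zeta beta n (snd z / 2) Hz Hb Hn ltac:(lra)) as [ML HLe].
  assert (LR := Lap_spec _ _ _ w HR ltac:(lra)). assert (LL := Lap_spec _ _ _ w HLe ltac:(lra)).
  destruct (sigma_at_bound beta n Hb Hn) as [H [PH HH]].
  destruct (top_edge_bound c1 (snd z) Hi) as [K [k [Pk HK]]].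
  assert (NP := C2PI_neq0). set (P := (RtoC (2 * PI) * Ci)%C) in *. assert (PP := Cmod_pos _ NP).
  set (eps := eps0 * Cmod P). assert (He : 0 < eps) by (apply Rmult_lt_0_compat; auto).
  set (ER := Cexp (RtoC (3 / 2) * z)). set (EL := Cexp (RtoC (- (1 / 2)) * z)).
  assert (PER : 0 < Cmod ER) by (apply Cmod_pos, Cexp_neq0). assert (PEL : 0 < Cmod EL) by (apply Cmod_pos, Cexp_neq0).
  destruct (LR (eps / 3 / Cmod ER)) as [X1 H1]; [apply Rdiv_lt_0_compat; lra|].
  destruct (LL (eps / 3 / Cmod EL)) as [X2 H2]; [apply Rdiv_lt_0_compat; lra|].
  destruct (exp_decay (2 * H * exp (2 * Rabs (fst z)) * K) k Pk (eps / 3) ltac:(lra)) as [X3 [P3 H3]].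
  destruct (nfloor_ex (Rabs X1 + Rabs X2 + X3)) as [N [_ HN]].
  { assert (A := Rabs_pos X1). assert (B := Rabs_pos X2). lra. }
  exists (S N). intros m Hm.
  destruct (HT m ltac:(lia)) as [T1 T2]. destruct (HL m) as [L1 L2].
  assert (Hm' := le_INR _ _ Hm). rewrite S_INR in Hm'. assert (PN := pos_INR N).
  assert (A1 := Rle_abs X1). assert (A2 := Rle_abs X2). assert (A3 := Rabs_pos X1). assert (A4 := Rabs_pos X2).
  assert (NZ : forall x, -1 <= x <= 2 -> zeta (x, T m) <> RtoC 0).
  { intros x Hx E. specialize (T2 x Hx). rewrite E, Cmod_0 in T2. lra. }
  assert (CI0 := contour_identity zeta zeta' beta n z (T m) (L m) Hz Hb Hn Hd Hs ltac:(lra) NZ L1 L2).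
  assert (TE := top_edge_estimate zeta beta n z (T m) c1 H Hz Hb Hn ltac:(lra) HH T2).
  assert (RL := right_line_laplace zeta beta n z Hz Hb Hn Hi).
  fold w ER EL P in CI0. fold w in RL.
  set (Sm := csum (map (fun rho => sigma_at beta n rho * / zeta' rho * Cexp (rho * z))%C (L m))) in *.
  set (IR := CI (lapf (right_line beta n) w) 0 (T m)) in *. set (IL := CI (lapf (left_line beta n) w) 0 (T m)) in *.
  set (IT := CI (fun x => quot beta n (x, T m) * Cexp ((x, T m) * z))%C (- (1 / 2)) (3 / 2)) in *.
  (* After multiplication by 2 pi i three errors remain: the tails of the two vertical integrals and
     the top edge. The real segment cancels exactly. *)
  assert (Eq : (P * (Sm - varpi_fun beta n z))%C =
     (Ci * (ER * (IR - Lap (right_line beta n) w)) + - IT + - (Ci * (EL * (IL - Lap (left_line beta n) w))))%C).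
  { unfold varpi_fun, varpi1_fun. fold P ER EL w.
    replace (P * (Sm - / P * (- (Ci * EL * Lap (left_line beta n) w) + bottom_fun beta n z - ER * Gfun beta n z)))%C
      with (P * Sm - (- (Ci * EL * Lap (left_line beta n) w) + bottom_fun beta n z + ER * (- Gfun beta n z)))%C by (field; auto).
    rewrite CI0, <- RL. ring. }
  assert (B : Cmod (P * (Sm - varpi_fun beta n z)) <= eps).
  { rewrite Eq. eapply Rle_trans; [apply Cmod_triangle|].
    eapply Rle_trans; [apply Rplus_le_compat_r, Cmod_triangle|].
    rewrite !Cmod_opp, !Cmod_mult, Cmod_Ci.
    assert (Q1 := H1 (T m) ltac:(lra) ltac:(lra)). fold IR in Q1. assert (Q2 := H2 (T m) ltac:(lra) ltac:(lra)). fold IL in Q2.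
    assert (Q3 := H3 (T m) ltac:(lra)). assert (Q4 := HK (T m) ltac:(lra)).
    assert (R1 : Cmod ER * Cmod (IR - Lap (right_line beta n) w) <= eps / 3).
    { apply Rle_trans with (Cmod ER * (eps / 3 / Cmod ER)); [apply Rmult_le_compat_l; lra|apply Req_le; field; lra]. }
    assert (R2 : Cmod EL * Cmod (IL - Lap (left_line beta n) w) <= eps / 3).
    { apply Rle_trans with (Cmod EL * (eps / 3 / Cmod EL)); [apply Rmult_le_compat_l; lra|apply Req_le; field; lra]. }
    assert (R3 : Cmod IT <= eps / 3).
    { eapply Rle_trans; [exact TE|]. eapply Rle_trans; [|exact Q3]. rewrite !Rmult_assoc.
      apply Rmult_le_compat_l; [lra|]. apply Rmult_le_compat_l; auto. apply Rmult_le_compat_l; [left; apply exp_pos|auto]. }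
    lra. }
  rewrite Cmod_mult in B. apply (Rmult_le_reg_l (Cmod P)); auto. unfold eps in B. lra.
Qed.

(** That a point is a pole is expressed by the modulus of the last term tending to infinity in its
    punctured neighbourhoods; [G] is characterised only off these points. *)
Theorem theorem8
  (zeta zeta' : C -> C)
  (* zeta is holomorphic on C \ {1} with derivative zeta' ... *)
  (Hzeta_hol : forall s : C, s <> RtoC 1 -> is_derive (K := C_AbsRing) zeta s (zeta' s))
  (* ... and equals the Dirichlet series sum_{k>=1} k^{-s} for Re s > 1 *)
  (Hzeta_dir : forall s : C, 1 < fst s ->
      is_series (K := C_AbsRing) (fun k : nat => cpow (S k) (Copp s)) (zeta s))
  (* all non-trivial zeros are simple *)
  (Hsimple : forall rho : C, nontrivial_zero zeta rho -> zeta' rho <> RtoC 0)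
  (* the fixed sequence (T_m) and the absolute constant c1 *)
  (T : nat -> R) (c1 : R)
  (HT : forall m : nat, (1 <= m)%nat ->
      INR m <= T m <= INR m + 1 /\
      (forall sigma : R, -1 <= sigma <= 2 ->
         1 < Rpower (T m) c1 * Cmod (zeta (sigma, T m)) /\
         1 < Rpower (T m) c1 * Cmod (zeta (sigma, - T m))))
  (beta n : nat) (Hbeta : (1 <= beta)%nat) (Hn : (1 <= n)%nat) :
  let integrand := fun (s z : C) =>
      Cmult (Cmult (sigma_beta beta (Cminus (RtoC 1) (Cdiv s (RtoC (INR beta)))) n)
                   (Cinv (zeta s)))
            (Cexp (Cmult s z)) in
  let poles := fun z : C =>
      exists q : nat, (1 <= q)%nat /\ c_beta beta q n <> RtoC 0 /\ z = RtoC (ln (INR q)) in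
  exists (varpi varpi1 varpi2 G : C -> C),
    (* the limit defining varpi_n(z) exists, for z in H *)
    (forall z : C, 0 < snd z ->
       exists Sm : nat -> C,
         (forall m : nat,
            is_finsum (fun rho => nontrivial_zero zeta rho /\ 0 < snd rho < T m)
                      (fun rho => Cmult (Cmult (sigma_beta beta
                                                  (Cminus (RtoC 1) (Cdiv rho (RtoC (INR beta)))) n)
                                               (Cinv (zeta' rho)))
                                        (Cexp (Cmult rho z)))
                      (Sm m)) /\
         filterlim Sm eventually (locally (varpi z))) /\
    (* varpi_n is holomorphic on H *)
    (forall z : C, 0 < snd z -> ex_derive (K := C_AbsRing) varpi z) /\
    (* varpi_{1,n}(z) = int_{-1/2 + i oo}^{-1/2} ..., analytic on H *)
    (forall z : C, 0 < snd z ->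
       is_RInt_gen (V := C_R_NormedModule)
         (fun t : R => Cmult Ci (integrand (-1/2, t) z))
         (Rbar_locally p_infty) (at_point 0) (varpi1 z)) /\
    (forall z : C, 0 < snd z -> ex_derive (K := C_AbsRing) varpi1 z) /\
    (* varpi_{2,n}(z) = int_{-1/2}^{3/2} ..., entire *)
    (forall z : C,
       is_RInt (V := C_R_NormedModule)
         (fun t : R => integrand (RtoC t) z) (-1/2) (3/2) (varpi2 z)) /\
    (forall z : C, ex_derive (K := C_AbsRing) varpi2 z) /\
    (* the last term e^{3z/2} sum_q c_q(n)/(q^{3/2}(z - log q)) is meromorphic on C,
       with poles exactly at the points log q with c_q(n) <> 0 *)
    (forall z : C, ~ poles z ->
       is_series (K := C_AbsRing) (fun k : nat => pole_term beta n (S k) z) (G z)) /\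
    (forall z : C, ~ poles z ->
       ex_derive (K := C_AbsRing) (fun w => Cmult (Cexp (Cmult (RtoC (3/2)) w)) (G w)) z) /\
    (forall s : C, poles s ->
       filterlim (fun w => Cmod (Cmult (Cexp (Cmult (RtoC (3/2)) w)) (G w)))
                 (within (fun w => w <> s) (locally s)) (Rbar_locally p_infty)) /\
    (* the identity *)
    (forall z : C, 0 < snd z ->
       Cmult (Cmult (RtoC (2 * PI)) Ci) (varpi z) =
       Cminus (Cplus (varpi1 z) (varpi2 z))
              (Cmult (Cexp (Cmult (RtoC (3/2)) z)) (G z))).
Proof.
  intros integrand poles.
  assert (Hz : is_zeta zeta).
  { split.
    - intros s Hs. exists (zeta' s). apply Cder_is_derive. auto.
    - intros s Hs. apply Cser_is_series. auto. }
  assert (Hd : forall s, s <> RtoC 1 -> Cder zeta s (zeta' s)) by (intros; apply Cder_is_derive; auto).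
  assert (HL : exists L : nat -> list C, forall m, NoDup (L m) /\ forall x, In x (L m) <-> nontrivial_zero zeta x /\ 0 < snd x < T m).
  { exists (fun m => proj1_sig (constructive_indefinite_description _ (zeros_finite zeta zeta' Hz Hd Hsimple (T m)))).
    intros m. destruct constructive_indefinite_description as [l Hl]. exact Hl. }
  destruct HL as [L HL].
  assert (Haway : forall z, ~ poles z -> exists d, away (gcoef beta n) gpole z d).
  { intros z Np. apply Gfun_away. intros q Hq Hc E. apply Np. exists q. auto. }
  assert (Npoles : forall z, 0 < snd z -> ~ poles z).
  { intros z Hi [q [_ [_ E]]]. rewrite E in Hi. simpl in Hi. lra. }
  assert (HE : forall z, Chol (fun w => Cexp (Cmult (RtoC (3 / 2)) w)) z).
  { intros z. apply Chol_Cexp, Chol_mult; [apply Chol_const|apply Chol_id]. }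
  assert (HG : forall z, ~ poles z -> Chol (Gfun beta n) z).
  { intros z Np. destruct (Haway z Np) as [d Hdz]. apply (Gfun_hol zeta beta n z d); auto. }
  assert (Hhalf : -1 / 2 = - (1 / 2)) by field.
  exists (varpi_fun beta n), (varpi1_fun beta n), (bottom_fun beta n), (Gfun beta n).
  split; [|split; [|split; [|split; [|split; [|split; [|split; [|split; [|split]]]]]]]].
  - intros z Hi.
    exists (fun m => csum (map (fun rho => sigma_at beta n rho * / zeta' rho * Cexp (rho * z))%C (L m))). split.
    + intros m. exists (L m). split; [apply HL|]. split; [apply HL|reflexivity].
    + intros P HP. apply (locally_C_iff (varpi_fun beta n z) P) in HP. destruct HP as [d [Hdd HP]].
      destruct (zero_sum_limit zeta zeta' beta n z T c1 L Hz Hbeta Hn Hd Hsimple) with (eps := d / 2) as [N HN]; auto; try lra.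
      * intros m Hm. destruct (HT m Hm) as [[H1 _] H2]. split; auto. intros x Hx. apply H2; auto.
      * exists N. intros m Hm. apply HP. specialize (HN m Hm). lra.
  - intros z Hi. apply Chol_ex_derive. unfold varpi_fun. apply Chol_mult; [apply Chol_const|].
    apply Chol_minus; [apply Chol_plus|].
    + apply (varpi1_hol zeta); auto.
    + apply (bottom_hol zeta); auto.
    + apply Chol_mult; auto.
  - intros z Hi. unfold integrand. rewrite Hhalf. apply (varpi1_integral zeta); auto.
  - intros z Hi. apply Chol_ex_derive, (varpi1_hol zeta); auto.
  - intros z. unfold integrand. rewrite Hhalf. apply (bottom_integral zeta); auto.
  - intros z. apply Chol_ex_derive, (bottom_hol zeta); auto.
  - intros z Np. destruct (Haway z Np) as [d Hdz]. apply Cser_is_series. apply (Gfun_series zeta beta n z d); auto.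
  - intros z Np. apply Chol_ex_derive. apply Chol_mult; auto.
  - intros s [q [Hq [Hc ->]]] P [M HP].
    destruct q as [|k0]; [lia|].
    destruct (Gfun_blowup zeta beta n k0 Hz Hbeta Hn Hc M) as [d [Hdd Hw]].
    refine (proj2 (locally_C_iff (RtoC (ln (INR (S k0)))) _) _). exists d. split; [exact Hdd|].
    intros w Bw Nw. apply HP. apply Hw; auto.
  - intros z Hi. unfold varpi_fun. assert (N := C2PI_neq0).
    rewrite Cmult_assoc, Cinv_r, Cmult_1_l by auto. reflexivity.
Qed.
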